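(* A distribution $f\in\mathcal{S}'(\mathbb{R})$ has a quasi-asymptotics of degree $\alpha$ at infinity, i.e., $$f(x)\sim g(x)=\begin{cases} C_1x_+^{\alpha}+C_2x_-^{\alpha}, & \alpha\neq -k,\\ C_1P(x^{-k})+C_2\delta^{(k-1)}(x), & \alpha=-k,\end{cases}\qquad |x|\to\infty,$$ if and only if its Fourier transform $F[f]$ has a quasi-asymptotics of degree $-\alpha-1$ at zero, i.e., $$F[f](\xi)\sim F[g](\xi)=\begin{cases}\Gamma(\alpha+1)\big(B_1\xi_+^{-\alpha-1}+B_2\xi_-^{-\alpha-1}\big), & \alpha\neq-k,\\ C_1\dfrac{\pi i^{k}}{(k-1)!}\xi^{k-1}\operatorname{sign}\xi+C_2(-i\xi)^{k-1}, & \alpha=-k,\end{cases}\qquad |\xi|\to0,$$ where $C_1,C_2$ are constants, $B_1=C_1e^{i(\alpha+1)\pi/2}+C_2e^{-i(\alpha+1)\pi/2}$, $B_2=C_1e^{-i(\alpha+1)\pi/2}+C_2e^{i(\alpha+1)\pi/2}$, and $k\in\mathbb{N}$ (so the first line of each formula is for $\alpha\notin\{-1,-2,\dots\}$ and the second for $\alpha=-k$ with $k\in\mathbb{N}$).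
   Context: $\mathbb{N}=\{1,2,\dots\}$. $\mathcal{S}(\mathbb{R})$ is the Schwartz space and $\mathcal{S}'(\mathbb{R})$ its dual, with (weak) convergence tested on each element of $\mathcal{S}(\mathbb{R})$. The Fourier transform is $F[\varphi](\xi)=\int_{\mathbb{R}}e^{i\xi x}\varphi(x)\,dx$ on $\mathcal{S}(\mathbb{R})$ and $\langle F[f],\varphi\rangle=\langle f,F[\varphi]\rangle$ on $\mathcal{S}'(\mathbb{R})$. For $s>0$, $\langle f(sx),\varphi(x)\rangle=s^{-1}\langle f(x),\varphi(x/s)\rangle$. Automodel (regularly varying) function of degree $\alpha\in\mathbb{R}$: a positive continuous real-valued function $\rho$ such that $\lim_{t\to\infty}\rho(ta)/\rho(t)=a^{\alpha}$ for every $a>0$. Quasi-asymptotics at infinity: $f$ has the quasi-asymptotics $g$ of degree $\alpha$ at infinity, written $f(x)\sim g(x)$, $|x|\to\infty$, if there exists an automodel function $\rho(t)$, $t>0$, of degree $\alpha$ such that $f(tx)/\rho(t)\to g(x)\not\equiv0$ in $\mathcal{S}'(\mathbb{R})$ as $t\to\infty$. Quasi-asymptotics at zero: $f$ has the quasi-asymptotics $g$ of degree $-\alpha$ at zero, written $f(x)\sim g(x)$, $|x|\to0$, if there exists an automodel function $\rho(t)$, $t>0$, of degree $\alpha$ such that $f(x/t)/\rho(t)\to g(x)\not\equiv0$ in $\mathcal{S}'(\mathbb{R})$ as $t\to\infty$. The distributions $x_\pm^{\alpha}$, $\alpha\neq-1,-2,\dots$: if $\operatorname{Re}\alpha>-m-1$,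 $\alpha\ne-1,\dots,-m$ ($m\in\{0,1,2,\dots\}$), then for $\varphi\in\mathcal{S}(\mathbb{R})$ $$\langle x_+^{\alpha},\varphi\rangle=\int_0^1x^{\alpha}\Big(\varphi(x)-\sum_{j=0}^{m-1}\frac{x^j}{j!}\varphi^{(j)}(0)\Big)dx+\int_1^\infty x^{\alpha}\varphi(x)\,dx+\sum_{j=0}^{m-1}\frac{\varphi^{(j)}(0)}{j!(\alpha+j+1)},$$ and $\langle x_-^{\alpha},\varphi(x)\rangle=\langle x_+^{\alpha},\varphi(-x)\rangle$. Set $|x|^{\alpha}=x_+^{\alpha}+x_-^{\alpha}$ for $\alpha\neq-1,-3,-5,\dots$ and $|x|^{\alpha}\operatorname{sign}x=x_+^{\alpha}-x_-^{\alpha}$ for $\alpha\neq-2,-4,\dots$; these are well defined (by analytic continuation in $\alpha$) at the remaining negative integers. The principal values are $P(x^{-2k})=|x|^{-2k}$ and $P(x^{-2k+1})=|x|^{-2k+1}\operatorname{sign}x$, $k\in\mathbb{N}$. $\delta^{(k-1)}$ is the $(k-1)$-th derivative of the Dirac delta.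
   Formalization: For α=0,1,2,… the distributions ξ_±^{-α-1} are undefined, so Γ(α+1)(B1 ξ_+^{-α-1}+B2 ξ_-^{-α-1}) is read there as its limit in α with C1, C2 fixed, B1 and B2 varying with α. *)

(* Defs.v *)
(* C is the type R[i] over an arbitrary realType R. *)
From HB Require Import structures.
From mathcomp Require Import all_boot all_order all_algebra.
From mathcomp Require Import all_classical all_reals all_analysis.
From mathcomp.real_closed Require Import complex.

Set Implicit Arguments.
Unset Strict Implicit.
Unset Printing Implicit Defensive.

Import Order.TTheory GRing.Theory Num.Theory.
Import ComplexField.Normc.
Import numFieldNormedType.Exports.

Local Open Scope classical_set_scope.
Local Open Scope ring_scope.
Local Open Scope complex_scope.

(* MathComp-Analysis has no calculus for functions into R[i]: limits,         *)
(* derivatives and (Lebesgue) integrals are taken on real and imaginary parts.*)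
Section ComplexCalculus.
Context {R : realType}.
Implicit Types (u : R -> R[i]) (D : set R) (F : set_system R).

Definition ccvg F u (l : R[i]) : Prop :=
  (fun t => complex.Re (u t)) @ F --> complex.Re l /\
  (fun t => complex.Im (u t)) @ F --> complex.Im l.

Definition clim F u : R[i] :=
  lim ((fun t => complex.Re (u t)) @ F) +i* lim ((fun t => complex.Im (u t)) @ F).

Definition cderive (n : nat) u (x : R) : R[i] :=
  derive1n n (fun t => complex.Re (u t)) x
    +i* derive1n n (fun t => complex.Im (u t)) x.

Definition cintegral D u : R[i] :=
  (\int[lebesgue_measure]_(x in D) complex.Re (u x))
    +i* (\int[lebesgue_measure]_(x in D) complex.Im (u x)).

(* exp (i theta) *)
Definition cexpi (theta : R) : R[i] := cos theta +i* sin theta.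

(* The value at [a] of [u], extended by continuity across [a] when [a] is a   *)
(* removable singularity ([sing]); [u] itself is junk there.                  *)
Definition continued (sing : bool) u (a : R) : R[i] :=
  if sing then clim a^' u else u a.

End ComplexCalculus.

Section TemperedDistributions.
Context {R : realType}.
Implicit Types (phi psi : R -> R[i]).

Definition smooth phi : Prop := forall (n : nat) (x : R),
  derivable (derive1n n (fun t => complex.Re (phi t))) x 1 /\
  derivable (derive1n n (fun t => complex.Im (phi t))) x 1.

Definition schwartz phi : Prop :=
  smooth phi /\
  forall p q : nat, exists M : R, forall x : R,
    `|x| ^+ p * normc (cderive q phi x) <= M.

(* A functional is a function on all of R -> R[i] of which only the values on *)
(* Schwartz functions are meaningful; accordingly distributions are compared  *)
(* by [eqD] and never by Leibniz equality.                                    *)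
Definition functional := (R -> R[i]) -> R[i].
Implicit Types (f g : functional).

Definition eqD f g : Prop := forall phi, schwartz phi -> f phi = g phi.

Definition linear_on_schwartz f : Prop :=
  forall (a : R[i]) phi psi, schwartz phi -> schwartz psi ->
    f (fun x => a * phi x + psi x) = a * f phi + f psi.

(* Continuity for the topology of the seminorms sup_x |x^p phi^(q)(x)|. *)
Definition continuous_on_schwartz f : Prop :=
  forall phi, schwartz phi -> forall eps : R, 0 < eps ->
  exists (N : nat) (delta : R), 0 < delta /\
    forall psi, schwartz psi ->
      (forall p q : nat, (p <= N)%N -> (q <= N)%N -> forall x : R,
         `|x| ^+ p * normc (cderive q (fun y => psi y - phi y) x) <= delta) ->
      normc (f psi - f phi) < eps.

Definition tempered f : Prop := linear_on_schwartz f /\ continuous_on_schwartz f.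

Definition fourier phi (xi : R) : R[i] :=
  cintegral setT (fun x => cexpi (xi * x) * phi x).

Definition fourierD f : functional := fun phi => f (fourier phi).

(* f(s x), for s > 0 *)
Definition dilate f (s : R) : functional :=
  fun phi => (s^-1)%:C * f (fun x => phi (x / s)).

End TemperedDistributions.

Section QuasiAsymptotics.
Context {R : realType}.
Implicit Types (f g : @functional R) (rho : R -> R) (alpha : R).

(* Only the values of [rho] on the positive half-line matter. *)
Definition automodel alpha rho : Prop :=
  [/\ forall t : R, 0 < t -> 0 < rho t,
      forall t : R, 0 < t -> {for t, continuous rho}
    & forall a : R, 0 < a ->
        (fun t => rho (t * a) / rho t) @ +oo%R --> a `^ alpha].

Definition nonzeroD g : Prop := exists2 phi, schwartz phi & g phi <> 0.

Definition quasi_asymp_infty f alpha g : Prop :=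
  [/\ tempered f, tempered g, nonzeroD g
    & exists2 rho, automodel alpha rho &
        forall phi, schwartz phi ->
          ccvg +oo%R (fun t => ((rho t)^-1)%:C * dilate f t phi) (g phi)].

(* [degree] is the degree of the quasi-asymptotics, the opposite of that of   *)
(* [rho].                                                                     *)
Definition quasi_asymp_zero f (degree : R) g : Prop :=
  [/\ tempered f, tempered g, nonzeroD g
    & exists2 rho, automodel (- degree) rho &
        forall phi, schwartz phi ->
          ccvg +oo%R (fun t => ((rho t)^-1)%:C * dilate f t^-1 phi) (g phi)].

End QuasiAsymptotics.

Section Homogeneous.
Context {R : realType}.
Implicit Types (phi : R -> R[i]) (alpha : R).

(* x_+^alpha, for alpha not a negative integer. [Num.truncn (- alpha)] is the *)
(* least natural number m such that alpha > - m - 1.                          *)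
Definition x_plus alpha : functional := fun phi =>
  let m := Num.truncn (- alpha) in
  cintegral `]0, 1] (fun x => (x `^ alpha)%:C *
      (phi x - \sum_(j < m) (x ^+ j / j`!%:R)%:C * cderive j phi 0))
  + cintegral `[1, +oo[ (fun x => (x `^ alpha)%:C * phi x)
  + \sum_(j < m) cderive j phi 0 / (j`!%:R * (alpha + j%:R + 1))%:C.

Definition x_minus alpha : functional := fun phi =>
  x_plus alpha (fun x => phi (- x)).

Definition neg_int alpha : bool := (alpha \is a Num.int) && (alpha < 0).

(* |x|^alpha (alpha <> -1, -3, ..) and |x|^alpha sign x (alpha <> -2, -4, ..);*)
(* at the other negative integers the poles of x_+^beta and x_-^beta cancel.  *)
Definition abs_pow alpha : functional := fun phi =>
  continued (neg_int alpha) (fun beta => x_plus beta phi + x_minus beta phi)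
    alpha.

Definition abs_pow_sign alpha : functional := fun phi =>
  continued (neg_int alpha) (fun beta => x_plus beta phi - x_minus beta phi)
    alpha.

(* P(x^{-k}), for k >= 1 *)
Definition principal_value (k : nat) : functional := fun phi =>
  if odd k then abs_pow_sign (- k%:R) phi else abs_pow (- k%:R) phi.

Definition delta_deriv (n : nat) : functional := fun phi =>
  (-1) ^+ n * cderive n phi (0 : R).

(* Euler's Gamma, for s not in {0, -1, -2, ..}; [n] is 0 for s > 0, and in    *)
(* general the least natural number such that s + n > 0.                      *)
Definition Gamma (s : R) : R :=
  let n := Num.truncn (1 - s) in
  (\int[lebesgue_measure]_(x in `]0, +oo[)
      (x `^ (s + n%:R - 1) * expR (- x)))
  / \prod_(j < n) (s + j%:R).

Definition limit_infty alpha (C1 C2 : R[i]) : functional := fun phi =>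
  if neg_int alpha then
    let k := Num.truncn (- alpha) in
    C1 * principal_value k phi + C2 * delta_deriv k.-1 phi
  else C1 * x_plus alpha phi + C2 * x_minus alpha phi.

Definition B1 alpha (C1 C2 : R[i]) : R[i] :=
  C1 * cexpi ((alpha + 1) * pi / 2) + C2 * cexpi (- ((alpha + 1) * pi / 2)).

Definition B2 alpha (C1 C2 : R[i]) : R[i] :=
  C1 * cexpi (- ((alpha + 1) * pi / 2)) + C2 * cexpi ((alpha + 1) * pi / 2).

(* The explicit form of the Fourier transform of [limit_infty alpha C1 C2].   *)
(* When alpha is a natural number xi_+^{-alpha-1}                             *)
(* and xi_-^{-alpha-1} have poles, but these cancel in the combination with   *)
(* coefficients B1 and B2, which is then read by continuation in alpha (with  *)
(* C1 and C2 fixed).                                                          *)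
Definition limit_zero alpha (C1 C2 : R[i]) : functional := fun phi =>
  if neg_int alpha then
    let k := Num.truncn (- alpha) in
    cintegral setT (fun xi : R =>
      (C1 * (pi%:C * 'i ^+ k / (k.-1)`!%:R) * (xi ^+ k.-1 * Num.sg xi)%:C
       + C2 * (- 'i * xi%:C) ^+ k.-1) * phi xi)
  else
    continued (alpha \is a Num.nat)
      (fun beta => (Gamma (beta + 1))%:C *
         (B1 beta C1 C2 * x_plus (- beta - 1) phi
          + B2 beta C1 C2 * x_minus (- beta - 1) phi))
      alpha.

End Homogeneous.

(* Main.v *)
Require Import Defs.
From mathcomp Require Import all_boot all_order all_algebra.
From mathcomp Require Import all_classical all_reals all_analysis.
From mathcomp.real_closed Require Import complex.
From mathcomp Require Import measurable_realfun ring lra zify.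
Import Order.TTheory GRing.Theory Num.Theory.
Import numFieldNormedType.Exports.
Set Implicit Arguments.
Unset Strict Implicit.
Unset Printing Implicit Defensive.
Local Open Scope classical_set_scope.
Local Open Scope ring_scope.

(** A limit [g] of the rescaled distributions f(t x) / rho(t) is homogeneous:
    replacing t by t s changes rho(t) by the factor s^alpha in the limit
    ([homogeneous_infty], [homogeneous_zero]).  So two things have to be shown:
    which tempered distributions are homogeneous of a given degree, and how
    the Fourier transform acts on them.

    _Classification._  Differentiating g(phi(l x)) = l^(-gamma-1) g(phi) at
    l = 1 shows that g kills all x psi' + (gamma + 1) psi ([euler_equation]).
    For gamma > -1 the equation x psi' + (gamma + 1) psi = phi has the solution
    psi(x), the integral over 0 < u < 1 of u^gamma phi(u x), and psi is a
    Schwartz function exactly when the integrals of x^gamma phi(x) and of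
    x^gamma phi(-x) over the half-line vanish ([euler_solvable]).  Hence g
    vanishes on the common kernel of x_+^gamma and x_-^gamma, and is a
    combination of these two ([classification]).  When gamma <= -1 the Fourier
    transform of g is homogeneous of degree - gamma - 1 >= 0, and the previous
    case together with Fourier inversion gives g ([homogeneous_limit_infty]).

    _Fourier transforms._  For -1 < alpha < 0 the transform of x_+^alpha is the
    limit, as eps tends to 0, of that of x_+^alpha exp(- eps x), which is a
    multiple of (eps - i xi)^(-alpha-1) by a differential equation in xi
    ([dcos_dsin], [mellin_Fcos], [mellin_Fsin]).  Multiplication by x and
    differentiation, which the Fourier transform exchanges, move alpha by one
    in each direction and reach all non-integer exponents
    ([Fourier_rule_nonint], [homogeneous_fourier]).  Integer exponents are
    obtained as limits: at alpha = 0, 1, ... the left-hand side is continuous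
    in alpha, and at alpha = - k the simple zero of the trigonometric factor
    compensates the pole of Gamma ([pole_limit]).  Derivatives of delta are
    handled by differentiation of the transform under the integral
    ([cderive_fourier]).  All cases are collected in [fourier_limit_infty].

    _Equivalence._  The transform of f evaluated at the scale 1/t is t times f
    at the scale t applied to transforms ([dilate_fourier]), so the
    quasi-asymptotics of f with rho(t) and those of F[f] with t rho(t) are the
    same statement about the functions phi and F[phi]; as F is a bijection of
    the Schwartz space this is an equivalence ([quasi_asymp_fourier]).

    Fourier inversion is proved algebraically: an operator that turns
    multiplication by x into multiplication by - xi is a multiple of the
    reflection ([intertwine]), because by Hadamard's lemma a Schwartz function
    vanishing at a point is divisible by x - x0 within the Schwartz class.
    Analysis is done for real-valued functions, with cosine and sine
    transforms, and then carried over to real and imaginary parts. *)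

(** * Derivatives of real functions *)

Section RealCalculus.
Context {R : realType}.
Implicit Types (a b f g : R -> R) (x c : R).

Lemma derE f x l : is_derive x 1 f l -> (derive1 f) x = l.
Proof. by move=> H; rewrite derive1E; exact: derive_val. Qed.

Lemma derP f x : derivable f x 1 -> is_derive x 1 f ((derive1 f) x).
Proof. by move=> H; apply: DeriveDef => //; rewrite derive1E. Qed.

Lemma der_derivable f x l : is_derive x 1 f l -> derivable f x 1.
Proof. by case. Qed.

Lemma der_funE f g : (forall x, is_derive x 1 f (g x)) -> (derive1 f) = g.
Proof. by move=> H; apply/funext => x; exact: derE. Qed.

Lemma derD f g x l m : is_derive x 1 f l -> is_derive x 1 g m ->
  is_derive x 1 (fun t => f t + g t) (l + m).
Proof. exact: is_deriveD. Qed.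

Lemma derN f x l : is_derive x 1 f l -> is_derive x 1 (fun t => - f t) (- l).
Proof. exact: is_deriveN. Qed.

Lemma derB f g x l m : is_derive x 1 f l -> is_derive x 1 g m ->
  is_derive x 1 (fun t => f t - g t) (l - m).
Proof. exact: is_deriveB. Qed.

Lemma derM f g x l m : is_derive x 1 f l -> is_derive x 1 g m ->
  is_derive x 1 (fun t => f t * g t) (l * g x + f x * m).
Proof.
move=> H K; apply: is_derive_eq (is_deriveM H K) _.
by rewrite /GRing.scale /= addrC mulrC.
Qed.

Lemma derZ c f x l : is_derive x 1 f l -> is_derive x 1 (fun t => c * f t) (c * l).
Proof. exact: is_deriveZ. Qed.

Lemma dercomp f g x l m : is_derive (g x) 1 f l -> is_derive x 1 g m ->
  is_derive x 1 (fun t => f (g t)) (l * m).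
Proof. exact: is_derive1_comp. Qed.

Lemma der_id x : is_derive x 1 (fun t : R => t) 1.
Proof. exact: is_derive_id. Qed.

Lemma der_cst c x : is_derive x 1 (fun=> c) (0 : R).
Proof. exact: is_derive_cst. Qed.

Lemma der_aff c d x : is_derive x 1 (fun t : R => c * t + d) c.
Proof.
apply: is_derive_eq (derD (derZ c (der_id x)) (der_cst d x)) _.
by rewrite mulr1 addr0.
Qed.

Lemma der_congr f g x l m : is_derive x 1 f l ->
  (forall t, f t = g t) -> l = m -> is_derive x 1 g m.
Proof. by move=> + /funext <- <-. Qed.

Lemma derXn n x : is_derive x 1 (fun t : R => t ^+ n) (n%:R * x ^+ n.-1).
Proof.
apply: (der_congr (@is_deriveX R R id n x 1 1 (is_derive_id _ _))) => [t|].
  by rewrite fctE.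
by rewrite /GRing.scale /= mulr1.
Qed.

Lemma der_continuous f x l : is_derive x 1 f l -> {for x, continuous f}.
Proof. by case=> /derivable1_diffP /differentiable_continuous. Qed.

End RealCalculus.

(** * The real Schwartz class *)

Section SchwartzClass.
Context {R : realType}.
Implicit Types (a b f g : R -> R) (x c : R).

Definition sch a : Prop :=
  (forall n x, derivable (derive1n n a) x 1) /\
  (forall p q, exists M, forall x, `|x| ^+ p * `|derive1n q a x| <= M).

Definition decay a := forall p : nat, exists M, forall x, `|x| ^+ p * `|a x| <= M.

(** The Schwartz class is the largest class of differentiable functions of
    rapid decay that is stable under differentiation. To show that a function
    is Schwartz it thus suffices to exhibit such a class containing it, and no
    formula for higher derivatives is needed. *)
Lemma sch_coind (P : (R -> R) -> Prop) :
  (forall a, P a -> [/\ forall x, derivable a x 1, P (derive1 a) & decay a]) ->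
  forall a, P a -> sch a.
Proof.
move=> H a Pa; have K n : P (derive1n n a).
  by elim: n => [//|n /H [_ ? _]]; rewrite derive1nS.
by split => [n|p n]; case: (H _ (K n)) => // _ _ /(_ p).
Qed.

Lemma sch_derive a : sch a -> sch (derive1 a).
Proof.
move=> [H1 H2]; split => [n x|p q]; rewrite -?derive1Sn //; exact: H2.
Qed.

Lemma sch_der a : sch a -> forall x, is_derive x 1 a ((derive1 a) x).
Proof. by move=> [/(_ 0%N) H _] x; apply: derP; exact: H. Qed.

Lemma sch_continuous a : sch a -> continuous a.
Proof. by move=> H x; exact: der_continuous (sch_der H x). Qed.

Lemma sch_decay a : sch a -> decay a.
Proof. by move=> [_ H] p; have := H p 0%N. Qed.

Lemma decay_bound a p : decay a ->
  exists2 M, 0 < M & forall x, `|x| ^+ p * `|a x| <= M.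
Proof.
move=> /(_ p) [M H]; exists (Num.max M 1); first by rewrite lt_max ltr01 orbT.
by move=> x; rewrite le_max H.
Qed.

Lemma decayD a b : decay a -> decay b -> decay (fun x => a x + b x).
Proof.
move=> Ha Hb p; have [[M HM] [N HN]] := (Ha p, Hb p); exists (M + N) => x.
apply: le_trans (lerD (HM x) (HN x)); rewrite -mulrDr.
by rewrite ler_wpM2l ?exprn_ge0 // ler_normD.
Qed.

Lemma decayZ c a : decay a -> decay (fun x => c * a x).
Proof.
move=> Ha p; have [M HM] := Ha p; exists (`|c| * M) => x.
by rewrite normrM mulrCA ler_wpM2l.
Qed.

Lemma decayMx a : decay a -> decay (fun x => x * a x).
Proof.
by move=> Ha p; have [M HM] := Ha p.+1; exists M => x; rewrite normrM mulrA -exprSr.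
Qed.

Lemma schD a b : sch a -> sch b -> sch (fun x => a x + b x).
Proof.
move=> Ha Hb.
apply: (@sch_coind (fun f => exists a b, [/\ sch a, sch b & f = fun x => a x + b x]));
  last by exists a, b.
move=> {Ha Hb}_ {a b}[a [b [Ha Hb ->]]].
have D x := derD (sch_der Ha x) (sch_der Hb x).
split; [by move=> x; exact: der_derivable (D x)| |].
  by exists (derive1 a), (derive1 b); split; [exact: sch_derive..|exact: der_funE].
by apply: decayD; exact: sch_decay.
Qed.

Lemma schZ c a : sch a -> sch (fun x => c * a x).
Proof.
move=> Ha.
apply: (@sch_coind (fun f => exists2 a, sch a & f = fun x => c * a x)); last by exists a.
move=> {Ha}_ {a}[a Ha ->].
have D x := derZ c (sch_der Ha x).
split; [by move=> x; exact: der_derivable (D x)| |].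
  by exists (derive1 a); [exact: sch_derive|exact: der_funE].
by apply: decayZ; exact: sch_decay.
Qed.

Lemma schN a : sch a -> sch (fun x => - a x).
Proof. by move=> /(schZ (-1)); under eq_fun do rewrite mulN1r. Qed.

Lemma schB a b : sch a -> sch b -> sch (fun x => a x - b x).
Proof. by move=> Ha /schN Hb; exact: schD Ha Hb. Qed.

(** The functions x a(x) are not stable under differentiation, but the
    functions x a(x) + b(x) are. *)
Lemma schMx a : sch a -> sch (fun x => x * a x).
Proof.
move=> Ha.
apply: (@sch_coind
  (fun f => exists a b, [/\ sch a, sch b & f = fun x => x * a x + b x])); last first.
  exists a, (fun x => 0 * a x); split => //; first exact: schZ.
  by apply/funext => x; rewrite mul0r addr0.
move=> {Ha}_ {a}[a [b [Ha Hb ->]]].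
have D x := derD (derM (der_id x) (sch_der Ha x)) (sch_der Hb x).
split; [by move=> x; exact: der_derivable (D x)| |].
  exists (derive1 a), (fun x => a x + (derive1 b) x); split; first exact: sch_derive.
    by apply: schD => //; exact: sch_derive.
  by apply: der_funE => x; apply: is_derive_eq (D x) _; ring.
by apply: decayD; [apply: decayMx|]; exact: sch_decay.
Qed.

(** Compare |c x| with |d|: either y = c x + d is the larger of |y| and |d|
    and |c x| <= 2 |y|, or |c x| <= 2 |d| is bounded. *)
Lemma decay_affine c d a : c != 0 -> decay a -> decay (fun x => a (c * x + d)).
Proof.
move=> c0 Ha p.
have [M M0 HM] := decay_bound p Ha; have [N N0 HN] := decay_bound 0 Ha.
exists ((2 / `|c|) ^+ p * (M + `|d| ^+ p * N)) => x.
have -> : `|x| = `|c|^-1 * `|c * x| by rewrite normrM mulKf // normr_eq0.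
rewrite [(_ * `|c * x|) ^+ p]exprMn [(2 / _) ^+ p]exprMn [2 ^+ p * _]mulrC -!mulrA.
rewrite ler_wpM2l ?exprn_ge0 ?invr_ge0 //.
have := HM (c * x + d); have := HN (c * x + d).
rewrite expr0 mul1r; set y := c * x + d => h0 hp.
have hy : `|c * x| <= `|y| + `|d| by rewrite -[c * x](addrK d) ler_normB.
have [yd|dy] := leP `|y| `|d|.
  apply: (@le_trans _ _ ((2 * `|d|) ^+ p * `|a y|)).
    rewrite ler_wpM2r // lerXn2r ?nnegrE ?mulr_ge0 //.
    by rewrite (le_trans hy) // mulr_natl mulr2n lerD2r.
  rewrite exprMn -mulrA ler_wpM2l ?exprn_ge0 //.
  rewrite (le_trans (ler_wpM2l _ h0)) ?exprn_ge0 // lerDr; exact: ltW.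
apply: (@le_trans _ _ ((2 * `|y|) ^+ p * `|a y|)).
  rewrite ler_wpM2r // lerXn2r ?nnegrE ?mulr_ge0 //.
  by rewrite (le_trans hy) // mulr_natl mulr2n lerD2l ltW.
rewrite exprMn -mulrA ler_wpM2l ?exprn_ge0 // (le_trans hp) // lerDl.
by rewrite mulr_ge0 ?exprn_ge0 // ltW.
Qed.

Lemma sch_affine c d a : c != 0 -> sch a -> sch (fun x => a (c * x + d)).
Proof.
move=> c0 Ha.
apply: (@sch_coind (fun f => exists2 a, sch a & f = fun x => a (c * x + d)));
  last by exists a.
move=> {Ha}_ {a}[a Ha ->].
have D x := @dercomp _ a _ x _ _ (sch_der Ha (c * x + d)) (der_aff c d x).
split; [by move=> x; exact: der_derivable (D x)| |].
  exists (fun x => c * (derive1 a) x); first by apply: schZ; exact: sch_derive.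
  by apply: der_funE => x; apply: is_derive_eq (D x) _; rewrite mulrC.
by apply: decay_affine => //; exact: sch_decay.
Qed.

Lemma sch_scale c a : c != 0 -> sch a -> sch (fun x => a (c * x)).
Proof. by move=> c0 /(sch_affine 0 c0); under eq_fun do rewrite addr0. Qed.

Lemma sch_opp a : sch a -> sch (fun x => a (- x)).
Proof.
move=> Ha; have := @sch_scale (-1) a; rewrite oppr_eq0 oner_eq0 => /(_ isT Ha).
by under eq_fun do rewrite mulN1r.
Qed.

Definition gauss x : R := expR (- (x ^+ 2 / 2)).

Lemma gauss_der x : is_derive x 1 gauss (- x * gauss x).
Proof.
apply: (der_congr (dercomp (is_derive_expR _) (derN (derZ 2^-1 (derXn 2 x))))) => [t|].
  by rewrite /gauss [2^-1 * _]mulrC.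
by rewrite /gauss mulrC [_^-1 * _ ^+ 2]mulrC expr1; congr (_ * _); field.
Qed.

(** One term of the exponential series gives exp(y) >= y^p / p! at y = x^2 /
    2. *)
Lemma decay_gauss : decay gauss.
Proof.
move=> p; exists (1 + 2 ^+ p.+1 * p`!%:R) => x.
have [x1|x1] := leP `|x| 1.
  apply: (@le_trans _ _ 1); last by rewrite lerDl mulr_ge0 ?exprn_ge0.
  rewrite mulr_ile1 ?exprn_ge0 ?normr_ge0 //; first exact: exprn_ile1.
  rewrite /gauss ger0_norm ?expR_ge0 // expR_le1 oppr_le0.
  by rewrite mulr_ge0 ?sqr_ge0 // invr_ge0.
apply: (@le_trans _ _ (2 ^+ p.+1 * p`!%:R)); last by rewrite lerDr.
rewrite /gauss [`|expR _|]ger0_norm ?expR_ge0 // expRN ler_pdivrMr ?expR_gt0 //.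
set y := x ^+ 2 / 2.
have y0 : 0 <= y by rewrite mulr_ge0 ?sqr_ge0 // invr_ge0.
have yE : `|x| ^+ 2 = 2 * y by rewrite /y real_normK ?num_real //; field.
have h : y ^+ p / p`!%:R <= expR y.
  case: (p) => [|n]; last by rewrite (le_trans _ (expR_ge1Dxn n y0)) // lerDr.
  by rewrite expr0 fact0 divr1 -expR0 ler_expR.
rewrite ler_pdivrMr ?ltr0n ?fact_gt0 // in h.
apply: (@le_trans _ _ ((`|x| ^+ 2) ^+ p)).
  by rewrite lerXn2r ?nnegrE ?exprn_ge0 // expr2 ler_peMr // ltW.
have -> : 2 ^+ p.+1 * p`!%:R * expR y = 2 ^+ p * (2 * (expR y * p`!%:R)).
  by rewrite exprS; ring.
rewrite yE exprMn ler_wpM2l ?exprn_ge0 // (le_trans h) //.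
by apply: ler_peMl; [rewrite mulr_ge0 ?ler0n ?expR_ge0|lra].
Qed.

(** The products of a polynomial with the Gaussian are stable under
    differentiation. *)
Lemma sch_gauss : sch gauss.
Proof.
apply: (@sch_coind (fun f => exists p : {poly R}, f = fun x => p.[x] * gauss x));
  last by exists 1%:P; apply/funext => x; rewrite hornerC mul1r.
move=> _ [p ->]; have D x := derM (is_derive_poly p x) (gauss_der x).
split; [by move=> x; exact: der_derivable (D x)| |].
  exists (p^`() - 'X * p); apply: der_funE => x; apply: is_derive_eq (D x) _.
  rewrite hornerD hornerN hornerM hornerX.
  by move: (p^`().[x]) p.[x] (gauss x) => u v w; ring.
elim/poly_ind: p {D} => [|p c IH].
  by move=> n; exists 0 => x; rewrite horner0 mul0r normr0 mulr0.
have -> : (fun x => (p * 'X + c%:P).[x] * gauss x) =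
    (fun x => x * (p.[x] * gauss x) + c * gauss x).
  apply/funext => x; rewrite hornerD hornerMX hornerC.
  by move: p.[x] (gauss x) => u w; ring.
by apply: decayD; [exact: decayMx|apply: decayZ; exact: decay_gauss].
Qed.

End SchwartzClass.

Notation intg D f := ((@lebesgue_measure _).-integrable D (EFin \o f)).
Notation mble D := (@measurable _ (measurableTypeR _) D).

(** * Integrability and integrals of derivatives *)

Section IntegralTools.
Context {R : realType}.
Notation mu := (@lebesgue_measure R).
Implicit Types (f g h H : R -> R) (D E : set R) (x c : R).

Lemma meas_cont D h : mble D -> (forall x, D x -> {for x, continuous h}) ->
  measurable_fun D h.
Proof.
move=> mD ch; apply: subspace_continuous_measurable_fun => //.
by apply: continuous_in_subspaceT => x /set_mem /ch.
Qed.

Lemma intg_meas D f : intg D f -> measurable_fun D f.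
Proof. by move=> /(measurable_int mu) /measurable_EFinP. Qed.

Lemma intg_le D f g : mble D -> measurable_fun D f ->
  (forall x, D x -> `|f x| <= g x) -> intg D g -> intg D f.
Proof.
move=> mD mf fg; apply: le_integrable => //; first exact/measurable_EFinP.
by move=> x Dx; rewrite /= lee_fin (le_trans (fg x Dx)) // ler_norm.
Qed.

Lemma intgS D E f : mble D -> mble E -> D `<=` E -> intg E f -> intg D f.
Proof. by move=> mD mE sDE; exact: (integrableS mE mD sDE). Qed.

Lemma intgD D f g : mble D -> intg D f -> intg D g ->
  intg D (fun x => f x + g x).
Proof.
move=> mD If Ig; have := integrableD mD If Ig.
by apply: eq_integrable => // x _; rewrite /= EFinD.
Qed.

Lemma intgZ D c f : mble D -> intg D f -> intg D (fun x => c * f x).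
Proof.
by move=> mD If; have := integrableZl mD c If; apply: eq_integrable.
Qed.

Lemma intgN D f : mble D -> intg D f -> intg D (fun x => - f x).
Proof. by move=> mD /(intgZ (-1) mD); under eq_fun do rewrite mulN1r. Qed.

Lemma intg_eq D f g : {in D, f =1 g} -> mble D -> intg D f -> intg D g.
Proof. by move=> fg mD; apply: eq_integrable => // x Dx /=; rewrite fg. Qed.

Lemma intg_setU D E f : mble D -> mble E -> intg D f -> intg E f ->
  intg (D `|` E) f.
Proof.
move=> mD mE iD iE; have mf : measurable_fun (D `|` E) f.
  by apply/measurable_funU => //; split; exact: intg_meas.
apply/integrableP; split; first exact/measurable_EFinP.
have m1 F : mble F -> F `<=` D `|` E ->
    measurable_fun F (fun x => `|(EFin \o f) x|)%E.
  move=> mF sF; apply: measurableT_comp => //; apply/measurable_EFinP.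
  by apply: measurable_funS mf => //; exact: measurableU.
rewrite -(setDUK (@subsetUl _ D E)) ge0_integral_setU //.
- case/integrableP: iD => _ iD; case/integrableP: iE => _ iE.
  apply: lte_add_pinfty => //; apply: le_lt_trans iE.
  apply: ge0_subset_integral => //; first by apply: measurableD => //; exact: measurableU.
    by apply: m1.
  by move=> x [[]].
- by apply: measurableD => //; exact: measurableU.
- by rewrite setDUK //; apply: m1 => //; exact: measurableU.
- by apply/disj_setPS => x [? []].
Qed.

Lemma Rint_le D f g : mble D -> measurable_fun D f ->
  (forall x, D x -> `|f x| <= g x) -> intg D g ->
  `|\int[mu]_(x in D) f x| <= \int[mu]_(x in D) g x.
Proof.
move=> mD mf fg ig; have If := intg_le mD mf fg ig.
apply: le_trans; first exact: le_normr_Rintegral mD If.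
by apply: le_Rintegral => //; exact: integrable_norm If.
Qed.

Lemma FTC_segment (u v : R) H h : u < v ->
  (forall x, u <= x <= v -> is_derive x 1 H (h x)) ->
  (forall x, u <= x <= v -> {for x, continuous h}) ->
  (\int[mu]_(x in `[u, v]) (h x)%:E = (H v - H u)%:E)%E.
Proof.
move=> uv dH ch; rewrite (@continuous_FTC2 _ h H) //.
- by apply: continuous_in_subspaceT => x; rewrite inE /= in_itv /=; exact: ch.
- split.
  + move=> x; rewrite in_itv /= => /andP[/ltW ux /ltW xv].
    by apply: der_derivable (dH x _); rewrite ux.
  + apply: cvg_at_right_filter; apply: der_continuous (dH u _).
    by rewrite lexx ltW.
  + apply: cvg_at_left_filter; apply: der_continuous (dH v _).
    by rewrite lexx ltW.
- move=> x; rewrite in_itv /= => /andP[/ltW ux /ltW xv].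
  by apply: derE; apply: dH; rewrite ux.
Qed.

Section Exhaustion.
Variables (D : set R) (u v : nat -> R) (H h : R -> R).
Hypothesis mD : mble D.
Hypothesis uv : forall n, u n < v n.
Hypothesis uvD : forall n x, u n <= x <= v n -> D x.
Hypothesis Duv : forall x, D x -> \forall n \near \oo, u n <= x <= v n.
Hypothesis dH : forall x, D x -> is_derive x 1 H (h x).
Hypothesis ch : forall x, D x -> {for x, continuous h}.

Let h_ n := h \_ `[u n, v n].

Let mh : measurable_fun D h. Proof. exact: meas_cont. Qed.

Let uvsub n : `[u n, v n] `<=` D.
Proof. by move=> x; rewrite /= in_itv /=; exact: uvD. Qed.

Let mh_ n : measurable_fun D (h_ n).
Proof.
apply/measurable_restrict => //.
by apply: measurable_funS mh => //; exact: subIsetl.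
Qed.

Let int_h n : (\int[mu]_(x in D) (h_ n x)%:E = (H (v n) - H (u n))%:E)%E.
Proof.
have <- := @FTC_segment (u n) (v n) H h (uv n)
  (fun x hx => @dH x (@uvD n x hx)) (fun x hx => @ch x (@uvD n x hx)).
rewrite -[in RHS](setIidr (@uvsub n)) integral_mkcondr.
by apply: eq_integral => x _; rewrite /= restrict_EFin.
Qed.

Let h_cvg x : D x -> h_ n x @[n --> \oo] --> h x.
Proof.
move=> /Duv near_x; apply: cvg_near_cst; near=> n.
by rewrite /h_ patchE mem_set //= in_itv /=; near: n.
Unshelve. all: by end_near. Qed.

(** The domain is exhausted by the segments [u n, v n], to which the theorem
    for segments applies; dominated convergence gives the limit. *)
Lemma FTC_exhaust l0 l1 : intg D h ->
  H (u n) @[n --> \oo] --> l0 -> H (v n) @[n --> \oo] --> l1 ->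
  \int[mu]_(x in D) h x = l1 - l0.
Proof.
move=> ih c0 c1.
have /fine_cvgP[_ K] : (\int[mu]_(x in D) (h_ n x)%:E)%E @[n --> \oo] -->
    (fine (\int[mu]_(x in D) (h x)%:E))%:E.
  rewrite fineK; last exact: integrable_fin_num.
  apply: (@dominated_cvg _ _ _ mu _ mD (fun n x => (h_ n x)%:E) _ (fun x => `|h x|%:E)) => //.
  - by move=> n; apply/measurable_EFinP; exact: mh_.
  - by move=> x Dx; apply: cvg_EFin; [exact: nearW|exact: h_cvg].
  - exact: integrable_norm ih.
  - move=> n x Dx; rewrite /= lee_fin /h_ patchE.
    by case: ifP => // _; rewrite normr0.
apply: (cvg_unique (@Rhausdorff R) K).
have -> : fine \o (fun n => (\int[mu]_(x in D) (h_ n x)%:E)%E) =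
    (fun n => H (v n) - H (u n)).
  by apply/funext => n; rewrite /= int_h.
exact: cvgB.
Qed.

(** A nonnegative derivative is integrable once the increments of its
    primitive over the segments are bounded, by monotone convergence. *)
Lemma intg_exhaust C : (forall n, u n.+1 <= u n) -> (forall n, v n <= v n.+1) ->
  (forall x, D x -> 0 <= h x) -> (forall n, H (v n) - H (u n) <= C) -> intg D h.
Proof.
move=> du dv h0 HC.
apply/integrableP; split; first exact/measurable_EFinP.
have h_0 n x : D x -> 0 <= h_ n x.
  by move=> Dx; rewrite /h_ patchE; case: ifP => // _; exact: h0.
have nd x : D x -> {homo (fun n => (h_ n x)%:E) : n m / (n <= m)%N >-> (n <= m)%E}.
  move=> Dx; apply/nondecreasing_seqP => n; rewrite lee_fin /h_ !patchE.
  case: ifPn => [|_]; last by case: ifP => // _; exact: h0.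
  rewrite inE /= in_itv /= => /andP[ux xv].
  by rewrite mem_set // /= in_itv /= (le_trans (du n)) // (le_trans xv).
have K := @cvg_monotone_convergence _ _ _ mu D mD (fun n x => (h_ n x)%:E)
  (fun n => (measurable_EFinP _ _).2 (mh_ n)) (fun n x Dx => h_0 n x Dx) nd.
have -> : (\int[mu]_(x in D) `|(EFin \o h) x| =
   \int[mu]_(x in D) (fun x0 : R => limn (fun n => (h_ n x0)%:E)) x)%E.
  apply: eq_integral => x /set_mem Dx /=; rewrite ger0_norm ?h0 //.
  apply/esym/cvg_lim => //; apply: cvg_EFin; [exact: nearW|exact: h_cvg].
apply: (@le_lt_trans _ _ C%:E); last by rewrite ltry.
rewrite -(cvg_lim _ K) //; apply: lime_le.
  by apply/cvg_ex; eexists; exact: K.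
by apply: nearW => n; rewrite int_h lee_fin.
Qed.

End Exhaustion.

End IntegralTools.

(** * Improper integrals and powers *)

Section ImproperFTC.
Context {R : realType}.
Notation mu := (@lebesgue_measure R).
Implicit Types (f g h H : R -> R) (x c X : R).

Lemma cvg_seq_pinfty (f : R -> R) (l : R) (v : nat -> R) :
  (forall n : nat, n%:R <= v n) ->
  f x @[x --> +oo] --> l -> f (v n) @[n --> \oo] --> l.
Proof.
move=> hv; apply: cvg_comp => A [M [_ MA]].
suff: \forall n \near \oo, A (v n) by [].
near=> n; apply: MA; apply: (lt_le_trans _ (hv n)).
near: n; exact: nbhs_infty_gtr.
Unshelve. all: by end_near. Qed.

Lemma near_le_seq (v : nat -> R) (c : R) : (forall n : nat, n%:R <= v n) ->
  \forall n \near \oo, c <= v n.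
Proof.
move=> hv; near=> n; apply: le_trans (hv n).
near: n; exact: nbhs_infty_ger.
Unshelve. all: by end_near. Qed.

Lemma near_invS (c X : R) : 0 < c -> \forall n \near \oo, X / n.+2%:R <= c.
Proof.
move=> c0; near=> n; rewrite ler_pdivrMr ?ltr0n // mulrC -ler_pdivrMr //.
apply: (@le_trans _ _ n%:R); last by rewrite ler_nat ltnW.
near: n; exact: nbhs_infty_ger.
Unshelve. all: by end_near. Qed.

Lemma cvg_invS (f : R -> R) (l X : R) : 0 < X ->
  f x @[x --> 0^'+] --> l -> f (X / n.+2%:R) @[n --> \oo] --> l.
Proof.
move=> X0; apply: cvg_comp => A [e e0 eA].
suff: \forall n \near \oo, A (X / n.+2%:R) by [].
near=> n; have h : 0 < X / n.+2%:R by rewrite divr_gt0 ?ltr0n.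
apply: (eA _ _ h); rewrite /= sub0r normrN gtr0_norm ?divr_gt0 //.
apply: (@le_lt_trans _ _ (e / 2)); last by rewrite ltr_pdivrMr // ltr_pMr // ltr1n.
by near: n; apply: near_invS; rewrite divr_gt0.
Unshelve. all: by end_near. Qed.

Lemma FTC_T H h l0 l1 : (forall x, is_derive x 1 H (h x)) -> continuous h ->
  intg setT h -> H x @[x --> -oo] --> l0 -> H x @[x --> +oo] --> l1 ->
  \int[mu]_x h x = l1 - l0.
Proof.
move=> dH ch ih c0 c1.
apply: (@FTC_exhaust _ setT (fun n => - n.+1%:R) (fun n => n.+1%:R) H h) => //.
- by move=> n; apply: (@lt_trans _ _ 0); rewrite ?oppr_lt0 ltr0n.
- move=> x _; have h1 := @near_le_seq (fun n => n.+1%:R) x.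
  have h2 := @near_le_seq (fun n => n.+1%:R) (- x).
  near=> n; rewrite lerNl; apply/andP; split; near: n.
    by apply: h2 => n; rewrite ler_nat.
  by apply: h1 => n; rewrite ler_nat.
- by move=> x _; exact: ch.
- apply: (@cvg_seq_pinfty (H \o -%R)) => [n|]; first by rewrite ler_nat.
  exact/cvgNy_compNP.
- by apply: cvg_seq_pinfty => // n; rewrite ler_nat.
Unshelve. all: by end_near. Qed.

Lemma FTC_0y H h l0 l1 : (forall x, 0 < x -> is_derive x 1 H (h x)) ->
  (forall x, 0 < x -> {for x, continuous h}) ->
  intg `]0, +oo[ h -> H x @[x --> 0^'+] --> l0 -> H x @[x --> +oo] --> l1 ->
  \int[mu]_(x in `]0, +oo[) h x = l1 - l0.
Proof.
move=> dH ch ih c0 c1.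
have Dx x : `]0, +oo[%classic x -> 0 < x by rewrite /= in_itv /= andbT.
apply: (@FTC_exhaust _ _ (fun n => 1 / n.+2%:R) (fun n => n.+2%:R) H h) => //.
- by move=> n; rewrite ltr_pdivrMr ?ltr0n // -natrM ltr1n mulSn.
- move=> n x /andP[nx _]; rewrite /= in_itv /= andbT.
  by apply: lt_le_trans nx; rewrite divr_gt0 ?ltr0n.
- move=> x /Dx x0.
  have h1 := @near_le_seq (fun n => n.+2%:R) x; have h2 := near_invS 1 x0.
  near=> n; apply/andP; split; near: n => //.
  by apply: h1 => n; rewrite ler_nat ltnW.
- by move=> x /Dx; exact: dH.
- by move=> x /Dx; exact: ch.
- exact: cvg_invS.
- by apply: cvg_seq_pinfty => // n; rewrite ler_nat ltnW.
Unshelve. all: by end_near. Qed.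

Lemma FTC_0c H h l0 X : 0 < X ->
  (forall x, 0 < x <= X -> is_derive x 1 H (h x)) ->
  (forall x, 0 < x <= X -> {for x, continuous h}) ->
  intg `]0, X] h -> H x @[x --> 0^'+] --> l0 ->
  \int[mu]_(x in `]0, X]) h x = H X - l0.
Proof.
move=> X0 dH ch ih c0.
have Dx x : `]0, X]%classic x -> 0 < x <= X by rewrite /= in_itv.
apply: (@FTC_exhaust _ _ (fun n => X / n.+2%:R) (fun n => X) H h) => //.
- by move=> n; rewrite ltr_pdivrMr ?ltr0n // ltr_pMr // ltr1n.
- move=> n x /andP[nx xX]; rewrite /= in_itv /= xX andbT.
  by apply: lt_le_trans nx; rewrite divr_gt0 ?ltr0n.
- move=> x /Dx /andP[x0 xX]; have h2 := near_invS X x0.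
  by near=> n; rewrite xX andbT; near: n.
- exact: cvg_invS.
- exact: cvg_cst.
Unshelve. all: by end_near. Qed.

Lemma FTC_cy H h l1 X :
  (forall x, X <= x -> is_derive x 1 H (h x)) ->
  (forall x, X <= x -> {for x, continuous h}) ->
  intg `[X, +oo[ h -> H x @[x --> +oo] --> l1 ->
  \int[mu]_(x in `[X, +oo[) h x = l1 - H X.
Proof.
move=> dH ch ih c1.
have Dx x : `[X, +oo[%classic x -> X <= x by rewrite /= in_itv /= andbT.
have vn n : n%:R <= `|X| + n.+1%:R :> R.
  by rewrite -[leLHS]add0r lerD // ler_nat.
apply: (@FTC_exhaust _ _ (fun n => X) (fun n => `|X| + n.+1%:R) H h) => //.
- by move=> n; rewrite (le_lt_trans (ler_norm X)) // ltrDl ltr0n.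
- by move=> n x /andP[nx _]; rewrite /= in_itv /= andbT.
- move=> x /Dx xX; near=> n; rewrite xX /=; near: n.
  exact: near_le_seq.
- by move=> x /Dx; exact: dH.
- by move=> x /Dx; exact: ch.
- exact: cvg_cst.
- exact: cvg_seq_pinfty c1.
Unshelve. all: by end_near. Qed.

Lemma der_powR (g x : R) : 0 < x ->
  is_derive x 1 (fun t : R => t `^ g) (g * x `^ (g - 1)).
Proof. exact: is_derive1_powR. Qed.

Lemma powR_continuous (g x : R) : 0 < x -> {for x, continuous (fun t : R => t `^ g)}.
Proof. by move=> /(der_powR g); exact: der_continuous. Qed.

Lemma powRS (g x : R) : 0 < x -> x * x `^ g = x `^ (g + 1).
Proof. move=> x0; rewrite powRD; last by rewrite (gt_eqF x0) implybT.
by rewrite powRr1 ?ltW // mulrC. Qed.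

Lemma cvg_powR0 (g : R) : 0 < g -> x `^ g @[x --> 0^'+] --> (0 : R).
Proof.
move=> g0; apply/cvgr0Pnorm_lt => e e0; near=> x.
have x0 : 0 < x by near: x; exact: nbhs_right_gt.
rewrite ger0_norm ?powR_ge0 // -[ltRHS](powRr1 (ltW e0)) -(mulVf (lt0r_neq0 g0)).
rewrite powRrM gt0_ltr_powR ?nnegrE ?powR_ge0 ?ltW //.
by near: x; apply: nbhs_right_lt; rewrite powR_gt0.
Unshelve. all: by end_near. Qed.

Lemma intg_powR01 (g : R) : -1 < g -> intg `]0, 1] (fun x : R => x `^ g).
Proof.
move=> g1; have g0 : 0 < g + 1 by rewrite -ltrBlDr sub0r.
have Dx (x : R) : `]0, 1]%classic x -> 0 < x <= 1 by rewrite /= in_itv.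
apply: (@intg_exhaust _ _ (fun n => 1 / n.+2%:R) (fun n => 1)
  (fun x => (g + 1)^-1 * x `^ (g + 1)) _ _ _ _ _ _ _ (g + 1)^-1) => //.
- by move=> n; rewrite ltr_pdivrMr ?ltr0n // mul1r ltr1n.
- move=> n x /andP[nx xX]; rewrite /= in_itv /= xX andbT.
  by apply: lt_le_trans nx; rewrite divr_gt0 ?ltr0n.
- move=> x /Dx /andP[x0 xX]; have h2 := near_invS 1 x0.
  by near=> n; rewrite xX andbT; near: n.
- move=> x /Dx /andP[x0 _]; apply: is_derive_eq (derZ _ (der_powR (g + 1) x0)) _.
  by rewrite mulrA mulVf ?lt0r_neq0 // mul1r addrK.
- by move=> x /Dx /andP[x0 _]; exact: powR_continuous.
- by move=> n; rewrite !div1r lef_pV2 ?posrE ?ltr0n // ler_nat.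
- by move=> x _; exact: powR_ge0.
- by move=> n; rewrite powR1 mulr1 gerBl mulr_ge0 ?powR_ge0 // invr_ge0 ltW.
Unshelve. all: by end_near. Qed.

Lemma der_recip (x : R) : x != 0 -> is_derive x 1 (fun t : R => t^-1) (- (x ^- 2)).
Proof.
by move=> x0; apply: is_derive_eq (is_deriveV x0 (is_derive_id x 1)) _; rewrite /GRing.scale /= mulr1.
Qed.

Lemma intg_inv2 : intg `[1, +oo[ (fun x : R => x ^- 2).
Proof.
have Dx (x : R) : `[1, +oo[%classic x -> 1 <= x by rewrite /= in_itv /= andbT.
have D0 (x : R) : `[1, +oo[%classic x -> x != 0.
  by move=> /Dx x1; rewrite gt_eqF // (lt_le_trans _ x1).
apply: (@intg_exhaust _ _ (fun n => 1) (fun n => n.+2%:R)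
  (fun x => - x^-1) _ _ _ _ _ _ _ 1) => //.
- by move=> n; rewrite ltr1n.
- by move=> n x /andP[nx _]; rewrite /= in_itv /= andbT.
- move=> x /Dx xX; near=> n; rewrite xX /=; near: n.
  by apply: near_le_seq => n; rewrite ler_nat ltnW.
- by move=> x /D0 x0; apply: is_derive_eq (derN (der_recip x0)) _; rewrite opprK.
- move=> x /D0 x0.
  have := @dercomp _ (fun t : R => t^-1) (fun t => t ^+ 2) x _ _ (der_recip _) (derXn 2 x).
  by rewrite expf_eq0 /= => /(_ x0); exact: der_continuous.
- by move=> n; rewrite ler_nat.
- by move=> x /Dx x1; rewrite invr_ge0 exprn_ge0 // (le_trans ler01).
- by move=> n; rewrite invr1 opprK addrC gerBl invr_ge0 ler0n.
Unshelve. all: by end_near. Qed.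

Lemma intg_oneDsqr : intg setT (fun x : R => (1 + x ^+ 2)^-1).
Proof.
have q0 (x : R) : 1 + x ^+ 2 != 0 by rewrite gt_eqF // ltr_pwDl // sqr_ge0.
apply: (@intg_exhaust _ _ (fun n => - n.+1%:R) (fun n => n.+1%:R)
  atan _ _ _ _ _ _ _ pi) => //.
- by move=> n; apply: (@lt_trans _ _ 0); rewrite ?oppr_lt0 ltr0n.
- move=> x _; have h1 := @near_le_seq (fun n => n.+1%:R) x.
  have h2 := @near_le_seq (fun n => n.+1%:R) (- x).
  near=> n; rewrite lerNl; apply/andP; split; near: n.
    by apply: h2 => n; rewrite ler_nat.
  by apply: h1 => n; rewrite ler_nat.
- move=> x _; have := derD (der_cst 1 x) (derXn 2 x) => K.
  have := @dercomp _ (fun t : R => t^-1) _ x _ _ (der_recip (q0 x)) K.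
  exact: der_continuous.
- by move=> n; rewrite lerN2 ler_nat.
- by move=> n; rewrite ler_nat.
- by move=> x _; rewrite invr_ge0 addr_ge0 ?sqr_ge0.
- move=> n;
  have := atan_ltpi2 (n.+1%:R : R); have := atan_gtNpi2 (- n.+1%:R : R).
  by move: (atan _) (atan _) => u v; lra.
Unshelve. all: by end_near. Qed.

End ImproperFTC.

(** * Integrals of x^s a(x) over the half-line *)

Section Mellin.
Context {R : realType}.
Notation mu := (@lebesgue_measure R).
Implicit Types (a b f g h : R -> R) (x c X L U s : R).

(** Decay and continuity are only asked on the open half-line: exp(- eps x)
    grows on the negative side. *)
Definition hdecay a := forall p : nat, exists M, forall x, 0 < x -> x ^+ p * `|a x| <= M.

Definition hcont a := forall x, 0 < x -> {for x, continuous a}.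

(** The Mellin transform of a at s + 1; for s > -1 this is the value of x_+^s
    at a. *)
Definition mellin s a := \int[mu]_(x in `]0, +oo[) (x `^ s * a x).

Lemma in0y x : `]0, +oo[%classic x -> 0 < x.
Proof. by rewrite /= in_itv /= andbT. Qed.

Lemma mbl0y : mble (`]0, +oo[%classic : set R).
Proof. exact: measurable_itv. Qed.
Local Hint Resolve mbl0y : core.

Lemma decay_hdecay a : decay a -> hdecay a.
Proof. by move=> Ha p; have [M H] := Ha p; exists M => x x0; rewrite -{1}(gtr0_norm x0). Qed.

Lemma hdecay_bound a p : hdecay a ->
  exists2 M, 0 < M & forall x, 0 < x -> x ^+ p * `|a x| <= M.
Proof.
move=> /(_ p) [M H]; exists (Num.max M 1); first by rewrite lt_max ltr01 orbT.
by move=> x x0; rewrite le_max H.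
Qed.

Lemma hdecayZ c a : hdecay a -> hdecay (fun x => c * a x).
Proof.
move=> Ha p; have [M HM] := Ha p; exists (`|c| * M) => x x0.
by rewrite normrM mulrCA ler_wpM2l // HM.
Qed.

Lemma hdecayD a b : hdecay a -> hdecay b -> hdecay (fun x => a x + b x).
Proof.
move=> Ha Hb p; have [[M HM] [N HN]] := (Ha p, Hb p); exists (M + N) => x x0.
apply: le_trans (lerD (HM x x0) (HN x x0)); rewrite -mulrDr.
by rewrite ler_wpM2l ?exprn_ge0 ?ler_normD // ltW.
Qed.

Lemma hdecayMb c a b : (forall x, 0 < x -> `|b x| <= c) -> hdecay a ->
  hdecay (fun x => a x * b x).
Proof.
move=> Hb Ha p; have [M M0 HM] := hdecay_bound p Ha; exists (M * c) => x x0.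
by rewrite normrM mulrA ler_pM ?mulr_ge0 ?exprn_ge0 ?Hb ?HM // ltW.
Qed.

Lemma hcontZ c a : hcont a -> hcont (fun x => c * a x).
Proof. by move=> ca x x0; apply: cvgM; [exact: cvg_cst|exact: ca]. Qed.

Lemma hcontM a b : hcont a -> hcont b -> hcont (fun x => a x * b x).
Proof. by move=> ca cb x x0; apply: cvgM; [exact: ca|exact: cb]. Qed.

Lemma hcontD a b : hcont a -> hcont b -> hcont (fun x => a x + b x).
Proof. by move=> ca cb x x0; apply: cvgD; [exact: ca|exact: cb]. Qed.

Lemma hcont_pow s : hcont (fun x => x `^ s).
Proof. by move=> x; exact: powR_continuous. Qed.

(** Dominates x^s a(x), up to a constant, for all s >= L in a bounded set,
    whence the continuity of [mellin] in s. *)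
Definition majorant L x : R := if x <= 1 then x `^ L else x ^- 2.

Lemma intg_majorant L : -1 < L -> intg `]0, +oo[ (majorant L).
Proof.
move=> L1; have -> : `]0, +oo[%classic = `]0, 1]%classic `|` `]1, +oo[%classic :> set R.
    by rewrite -itv_bndbnd_setU // bnd_simp.
apply: intg_setU; [exact: measurable_itv|exact: measurable_itv| |].
  apply: intg_eq (intg_powR01 L1); last exact: measurable_itv.
  by move=> x; rewrite inE /= in_itv /= => /andP[_ x1]; rewrite /majorant x1.
apply: (@intg_eq _ _ (fun x => x ^- 2)); last 2 first.
- exact: measurable_itv.
- apply: intgS intg_inv2; [exact: measurable_itv|exact: measurable_itv|].
  by move=> x; rewrite /= !in_itv /= !andbT; exact: ltW.
- by move=> x; rewrite inE /= in_itv /= andbT => x1; rewrite /majorant leNgt x1.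
Qed.

Lemma majorant_ge0 L x : 0 <= majorant L x.
Proof.
by rewrite /majorant; case: ifP => _; [exact: powR_ge0|rewrite invr_ge0 sqr_ge0].
Qed.

Lemma mellin_bound a L U : hdecay a -> exists2 M, 0 < M &
  forall s x, L <= s <= U -> 0 < x -> `|x `^ s * a x| <= M * majorant L x.
Proof.
(* For x > 1 the power x^s is at most x^n, for any natural n >= U. *)
move=> Ha; pose n := Num.bound `|U|.
have [M0 M00 H0] := hdecay_bound 0 Ha; have [M1 M10 H1] := hdecay_bound n.+2 Ha.
exists (M0 + M1) => [|s x /andP[Ls sU] x0]; first by rewrite addr_gt0.
rewrite normrM ger0_norm ?powR_ge0 // /majorant.
have := H0 x x0; have := H1 x x0; rewrite expr0 mul1r => h1 h0.
case: ifPn => [x1|]; last rewrite -ltNge => x1.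
  rewrite mulrC ler_pM ?powR_ge0 //.
    by rewrite (le_trans h0) // lerDl ltW.
  by apply: ger_powR => //; rewrite x0.
apply: (@le_trans _ _ (M1 * x ^- 2)); last first.
  by rewrite ler_wpM2r ?invr_ge0 ?sqr_ge0 // lerDr ltW.
rewrite ler_pdivlMr ?exprn_gt0 //; apply: le_trans h1.
have -> : x ^+ n.+2 * `|a x| = x ^+ n * `|a x| * x ^+ 2.
  by rewrite -addn2 exprD; ring.
rewrite ler_wpM2r ?sqr_ge0 // ler_wpM2r //.
rewrite -(powR_mulrn n (ltW x0)); apply: ler_powR; first exact: ltW.
by rewrite (le_trans sU) // ltW // (le_lt_trans (ler_norm U)) // archi_boundP.
Qed.

Lemma mellin_meas s a : hcont a ->
  measurable_fun (`]0, +oo[%classic : set (measurableTypeR R)) (fun x => x `^ s * a x).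
Proof.
move=> ca; apply: meas_cont => // x /in0y.
by apply: hcontM => //; exact: hcont_pow.
Qed.

Lemma mellin_intg s a : -1 < s -> hcont a -> hdecay a ->
  intg `]0, +oo[ (fun x => x `^ s * a x).
Proof.
move=> s1 ca da; have [M M0 HM] := mellin_bound s s da.
apply: (@intg_le _ _ _ (fun x => M * majorant s x)) => //.
- exact: mellin_meas.
- by move=> x /in0y x0; rewrite HM // lexx.
- by apply: intgZ => //; exact: intg_majorant.
Qed.

Lemma powR_exponent_continuous x : 0 < x -> continuous (fun s : R => x `^ s).
Proof.
move=> x0 s; have := @dercomp _ expR (fun s => ln x * s) s _ _ (is_derive_expR _)
  (derZ (ln x) (der_id s)).
move/der_continuous; rewrite (_ : (fun s => _) = (fun s => x `^ s)) //.
by apply/funext => t; rewrite /powR gt_eqF // mulrC.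
Qed.

Lemma mellin_continuous a s : -1 < s -> hcont a -> hdecay a ->
  {for s, continuous (fun t => mellin t a)}.
Proof.
move=> s1 ca da; pose L := (s - 1) / 2; pose U := s + 1.
have L1 : -1 < L by rewrite /L; lra.
have [M M0 HM] := mellin_bound L U da.
apply: (@continuity_under_integral _ _ _ mu (fun t x => x `^ t * a x) _ mbl0y L U _ _
  (fun x => M * majorant L x)).
- move=> t; rewrite /= in_itv /= => /andP[Lt tU].
  by apply: mellin_intg => //; exact: lt_trans Lt.
- apply: aeW => x /in0y x0 t _; apply: cvgM; last exact: cvg_cst.
  exact: powR_exponent_continuous.
- by apply: intgZ => //; exact: intg_majorant.
- move=> t; rewrite /= in_itv /= => /andP[/ltW Lt /ltW tU]; apply: aeW => x /in0y x0.
  by rewrite HM // Lt.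
- by rewrite inE /= in_itv /=; rewrite /L /U; lra.
Qed.

Lemma mellinZ c s a : -1 < s -> hcont a -> hdecay a ->
  mellin s (fun x => c * a x) = c * mellin s a.
Proof.
move=> s1 ca da; rewrite /mellin -RintegralZl //; last exact: mellin_intg.
by apply: eq_Rintegral => x _; ring.
Qed.

Lemma mellinD s a b : -1 < s -> hcont a -> hdecay a -> hcont b -> hdecay b ->
  mellin s (fun x => a x + b x) = mellin s a + mellin s b.
Proof.
move=> s1 ca da cb db; rewrite /mellin -RintegralD //; try exact: mellin_intg.
by apply: eq_Rintegral => x _; rewrite mulrDr.
Qed.

Lemma mellinMx s a : mellin s (fun x => x * a x) = mellin (s + 1) a.
Proof.
rewrite /mellin; apply: eq_Rintegral => x /set_mem /in0y x0.
by rewrite -powRS //; ring.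
Qed.

Lemma eq_mellin s a b : (forall x, 0 < x -> a x = b x) -> mellin s a = mellin s b.
Proof. by move=> ab; apply: eq_Rintegral => x /set_mem /in0y /ab ->. Qed.

(** If the integral vanished, the positive integrand would be zero almost
    everywhere, but the half-line is not negligible. *)
Lemma mellin_gt0 s a : -1 < s -> hcont a -> hdecay a -> (forall x, 0 < x -> 0 < a x) ->
  0 < mellin s a.
Proof.
move=> s1 ca da a0.
rewrite lt_neqAle; apply/andP; split; last first.
  by apply: Rintegral_ge0 => x /in0y x0; rewrite mulr_ge0 ?powR_ge0 // ltW // a0.
apply/eqP => K; have iM := mellin_intg s1 ca da.
pose D : set (measurableTypeR R) := `]0, +oo[%classic.
have E0 : (\int[mu]_(x in D) `|(x `^ s * a x)%:E| = 0)%E.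
  transitivity (\int[mu]_(x in D) (x `^ s * a x)%:E)%E.
    apply: eq_integral => x /set_mem /in0y x0.
    by rewrite gee0_abs // lee_fin mulr_ge0 ?powR_ge0 // ltW // a0.
  rewrite -[LHS]fineK; last exact: integrable_fin_num.
  by rewrite [fine _](_ : _ = mellin s a) // -K.
have mf : measurable_fun D (fun x => (x `^ s * a x)%:E).
  by apply/measurable_EFinP; exact: mellin_meas.
have [N [mN N0 sub]] := (ae_eq_integral_abs mu mbl0y mf).1 E0.
have DN : D `<=` N.
  move=> x Dx; apply: sub => /(_ Dx) /eqP; apply/negP.
  by rewrite eqe mulf_neq0 // ?gt_eqF ?powR_gt0 ?a0 //; exact: in0y.
have : (mu D <= mu N)%E by apply: le_measure => //; rewrite inE //; exact: mbl0y.
rewrite N0 /D lebesgue_measure_itv /= ltry.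
by rewrite leye_eq.
Qed.

Lemma cvg_mellin_pinfty s a : hdecay a -> x `^ s * a x @[x --> +oo] --> (0 : R).
Proof.
move=> da; have [M M0 HM] := mellin_bound (s + 1) (s + 1) da.
apply/cvgr0Pnorm_le => e e0; near=> x.
have x1 : 1 < x by near: x; exact: nbhs_pinfty_gt.
have x0 : 0 < x by exact: lt_trans x1.
have := HM (s + 1) x; rewrite lexx => /(_ isT x0).
rewrite /majorant (lt_geF x1) -powRS // -mulrA normrM [`|x|]gtr0_norm // => h.
apply: (@le_trans _ _ (M / x)).
  rewrite ler_pdivlMr // mulrC (le_trans h) // ger_pMr // invf_le1 ?exprn_gt0 //.
  by rewrite exprn_ege1 // ltW.
by rewrite ler_pdivrMr // mulrC -ler_pdivrMr // ltW.
Unshelve. all: by end_near. Qed.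

Lemma cvg_mellin_0 s a : 0 < s -> hdecay a -> x `^ s * a x @[x --> 0^'+] --> (0 : R).
Proof.
move=> s0 da; have [M M0 HM] := hdecay_bound 0 da.
apply/cvgr0Pnorm_le => e e0; near=> x.
have x0 : 0 < x by near: x; exact: nbhs_right_gt.
rewrite normrM ger0_norm ?powR_ge0 //.
have := HM x x0; rewrite expr0 mul1r => h.
apply: (@le_trans _ _ (x `^ s * M)); first by rewrite ler_wpM2l ?powR_ge0.
rewrite -ler_pdivlMr // -[leLHS]ger0_norm ?powR_ge0 //.
near: x; move: (cvg_powR0 s0) => /cvgr0Pnorm_le; apply.
by rewrite divr_gt0.
Unshelve. all: by end_near. Qed.

Lemma mellin_parts s a b : 0 < s ->
  (forall x, 0 < x -> is_derive x 1 a (b x)) -> hcont b -> hdecay a -> hdecay b ->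
  mellin s b = - s * mellin (s - 1) a.
Proof.
move=> s0 dab cb da db.
have ca : hcont a by move=> x /dab; exact: der_continuous.
have s1 : -1 < s - 1 by rewrite ltrBrDl subrr.
have s2 : -1 < s by apply: lt_trans s0; rewrite ltrN10.
have dH x : 0 < x -> is_derive x 1 (fun x => x `^ s * a x)
    (s * (x `^ (s - 1) * a x) + x `^ s * b x).
  by move=> x0; apply: is_derive_eq (derM (der_powR s x0) (dab x x0)) _; rewrite mulrA.
have i1 := mellin_intg s1 ca da; have i2 := mellin_intg s2 cb db.
have := @FTC_0y _ _ _ 0 0 dH _ _ (cvg_mellin_0 s0 da) (cvg_mellin_pinfty s da).
rewrite subr0 RintegralD //; last exact: intgZ.
rewrite RintegralZl // => K; apply/eqP.
rewrite mulNr -subr_eq0 opprK addrC; apply/eqP; apply: K.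
  move=> x x0; apply: hcontD => // {x0}x x0.
    by apply: hcontZ => // {x0}x x0; apply: hcontM => //; exact: hcont_pow.
  by apply: hcontM => //; exact: hcont_pow.
by apply: intgD => //; exact: intgZ.
Qed.

Lemma mellin0_parts a b : (forall x, 0 < x -> is_derive x 1 a (b x)) -> hcont b ->
  hdecay a -> hdecay b -> a x @[x --> 0^'+] --> a 0 -> mellin 0 b = - a 0.
Proof.
move=> dab cb da db a0.
have -> : mellin 0 b = \int[mu]_(x in `]0, +oo[) b x.
  by apply: eq_Rintegral => x _; rewrite powRr0 mul1r.
rewrite -[RHS]add0r; apply: (FTC_0y dab cb) => //.
  apply: intg_eq (mellin_intg (ltrN10 R) cb db) => //.
  by move=> x _; rewrite powRr0 mul1r.
have := cvg_mellin_pinfty 0 da; apply: cvg_trans; apply: near_eq_cvg.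
by near=> x; rewrite powRr0 mul1r.
Unshelve. all: by end_near. Qed.

End Mellin.

(** * The Euler equation in the Schwartz class *)

Section EulerEquation.
Context {R : realType}.
Notation mu := (@lebesgue_measure R).
Implicit Types (a b f g h : R -> R) (x c X s : R).

Lemma sch_hdecay a : sch a -> hdecay a.
Proof. by move=> /sch_decay /decay_hdecay. Qed.

Lemma sch_hcont a : sch a -> hcont a.
Proof. by move=> /sch_continuous ca x _; exact: ca. Qed.

(** The solution of x b'(x) + (s + 1) b(x) = a(x) that is smooth at 0. *)
Definition average s a x := \int[mu]_(u in `]0, 1]) (u `^ s * a (u * x)).

Lemma in01 (u : R) : `]0, 1]%classic u -> 0 < u <= 1.
Proof. by rewrite /= in_itv. Qed.

Lemma mbl01 : mble (`]0, 1]%classic : set R).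
Proof. exact: measurable_itv. Qed.
Local Hint Resolve mbl01 : core.

Lemma hcont_arg a x : sch a -> continuous (fun u : R => a (u * x)).
Proof.
move=> Ha u; have K : is_derive u 1 (fun u => u * x) x.
  by apply: (der_congr (der_aff x 0 u)) => // t; rewrite addr0 mulrC.
exact: der_continuous (@dercomp _ a _ u _ _ (sch_der Ha _) K).
Qed.

Lemma average_meas s a x : sch a ->
  measurable_fun (`]0, 1]%classic : set (measurableTypeR R)) (fun u => u `^ s * a (u * x)).
Proof.
move=> Ha; apply: meas_cont => // u /in01 /andP[u0 _].
by apply: cvgM; [exact: powR_continuous|exact: hcont_arg].
Qed.

Lemma average_intg s a x : -1 < s -> sch a -> intg `]0, 1] (fun u => u `^ s * a (u * x)).
Proof.
move=> s1 Ha; have [M M0 HM] := decay_bound 0 (sch_decay Ha).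
apply: (@intg_le _ _ _ (fun u => M * u `^ s)) => //; first exact: average_meas.
- move=> u _; rewrite normrM ger0_norm ?powR_ge0 // mulrC ler_wpM2r ?powR_ge0 //.
  by have := HM (u * x); rewrite expr0 mul1r.
- by apply: intgZ => //; exact: intg_powR01.
Qed.

Lemma average_bound s a : -1 < s -> sch a -> exists2 C, 0 < C & forall x, `|average s a x| <= C.
Proof.
move=> s1 Ha; have [M M0 HM] := decay_bound 0 (sch_decay Ha).
exists (1 + \int[mu]_(u in `]0, 1]) (M * u `^ s)) => [|x].
  rewrite ltr_pwDl // Rintegral_ge0 // => u _; rewrite mulr_ge0 ?powR_ge0 //; exact: ltW.
apply: (@le_trans _ _ (\int[mu]_(u in `]0, 1]) (M * u `^ s))); last by rewrite lerDr.
apply: Rint_le => //; first exact: average_meas.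
- move=> u _; rewrite normrM ger0_norm ?powR_ge0 // mulrC ler_wpM2r ?powR_ge0 //.
  by have := HM (u * x); rewrite expr0 mul1r.
- by apply: intgZ => //; exact: intg_powR01.
Qed.

Lemma average_der s a x : -1 < s -> sch a ->
  is_derive x 1 (average s a) (average (s + 1) (derive1 a) x).
Proof.
move=> s1 Ha; have Ha' := sch_derive Ha.
have [M M0 HM] := decay_bound 0 (sch_decay Ha').
pose f x (u : R) := u `^ s * a (u * x).
have df (t u : R) : 0 < u -> is_derive t 1 (f ^~ u) (u `^ (s + 1) * derive1 a (u * t)).
  move=> u0; have K : is_derive t 1 (fun x => u * x) u.
    by apply: (der_congr (der_aff u 0 t)) => // ?; rewrite addr0.
  apply: is_derive_eq (derZ (u `^ s) (@dercomp _ a _ t _ _ (sch_der Ha _) K)) _.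
  by rewrite -powRS //; ring.
have If t : `]x - 1, x + 1[%classic t -> intg `]0, 1] (f t).
  by move=> _; exact: average_intg.
have I0 : `]x - 1, x + 1[%classic x by rewrite /= in_itv /=; lra.
have D t u : `]x - 1, x + 1[%classic t -> `]0, 1]%classic u -> derivable (f ^~ u) t 1.
  by move=> _ /in01 /andP[u0 _]; exact: der_derivable (df t u u0).
have G0 u : 0 <= M * u `^ s by rewrite mulr_ge0 ?powR_ge0 // ltW.
have iG : intg `]0, 1] (fun u => M * u `^ s) by apply: intgZ => //; exact: intg_powR01.
have Gb t u : `]x - 1, x + 1[%classic t -> `]0, 1]%classic u ->
    `|partial1of2 f t u| <= M * u `^ s.
  move=> _ /in01 /andP[u0 u1]; rewrite /partial1of2 (derE (df t u u0)).
  rewrite -powRS // normrM [in leLHS]ger0_norm ?mulr_ge0 ?powR_ge0 ?(ltW u0) //.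
  rewrite mulrC ler_pM ?mulr_ge0 ?powR_ge0 ?(ltW u0) //.
    by have := HM (u * t); rewrite expr0 mul1r.
  by rewrite ler_piMl ?powR_ge0.
have d1 := @derivable_under_integral R _ _ mu f _ mbl01 x _ _ I0 If D _ G0 iG Gb.
have d2 := @differentiation_under_integral R _ _ mu f _ mbl01 x _ _ I0 If D _ G0 iG Gb.
apply: DeriveDef => //; rewrite -derive1E.
rewrite [LHS]d2; apply: eq_Rintegral => u /set_mem /in01 /andP[u0 _].
by rewrite /partial1of2 (derE (df x u u0)).
Qed.

(** The left-hand side is the integral over 0 < u < 1 of the derivative of
    u^(s+1) a(u x) in u. *)
Lemma average_eq s a x : -1 < s -> sch a ->
  x * average (s + 1) (derive1 a) x + (s + 1) * average s a x = a x.
Proof.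
move=> s1 Ha; have Ha' := sch_derive Ha.
have s0 : 0 < s + 1 by rewrite -ltrBlDr sub0r.
have s2 : -1 < s + 1 by apply: lt_trans s0; rewrite ltrN10.
have dH (u : R) : 0 < u <= 1 -> is_derive u 1 (fun u => u `^ (s + 1) * a (u * x))
    (x * (u `^ (s + 1) * derive1 a (u * x)) + (s + 1) * (u `^ s * a (u * x))).
  move=> /andP[u0 _]; have K : is_derive u 1 (fun u => u * x) x.
    by apply: (der_congr (der_aff x 0 u)) => // t; rewrite addr0 mulrC.
  apply: is_derive_eq (derM (der_powR _ u0) (@dercomp _ a _ u _ _ (sch_der Ha _) K)) _.
  by rewrite addrK; ring.
have i1 := average_intg x s2 Ha'; have i2 := average_intg x s1 Ha.
rewrite /average -!RintegralZl // -RintegralD //; try exact: intgZ.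
rewrite (FTC_0c (l0 := 0) ltr01 dH); first by rewrite powR1 !mul1r subr0.
- move=> u /andP[u0 _]; apply: cvgD; apply: cvgM; try exact: cvg_cst.
    by apply: cvgM; [exact: powR_continuous|exact: hcont_arg].
  by apply: cvgM; [exact: powR_continuous|exact: hcont_arg].
- by apply: intgD => //; exact: intgZ.
- rewrite -[X in _ --> X](mul0r (a (0 * x))); apply: cvgM; first exact: cvg_powR0.
  by apply: cvg_at_right_filter; exact: (hcont_arg Ha).
Qed.

(** x^(s+1) b(x), for b the average of a, is the primitive of x^s a(x) that
    vanishes at 0. *)
Lemma average_antideriv s a X : -1 < s -> sch a -> 0 < X ->
  \int[mu]_(y in `]0, X]) (y `^ s * a y) = X `^ (s + 1) * average s a X.
Proof.
move=> s1 Ha X0; have s0 : 0 < s + 1 by rewrite -ltrBlDr sub0r.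
have dH x : 0 < x <= X -> is_derive x 1 (fun x => x `^ (s + 1) * average s a x)
    (x `^ s * a x).
  move=> /andP[x0 _].
  apply: is_derive_eq (derM (der_powR _ x0) (average_der x s1 Ha)) _.
  by rewrite addrK -[in RHS](average_eq x s1 Ha) -powRS //; ring.
rewrite (FTC_0c (l0 := 0) X0 dH) ?subr0 //.
- move=> x /andP[x0 _]; apply: cvgM; first exact: powR_continuous.
  exact: sch_continuous.
- apply: intgS (mellin_intg s1 (sch_hcont Ha) (sch_hdecay Ha)).
  + exact: measurable_itv.
  + exact: measurable_itv.
  + by move=> x; rewrite /= !in_itv /= andbT => /andP[].
- have [C C0 HC] := average_bound s1 Ha.
  apply/cvgr0Pnorm_le => e e0; near=> x.
  rewrite normrM; apply: (@le_trans _ _ (`|x `^ (s + 1)| * C)); first by rewrite ler_wpM2l.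
  rewrite -ler_pdivlMr //; near: x; move: (cvg_powR0 s0) => /cvgr0Pnorm_le; apply.
  by rewrite divr_gt0.
Unshelve. all: by end_near. Qed.

(** If x^s a(x) has integral zero over the half-line, its integral over ]0, X]
    is minus the integral over ]X, +oo[, which decays rapidly. *)
Lemma average_tail s a p : -1 < s -> sch a -> mellin s a = 0 ->
  exists C, forall X, 1 <= X -> X ^+ p * `|average s a X| <= C.
Proof.
move=> s1 Ha Ma.
have sp1 : -1 < s + p%:R by rewrite (lt_le_trans s1) // lerDl.
have [M M0 HM] := mellin_bound (s + p%:R) (s + p%:R) (sch_hdecay Ha).
have iG : intg `]0, +oo[ (fun x => M * majorant (s + p%:R) x).
  by apply: intgZ; [exact: mbl0y|exact: intg_majorant].
exists (\int[mu]_(x in `]0, +oo[) (M * majorant (s + p%:R) x)) => X X1.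
have X0 : 0 < X by rewrite (lt_le_trans _ X1).
have i1 := mellin_intg s1 (sch_hcont Ha) (sch_hdecay Ha).
have mX : mble (`]X, +oo[%classic : set R) by exact: measurable_itv.
have sX : `]X, +oo[ `<=` `]0, +oo[%classic.
  by move=> x; rewrite /= !in_itv /= !andbT; exact: lt_trans.
have E : \int[mu]_(y in `]X, +oo[) (y `^ s * a y) = - (X `^ (s + 1) * average s a X).
  have := Rintegral_itvB (x := X) i1; rewrite -/(mellin s a) Ma average_antideriv //.
  by rewrite sub0r => <- //; rewrite bnd_simp ltW.
have -> : X ^+ p * `|average s a X| =
    (X `^ (- (s + 1))) * X ^+ p * `|\int[mu]_(y in `]X, +oo[) (y `^ s * a y)|.
  rewrite E normrN normrM [`|X `^ _|]ger0_norm ?powR_ge0 // powRN.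
  by field; rewrite gt_eqF // powR_gt0.
have i2 := intgS mX mbl0y sX i1.
apply: (@le_trans _ _ (\int[mu]_(y in `]X, +oo[) (M * majorant (s + p%:R) y))).
  apply: (@le_trans _ _ (X ^+ p * `|\int[mu]_(y in `]X, +oo[) (y `^ s * a y)|)).
    rewrite -mulrA ler_piMl ?mulr_ge0 ?exprn_ge0 ?(ltW X0) //.
    rewrite powRN invf_le1 ?powR_gt0 //.
    have : X `^ 0 <= X `^ (s + 1) by apply: ler_powR; lra.
    by rewrite powRr0.
  rewrite -[X ^+ p]ger0_norm ?exprn_ge0 ?(ltW X0) // -normrM -RintegralZl //.
  apply: Rint_le => //.
  - by apply: intg_meas; apply: intgZ.
  - move=> y; rewrite /= in_itv /= andbT => Xy; have y0 : 0 < y by exact: lt_trans Xy.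
    have := HM (s + p%:R) y; rewrite lexx => /(_ isT y0); apply: le_trans.
    rewrite mulrA !normrM ler_wpM2r //.
    rewrite powRD; last by rewrite (gt_eqF y0) implybT.
    rewrite powR_mulrn ?(ltW y0) // normrM mulrC ler_wpM2l // !normrX.
    by rewrite !gtr0_norm // lerXn2r ?nnegrE ?ltW.
  - exact: intgS iG.
rewrite /Rintegral fine_le //.
- by apply: integrable_fin_num => //; exact: intgS iG.
- by apply: integrable_fin_num => //; exact: mbl0y.
- apply: ge0_subset_integral => //.
    by apply/measurable_EFinP; exact: intg_meas.
  by move=> x _; rewrite lee_fin mulr_ge0 ?majorant_ge0 // ltW.
Qed.

Lemma decay_average s a : -1 < s -> sch a -> mellin s a = 0 ->
  mellin s (fun x => a (- x)) = 0 -> decay (average s a).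
Proof.
move=> s1 Ha M1 M2 p.
have [C1 H1] := average_tail p s1 Ha M1.
have [C2 H2] := average_tail p s1 (sch_opp Ha) M2.
have [C C0 HC] := average_bound s1 Ha.
exists (Num.max C (Num.max C1 C2)) => x; rewrite !le_max.
have [x1|x1] := leP `|x| 1.
  apply/orP; left; apply: le_trans (HC x).
  by rewrite ler_piMl // exprn_ile1.
apply/orP; right; apply/orP; have [x0|x0] := leP 0 x.
  by left; rewrite (ger0_norm x0) H1 // -(ger0_norm x0) ltW.
right; rewrite (ltr0_norm x0) (_ : average s a x = average s (fun x => a (- x)) (- x)).
  by apply: H2; rewrite -(ltr0_norm x0) ltW.
by apply: eq_Rintegral => u _; rewrite mulrN opprK.
Qed.

Lemma derive1_opp a : sch a -> derive1 (fun x => a (- x)) = (fun x => - derive1 a (- x)).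
Proof.
move=> Ha; apply: der_funE => x.
have := @dercomp _ a (fun x => - x) x _ _ (sch_der Ha _) (derN (der_id x)).
by move/is_derive_eq; apply; rewrite mulrN1.
Qed.

Lemma mellin_sch_parts s a : 0 < s -> sch a ->
  mellin s (derive1 a) = - s * mellin (s - 1) a.
Proof.
move=> s0 Ha; have Ha' := sch_derive Ha.
apply: mellin_parts => //; [by move=> x _; exact: sch_der|exact: sch_hcont|..];
  exact: sch_hdecay.
Qed.

Lemma mellin_sch0_parts a : sch a -> mellin 0 (derive1 a) = - a 0.
Proof.
move=> Ha; have Ha' := sch_derive Ha.
apply: mellin0_parts; [by move=> x _; exact: sch_der|exact: sch_hcont|..];
  try exact: sch_hdecay.
by apply: cvg_at_right_filter; exact: sch_continuous.
Qed.

Lemma mellin_sch_derive_opp s a : -1 < s -> sch a ->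
  mellin s (fun x => derive1 a (- x)) = - mellin s (derive1 (fun x => a (- x))).
Proof.
move=> s1 Ha; rewrite derive1_opp // -[RHS]mulN1r -mellinZ //.
- by apply: eq_mellin => x _; rewrite mulN1r opprK.
- by apply: sch_hcont; apply: schN; apply: sch_opp; exact: sch_derive.
- by apply: sch_hdecay; apply: schN; apply: sch_opp; exact: sch_derive.
Qed.

(** The averages of exponents s > -1 of functions with vanishing moments form
    a class stable under differentiation: the derivative of the average of a
    with exponent s is that of a' with exponent s + 1, and integration by
    parts gives the moment condition for a'. *)
Lemma sch_average s a : -1 < s -> sch a -> mellin s a = 0 ->
  mellin s (fun x => a (- x)) = 0 -> sch (average s a).
Proof.
move=> s1 Ha M1 M2.
apply: (@sch_coind _ (fun f => exists s a, [/\ -1 < s, sch a, mellin s a = 0,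
  mellin s (fun x => a (- x)) = 0 & f = average s a])); last by exists s, a.
move=> {s1 Ha M1 M2}_ {s a}[s [a [s1 Ha M1 M2 ->]]].
have D x := average_der x s1 Ha.
split; [by move=> x; exact: der_derivable (D x)| |exact: decay_average].
have s0 : 0 < s + 1 by rewrite -ltrBlDr sub0r.
have s2 : -1 < s + 1 by apply: lt_trans s0; rewrite ltrN10.
exists (s + 1), (derive1 a); split => //; first exact: sch_derive.
- by rewrite mellin_sch_parts // addrK M1 mulr0.
- rewrite mellin_sch_derive_opp // mellin_sch_parts //; last exact: sch_opp.
  by rewrite addrK M2 mulr0 oppr0.
- exact: der_funE.
Qed.

(** The values of x_+^s and x_-^s are the only obstructions to solving the
    Euler equation in the Schwartz class. *)
Lemma euler_solvable s a : -1 < s -> sch a -> mellin s a = 0 ->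
  mellin s (fun x => a (- x)) = 0 ->
  exists2 b, sch b & forall x, x * derive1 b x + (s + 1) * b x = a x.
Proof.
move=> s1 Ha M1 M2; exists (average s a); first exact: sch_average.
by move=> x; rewrite (derE (average_der x s1 Ha)) average_eq.
Qed.

(** Hadamard's lemma. The quotient a(x) / x is the average of a' with exponent
    0, and the moment conditions for a' reduce to a(0) = 0. *)
Lemma sch_divx a : sch a -> a 0 = 0 -> exists2 b, sch b & forall x, a x = x * b x.
Proof.
move=> Ha a0; have Ha' := sch_derive Ha; have n1 : -1 < 0 :> R by rewrite ltrN10.
exists (average 0 (derive1 a)).
  apply: sch_average => //; first by rewrite mellin_sch0_parts // a0 oppr0.
  rewrite mellin_sch_derive_opp // mellin_sch0_parts; last exact: sch_opp.
  by rewrite oppr0 a0 !oppr0.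
move=> x; apply/eqP; rewrite -subr_eq0; apply/eqP.
rewrite -[LHS]/((fun x => a x - x * average 0 (derive1 a) x) x).
transitivity (a 0 - 0 * average 0 (derive1 a) 0); last by rewrite a0 mul0r subrr.
apply: (@is_derive_0_is_cst _ (fun x => a x - x * average 0 (derive1 a) x)) => y.
apply: is_derive_eq (derB (sch_der Ha y) (derM (der_id y) (average_der y n1 Ha'))) _.
have := average_eq y n1 Ha'; rewrite add0r mul1r => <-.
by rewrite [X in X - _]addrC subrr.
Qed.

End EulerEquation.

(** * Linear changes of variables *)

Section ChangeOfVariables.
Context {R : realType}.
Notation mu := (@lebesgue_measure R).
Implicit Types (a b f g h : R -> R) (x c X s : R).

Section Pushforward.
Variables (phi : measurableTypeR R -> measurableTypeR R) (k : R).
Hypothesis mphi : measurable_fun setT phi.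
Hypothesis k0 : 0 < k.
Hypothesis phi_itv : forall u v : R, u < v ->
  mu (phi @^-1` (`]u, v]%classic : set R)) = (k^-1 * (v - u))%:E.

Let image_measure : {measure set (measurableTypeR R) -> \bar R} :=
  measure_function_pushforward__canonical__measure_function_Measure mu mphi.
Let nu := mscale (NngNum (ltW k0)) image_measure.

(** Both sides are measures which agree on bounded intervals, and these
    determine Lebesgue measure. *)
Lemma pushforward_lebesgue (A : set (measurableTypeR R)) : measurable A ->
  mu A = (k%:E * pushforward mu phi A)%E.
Proof.
move=> mA; rewrite (@lebesgue_measure_unique _ nu) // => _ [[u v] _ <-].
change (mu (`]u, v]%classic : set R) =
  k%:E * mu (phi @^-1` (`]u, v]%classic : set R)))%E.
have [uv|vu] := ltP u v; last by rewrite set_itv_ge ?preimage_set0 ?measure0 ?mule0 // bnd_simp -leNgt.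
by rewrite phi_itv // lebesgue_measure_itv /= lte_fin uv -EFinM mulrA mulfV ?gt_eqF // mul1r.
Qed.

Lemma Rint_pushforward f (D : set (measurableTypeR R)) : measurable D ->
  measurable_fun [set: measurableTypeR R] f -> intg (phi @^-1` D) (f \o phi) ->
  \int[mu]_(x in phi @^-1` D) f (phi x) = k^-1 * \int[mu]_(x in D) f x.
Proof.
move=> mD mf If; have mf' : measurable_fun setT (EFin \o f) by exact/measurable_EFinP.
have E : (\int[mu]_(y in D) (f y)%:E = \int[nu]_(y in D) (f y)%:E)%E.
  apply: eq_measure_integral => A mA _.
  by first [exact: pushforward_lebesgue|exact/esym/pushforward_lebesgue].
have Ii : image_measure.-integrable D (EFin \o f) by exact: integrable_pushforward.
have {}E : (\int[mu]_(y in D) (f y)%:E = k%:E * \int[image_measure]_(y in D) (f y)%:E)%E.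
  rewrite E integralE [in RHS]integralE.
  have mfD : measurable_fun D (EFin \o f) by exact: measurable_funTS.
  rewrite !ge0_integral_mscale //; [|exact: measurable_funeneg|exact: measurable_funepos].
  rewrite [in RHS]muleBr //; exact: integrable_add_def.
rewrite /Rintegral E integral_pushforward //= fineM //; last first.
  by apply: integrable_fin_num => //; rewrite -[_ @^-1` _]setTI; exact: mphi.
by rewrite mulrA mulVf ?gt_eqF // mul1r.
Qed.

End Pushforward.

Lemma preimage_scale_itv c u v : 0 < c ->
  ( *%R c) @^-1` `]u, v]%classic = `]u / c, v / c]%classic :> set R.
Proof.
move=> c0; apply/seteqP; split => x; rewrite /= !in_itv /= => /andP[].
  by move=> h1 h2; rewrite ltr_pdivrMr // ler_pdivlMr // mulrC h1.
by rewrite ltr_pdivrMr // ler_pdivlMr // mulrC => -> ->.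
Qed.

Lemma Rint_scale c f : 0 < c -> measurable_fun [set: measurableTypeR R] f ->
  intg setT (fun x => f (c * x)) ->
  \int[mu]_x f (c * x) = c^-1 * \int[mu]_x f x.
Proof.
move=> c0 mf If.
have mphi : measurable_fun [set: measurableTypeR R] ( *%R c : measurableTypeR R -> measurableTypeR R).
  exact: mulrl_measurable.
have := @Rint_pushforward ( *%R c) c mphi c0 _ f setT.
rewrite preimage_setT; apply => // u v uv.
rewrite preimage_scale_itv // lebesgue_measure_itv /= lte_fin ltr_pM2r ?invr_gt0 // uv.
by rewrite -EFinB; congr EFin; ring.
Qed.

Lemma Rint_opp f (D : set (measurableTypeR R)) : measurable D ->
  measurable_fun [set: measurableTypeR R] f ->
  intg [set x | D (- x)] (fun x => f (- x)) ->
  \int[mu]_(x in [set x | D (- x)]) f (- x) = \int[mu]_(x in D) f x.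
Proof.
move=> mD mf If.
have mphi : measurable_fun [set: measurableTypeR R] (-%R : measurableTypeR R -> measurableTypeR R).
  exact: oppr_measurable.
have := @Rint_pushforward -%R 1 mphi ltr01 _ f D; rewrite invr1 mul1r; apply => // u v uv.
rewrite [_ @^-1` _](_ : _ = `[- v, - u[%classic); last first.
  apply/seteqP; split => x; rewrite /= !in_itv /= => /andP[].
    by move=> h1 h2; rewrite lerNl h2 ltrNr h1.
  by rewrite lerNl ltrNr => -> ->.
rewrite lebesgue_measure_itv /= lte_fin ltrN2 uv -EFinB; congr EFin; ring.
Qed.

Lemma Rint_split f : measurable_fun [set: measurableTypeR R] f -> intg setT f ->
  intg setT (fun x => f (- x)) ->
  \int[mu]_x f x = \int[mu]_(x in `]0, +oo[) f x + \int[mu]_(x in `]0, +oo[) f (- x).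
Proof.
move=> mf If IfN.
have mN : mble (`]-oo, 0[%classic : set R) by exact: measurable_itv.
have mC : mble (`]-oo, 0]%classic : set R) by exact: measurable_itv.
have -> : setT = `]-oo, 0]%classic `|` `]0, +oo[%classic :> set (measurableTypeR R).
  by rewrite -itv_bndbnd_setU // set_itvE.
rewrite Rintegral_setU //; last 2 first.
- by apply: intgS If => //; apply: measurableU => //; exact: mbl0y.
- apply/disj_setPS => x [/=]; rewrite !in_itv /= andbT => h1 h2.
  by move: (lt_le_trans h2 h1); rewrite ltxx.
rewrite addrC; congr (_ + _).
have E : `]0, +oo[%classic = [set x | (`]-oo, 0[%classic : set (measurableTypeR R)) (- x)].
  by apply/seteqP; split => x; rewrite /= !in_itv /= ?andbT oppr_lt0.
rewrite -Rintegral_itv_bndo_bndc; last by apply: intgS If.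
rewrite [in RHS]E Rint_opp //.
by apply: intgS IfN => //; rewrite -E; exact: mbl0y.
Qed.

End ChangeOfVariables.

(** * Cosine and sine transforms *)

Section RealFourier.
Context {R : realType}.
Notation mu := (@lebesgue_measure R).
Implicit Types (a b f g h : R -> R) (x c X s xi : R).

Definition Fcos a xi := \int[mu]_x (cos (xi * x) * a x).
Definition Fsin a xi := \int[mu]_x (sin (xi * x) * a x).

Lemma cvg_decay_pinfty a : decay a -> a x @[x --> +oo] --> (0 : R).
Proof.
move=> da; have := cvg_mellin_pinfty 0 (decay_hdecay da).
by under eq_fun do rewrite powRr0 mul1r.
Qed.

Lemma decay_opp a : decay a -> decay (fun x => a (- x)).
Proof. by move=> Ha p; have [M H] := Ha p; exists M => x; rewrite -normrN. Qed.

Lemma cvg_decay_ninfty a : decay a -> a x @[x --> -oo] --> (0 : R).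
Proof. by move=> /decay_opp /cvg_decay_pinfty ?; exact/cvgNy_compNP. Qed.

Lemma decay_dom a : decay a -> exists2 M, 0 < M & forall x, `|a x| <= M * (1 + x ^+ 2)^-1.
Proof.
move=> da; have [M0 M00 H0] := decay_bound 0 da; have [M2 M20 H2] := decay_bound 2 da.
exists (M0 + M2) => [|x]; first by rewrite addr_gt0.
rewrite ler_pdivlMr; last by rewrite ltr_pwDl // sqr_ge0.
have := H0 x; have := H2 x; rewrite real_normK ?num_real // expr0 mul1r; lra.
Qed.

Lemma intg_kernel (k : R -> R) a : continuous a -> decay a -> continuous k ->
  (forall x, `|k x| <= 1) -> intg setT (fun x => k x * a x).
Proof.
move=> ca da ck k1; have [M M0 HM] := decay_dom da.
apply: (@intg_le _ _ _ (fun x => M * (1 + x ^+ 2)^-1)) => //.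
- by apply: meas_cont => // x _; apply: cvgM; [exact: ck|exact: ca].
- by move=> x _; rewrite normrM (le_trans _ (HM x)) // ler_piMl.
- by apply: intgZ => //; exact: intg_oneDsqr.
Qed.

(** K does not depend on the kernel or on the function; the continuity of the
    Fourier transform for the Schwartz topology rests on this uniformity. *)
Lemma kernel_bound : exists2 K : R, 0 < K & forall (k : R -> R) a M, continuous a -> continuous k ->
  (forall x, `|k x| <= 1) -> (forall x, `|a x| <= M * (1 + x ^+ 2)^-1) ->
  `|\int[mu]_x (k x * a x)| <= K * M.
Proof.
exists (1 + \int[mu]_x (1 + x ^+ 2)^-1).
  by rewrite ltr_pwDl // Rintegral_ge0 // => x _; rewrite invr_ge0 addr_ge0 ?sqr_ge0.
move=> k a M ca ck k1 HM.
have M0 : 0 <= M.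
  by have := HM 0; rewrite expr0n addr0 invr1 mulr1; exact: le_trans.
apply: (@le_trans _ _ (\int[mu]_x (M * (1 + x ^+ 2)^-1))).
  apply: Rint_le => //.
  - by apply: meas_cont => // x _; apply: cvgM; [exact: ck|exact: ca].
  - by move=> x _; rewrite normrM (le_trans _ (HM x)) // ler_piMl.
  - by apply: intgZ => //; exact: intg_oneDsqr.
rewrite RintegralZl //; last exact: intg_oneDsqr.
by rewrite mulrC ler_wpM2r // lerDr.
Qed.

Lemma cosx_continuous xi : continuous (fun x : R => cos (xi * x)).
Proof.
move=> x; have K : is_derive x 1 (fun x => xi * x) xi.
  by apply: (der_congr (der_aff xi 0 x)) => // ?; rewrite addr0.
exact: der_continuous (@dercomp _ cos _ x _ _ (is_derive_cos _) K).
Qed.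

Lemma sinx_continuous xi : continuous (fun x : R => sin (xi * x)).
Proof.
move=> x; have K : is_derive x 1 (fun x => xi * x) xi.
  by apply: (der_congr (der_aff xi 0 x)) => // ?; rewrite addr0.
exact: der_continuous (@dercomp _ sin _ x _ _ (is_derive_sin _) K).
Qed.

Lemma normr_cos_le1 (t : R) : `|cos t| <= 1.
Proof. by rewrite ler_norml cos_geN1 cos_le1. Qed.

Lemma normr_sin_le1 (t : R) : `|sin t| <= 1.
Proof. by rewrite ler_norml sin_geN1 sin_le1. Qed.

Lemma intg_cos xi a : continuous a -> decay a -> intg setT (fun x => cos (xi * x) * a x).
Proof.
by move=> ca da; apply: intg_kernel => // [|x]; [exact: cosx_continuous|exact: normr_cos_le1].
Qed.

Lemma intg_sin xi a : continuous a -> decay a -> intg setT (fun x => sin (xi * x) * a x).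
Proof.
by move=> ca da; apply: intg_kernel => // [|x]; [exact: sinx_continuous|exact: normr_sin_le1].
Qed.

Lemma intg_decay a : continuous a -> decay a -> intg setT a.
Proof.
move=> ca da; have := intg_cos 0 ca da; apply: intg_eq => // x _.
by rewrite mul0r cos0 mul1r.
Qed.

(** Differentiation under the integral for a majorant that is global in the
    parameter, with the derivative given explicitly. *)
Lemma der_underint (f df : R -> R -> R) (G : R -> R) (D : set (measurableTypeR R)) xi :
  measurable D -> (forall t, intg D (f t)) ->
  (forall t x : R, D x -> is_derive t 1 (f ^~ x) (df t x)) ->
  (forall x, 0 <= G x) -> intg D G -> (forall t x, D x -> `|df t x| <= G x) ->
  is_derive xi 1 (fun t => \int[mu]_(x in D) f t x) (\int[mu]_(x in D) df xi x).
Proof.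
move=> mD If Hd G0 iG Gb.
have I0 : `]xi - 1, xi + 1[%classic xi by rewrite /= in_itv /=; lra.
have D' t x : `]xi - 1, xi + 1[%classic t -> D x -> derivable (f ^~ x) t 1.
  by move=> _ Dx; exact: der_derivable (Hd t x Dx).
have Gb' t x : `]xi - 1, xi + 1[%classic t -> D x -> `|partial1of2 f t x| <= G x.
  by move=> _ Dx; rewrite /partial1of2 (derE (Hd t x Dx)) Gb.
have d1 := @derivable_under_integral R _ _ mu f _ mD xi _ _ I0 (fun t _ => If t) D' _ G0 iG Gb'.
have d2 := @differentiation_under_integral R _ _ mu f _ mD xi _ _ I0 (fun t _ => If t) D' _ G0 iG Gb'.
apply: DeriveDef => //; rewrite -derive1E.
rewrite [LHS]d2; apply: eq_Rintegral => x /set_mem Dx.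
by rewrite /partial1of2 (derE (Hd xi x Dx)).
Qed.

Lemma Fcos_der a xi : sch a -> is_derive xi 1 (Fcos a) (- Fsin (fun x => x * a x) xi).
Proof.
move=> Ha; have Hx := schMx Ha.
have cx := sch_continuous Hx; have dx := sch_decay Hx.
have df (t x : R) : is_derive t 1 (fun t => cos (t * x) * a x) (- (sin (t * x) * (x * a x))).
  have K : is_derive t 1 (fun t => t * x) x.
    by apply: (der_congr (der_aff x 0 t)) => // ?; rewrite addr0 mulrC.
  apply: is_derive_eq (derM (@dercomp _ cos _ t _ _ (is_derive_cos _) K) (der_cst _ t)) _.
  by ring.
apply: is_derive_eq; first apply: (@der_underint (fun t x => cos (t * x) * a x) _
  (fun x => `|x * a x|) setT xi measurableT _ (fun t x _ => df t x)).
- by move=> t; apply: intg_cos; [exact: sch_continuous|exact: sch_decay].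
- by [].
- by have := integrable_norm (intg_decay cx dx).
- by move=> t x _; rewrite normrN normrM ler_piMl // normr_sin_le1.
- rewrite -[RHS]mulN1r /Fsin -RintegralZl //; last exact: intg_sin.
  by apply: eq_Rintegral => x _; rewrite mulN1r.
Qed.

Lemma Fsin_der a xi : sch a -> is_derive xi 1 (Fsin a) (Fcos (fun x => x * a x) xi).
Proof.
move=> Ha; have Hx := schMx Ha.
have cx := sch_continuous Hx; have dx := sch_decay Hx.
have df (t x : R) : is_derive t 1 (fun t => sin (t * x) * a x) (cos (t * x) * (x * a x)).
  have K : is_derive t 1 (fun t => t * x) x.
    by apply: (der_congr (der_aff x 0 t)) => // ?; rewrite addr0 mulrC.
  apply: is_derive_eq (derM (@dercomp _ sin _ t _ _ (is_derive_sin _) K) (der_cst _ t)) _.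
  by ring.
apply: (@der_underint (fun t x => sin (t * x) * a x) (fun t x => cos (t * x) * (x * a x))
  (fun x => `|x * a x|) setT xi measurableT) => //.
- by move=> t; apply: intg_sin; [exact: sch_continuous|exact: sch_decay].
- by have := integrable_norm (intg_decay cx dx).
- by move=> t x _; rewrite normrM ler_piMl // normr_cos_le1.
Qed.

(** Integration by parts on the line; the boundary terms vanish because k is
    bounded. *)
Lemma Fourier_parts (k dk : R -> R) a : sch a -> (forall x, is_derive x 1 k (dk x)) ->
  continuous dk -> (forall x, `|k x| <= 1) ->
  intg setT (fun x => dk x * a x) -> intg setT (fun x => k x * derive1 a x) ->
  \int[mu]_x (k x * derive1 a x) = - \int[mu]_x (dk x * a x).
Proof.
move=> Ha dk_ cdk k1 i1 i2; have Ha' := sch_derive Ha.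
apply/eqP; rewrite -subr_eq0 opprK addrC -RintegralD // -[X in _ == X](subrr 0).
have ck : continuous k by move=> x; exact: der_continuous (dk_ x).
have dd : decay (fun x => k x * a x).
  move=> p; have [M H] := sch_decay Ha p; exists M => x; rewrite (le_trans _ (H x)) //.
  by rewrite normrM ler_wpM2l ?exprn_ge0 // ler_piMl.
apply/eqP; apply: (@FTC_T _ (fun x => k x * a x)).
- by move=> x; exact: derM (dk_ x) (sch_der Ha x).
- move=> x; apply: cvgD; apply: cvgM; [exact: cdk|exact: sch_continuous|exact: ck|].
  exact: sch_continuous.
- exact: intgD.
- exact: cvg_decay_ninfty.
- exact: cvg_decay_pinfty.
Qed.

Lemma der_cosx xi x : is_derive x 1 (fun x : R => cos (xi * x)) (- xi * sin (xi * x)).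
Proof.
have K : is_derive x 1 (fun x => xi * x) xi.
  by apply: (der_congr (der_aff xi 0 x)) => // ?; rewrite addr0.
apply: is_derive_eq (@dercomp _ cos _ x _ _ (is_derive_cos _) K) _; ring.
Qed.

Lemma der_sinx xi x : is_derive x 1 (fun x : R => sin (xi * x)) (xi * cos (xi * x)).
Proof.
have K : is_derive x 1 (fun x => xi * x) xi.
  by apply: (der_congr (der_aff xi 0 x)) => // ?; rewrite addr0.
apply: is_derive_eq (@dercomp _ sin _ x _ _ (is_derive_sin _) K) _; ring.
Qed.

Lemma Fcos_parts a xi : sch a -> Fcos (derive1 a) xi = xi * Fsin a xi.
Proof.
move=> Ha; have Ha' := sch_derive Ha.
have [ca da] := (sch_continuous Ha, sch_decay Ha).
have i1 := intgZ (- xi) measurableT (intg_sin xi ca da).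
have E x : - xi * (sin (xi * x) * a x) = - xi * sin (xi * x) * a x by ring.
rewrite /Fcos (Fourier_parts Ha (der_cosx xi)).
- under eq_Rintegral do rewrite -E.
  by rewrite RintegralZl // ?mulNr ?opprK //; exact: intg_sin.
- by move=> x; apply: cvgM; [exact: cvg_cst|exact: sinx_continuous].
- by move=> x; exact: normr_cos_le1.
- by apply: intg_eq i1.
- by apply: intg_cos; [exact: sch_continuous|exact: sch_decay].
Qed.

Lemma Fsin_parts a xi : sch a -> Fsin (derive1 a) xi = - (xi * Fcos a xi).
Proof.
move=> Ha; have Ha' := sch_derive Ha.
have [ca da] := (sch_continuous Ha, sch_decay Ha).
have i1 := intgZ xi measurableT (intg_cos xi ca da).
have E x : xi * (cos (xi * x) * a x) = xi * cos (xi * x) * a x by ring.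
rewrite /Fsin (Fourier_parts Ha (der_sinx xi)).
- under eq_Rintegral do rewrite -E.
  by rewrite RintegralZl //; exact: intg_cos.
- by move=> x; apply: cvgM; [exact: cvg_cst|exact: cosx_continuous].
- by move=> x; exact: normr_sin_le1.
- by apply: intg_eq i1.
- by apply: intg_sin; [exact: sch_continuous|exact: sch_decay].
Qed.

Lemma FcosD a b : sch a -> sch b ->
  Fcos (fun x => a x + b x) = (fun xi => Fcos a xi + Fcos b xi).
Proof.
move=> Ha Hb; apply/funext => xi; rewrite /Fcos -RintegralD //.
- by apply: eq_Rintegral => x _; rewrite mulrDr.
- by apply: intg_cos; [exact: sch_continuous|exact: sch_decay].
- by apply: intg_cos; [exact: sch_continuous|exact: sch_decay].
Qed.

Lemma FsinD a b : sch a -> sch b ->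
  Fsin (fun x => a x + b x) = (fun xi => Fsin a xi + Fsin b xi).
Proof.
move=> Ha Hb; apply/funext => xi; rewrite /Fsin -RintegralD //.
- by apply: eq_Rintegral => x _; rewrite mulrDr.
- by apply: intg_sin; [exact: sch_continuous|exact: sch_decay].
- by apply: intg_sin; [exact: sch_continuous|exact: sch_decay].
Qed.

Lemma FcosZ c a : sch a -> Fcos (fun x => c * a x) = (fun xi => c * Fcos a xi).
Proof.
move=> Ha; apply/funext => xi; rewrite /Fcos -RintegralZl //.
- by apply: eq_Rintegral => x _; rewrite mulrCA.
- by apply: intg_cos; [exact: sch_continuous|exact: sch_decay].
Qed.

Lemma FsinZ c a : sch a -> Fsin (fun x => c * a x) = (fun xi => c * Fsin a xi).
Proof.
move=> Ha; apply/funext => xi; rewrite /Fsin -RintegralZl //.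
- by apply: eq_Rintegral => x _; rewrite mulrCA.
- by apply: intg_sin; [exact: sch_continuous|exact: sch_decay].
Qed.

(** Multiplying a transform by xi gives, up to sign, the other transform of
    the derivative of the function. *)
Lemma decay_Fourier a p : sch a ->
  (exists M, forall xi, `|xi| ^+ p * `|Fcos a xi| <= M) /\
  (exists M, forall xi, `|xi| ^+ p * `|Fsin a xi| <= M).
Proof.
elim: p a => [|p IH] a Ha.
  have [K K0 HK] := kernel_bound; have [M M0 HM] := decay_dom (sch_decay Ha).
  have ca := sch_continuous Ha.
  split; exists (K * M) => xi; rewrite expr0 mul1r; apply: HK => //.
  - exact: cosx_continuous.
  - by move=> x; exact: normr_cos_le1.
  - exact: sinx_continuous.
  - by move=> x; exact: normr_sin_le1.
have [[Mc Hc] [Ms Hs]] := IH _ (sch_derive Ha).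
split; [exists Ms|exists Mc] => xi; rewrite exprSr -mulrA -normrM.
  by rewrite -[X in _ * X]normrN -Fsin_parts.
by rewrite -Fcos_parts.
Qed.

(** Differentiation exchanges the two transforms, so only their sums form a
    stable class. *)
Lemma sch_Fourier a b : sch a -> sch b -> sch (fun xi => Fcos a xi + Fsin b xi).
Proof.
move=> Ha Hb.
apply: (@sch_coind _ (fun f => exists a b, [/\ sch a, sch b &
  f = fun xi => Fcos a xi + Fsin b xi])); last by exists a, b.
move=> {Ha Hb}_ {a b}[a [b [Ha Hb ->]]].
have D x := derD (Fcos_der x Ha) (Fsin_der x Hb).
split; [by move=> x; exact: der_derivable (D x)| |].
  exists (fun x => x * b x), (fun x => -1 * (x * a x)); split; first exact: schMx.
    by apply: schZ; exact: schMx.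
  apply: der_funE => x; apply: is_derive_eq (D x) _.
  by rewrite FsinZ ?mulN1r 1?addrC //; exact: schMx.
by apply: decayD => p; [have [] := decay_Fourier p Ha|have [] := decay_Fourier p Hb].
Qed.

Lemma sch0 : sch (fun=> 0 : R).
Proof.
by have := schZ 0 (@sch_gauss R); under eq_fun do rewrite mul0r.
Qed.

Lemma sch_Fcos a : sch a -> sch (Fcos a).
Proof.
move=> Ha; have := sch_Fourier Ha (schZ 0 Ha); rewrite FsinZ //.
by under eq_fun do rewrite mul0r addr0.
Qed.

Lemma sch_Fsin a : sch a -> sch (Fsin a).
Proof.
move=> Ha; have := sch_Fourier (schZ 0 Ha) Ha; rewrite FcosZ //.
by under eq_fun do rewrite mul0r add0r.
Qed.

Lemma gauss_gt0 x : 0 < gauss x. Proof. exact: expR_gt0. Qed.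

Lemma gauss_ode f : (forall x, is_derive x 1 f (- x * f x)) ->
  f = (fun x => f 0 * gauss x).
Proof.
move=> df; apply/funext => x.
have g0 y : gauss y != 0 :> R by rewrite gt_eqF // gauss_gt0.
have K : f x / gauss x = f 0 / gauss 0.
  apply: (@is_derive_0_is_cst _ (fun x => f x / gauss x)) => y.
  have := @dercomp _ (fun t : R => t^-1) gauss y _ _ (der_recip (g0 y)) (gauss_der y).
  move=> /(derM (df y)) H; apply: is_derive_eq H _.
  by field.
have -> : f 0 = f 0 / gauss 0 by rewrite /gauss expr0n /= mul0r oppr0 expR0 divr1.
by rewrite -K mulfVK.
Qed.

(** The Gaussian and its cosine transform solve the same equation f' = - x f. *)
Lemma Fcos_gauss : Fcos (@gauss R) = (fun xi => Fcos (@gauss R) 0 * gauss xi).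
Proof.
apply: gauss_ode => x; apply: is_derive_eq (Fcos_der x (@sch_gauss R)) _.
rewrite mulNr -Fsin_parts; last exact: sch_gauss.
rewrite (der_funE (@gauss_der R)) -[LHS]mulN1r.
rewrite -[LHS]/((fun xi => -1 * Fsin (fun x => x * gauss x) xi) x) -FsinZ.
  by congr (Fsin _ _); apply/funext => y; rewrite mulN1r mulNr.
by apply: schMx; exact: sch_gauss.
Qed.

Lemma Fsin_gauss xi : Fsin (@gauss R) xi = 0.
Proof.
suff /gauss_ode -> : forall x, is_derive x 1 (Fsin (@gauss R)) (- x * Fsin (@gauss R) x).
  rewrite (_ : Fsin gauss 0 = 0) ?mul0r // /Fsin /Rintegral integral0_eq // => x _.
  by rewrite mul0r sin0 mul0r.
move=> x; apply: is_derive_eq (Fsin_der x (@sch_gauss R)) _.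
rewrite mulNr -Fcos_parts; last exact: sch_gauss.
rewrite (der_funE (@gauss_der R)) -[RHS]mulN1r.
rewrite -[RHS]/((fun xi => -1 * Fcos (fun x => - x * gauss x) xi) x) -FcosZ.
  by congr (Fcos _ _); apply/funext => y; rewrite mulN1r mulNr opprK.
have := schN (schMx (@sch_gauss R)).
by under eq_fun do rewrite -mulNr.
Qed.

Lemma Fcos_gauss0_gt0 : 0 < Fcos (@gauss R) 0.
Proof.
have -> : Fcos (@gauss R) 0 = \int[mu]_x gauss x.
  by apply: eq_Rintegral => x _; rewrite mul0r cos0 mul1r.
have Hg := @sch_gauss R; have HgN := sch_opp Hg.
rewrite Rint_split; first last.
- by apply: intg_decay; [exact: sch_continuous|exact: sch_decay].
- by apply: intg_decay; [exact: sch_continuous|exact: sch_decay].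
- by apply: meas_cont => // x _; exact: sch_continuous.
have E (a : R -> R) : \int[mu]_(x in `]0, +oo[) a x = mellin 0 a.
  by apply: eq_Rintegral => x _; rewrite powRr0 mul1r.
rewrite !E addr_gt0 // mellin_gt0 ?ltrN10 //; try exact: sch_hcont; try exact: sch_hdecay;
  by move=> x _; exact: gauss_gt0.
Qed.

(** Subtract from a the multiple r of the Gaussian that makes the difference
    vanish at - xi. By Hadamard's lemma the difference is x e(x) + xi e(x),
    which T maps to a function vanishing at xi. Applied to the square of the
    Fourier transform this is the inversion theorem. *)
Lemma intertwine (T : (R -> R) -> R -> R) a xi :
  (forall a b, sch a -> sch b -> T (fun x => a x + b x) = fun y => T a y + T b y) ->
  (forall c a, sch a -> T (fun x => c * a x) = fun y => c * T a y) ->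
  (forall a, sch a -> T (fun x => x * a x) = fun y => - (y * T a y)) ->
  sch a -> T a xi = T gauss xi / gauss xi * a (- xi).
Proof.
move=> TD TZ TM Ha; have Hg := @sch_gauss R.
pose r := a (- xi) / gauss xi.
have gE : gauss (- xi) = gauss xi by rewrite /gauss sqrrN.
have Hb : sch (fun x => a x + - r * gauss x) by apply: schD => //; exact: schZ.
have n1 : (1 : R) != 0 by exact: oner_neq0.
have [E HE EE] : exists2 e, sch e & forall x,
    a (1 * x + - xi) + - r * gauss (1 * x + - xi) = x * e x.
  apply: (sch_divx (sch_affine (- xi) n1 Hb)).
  by rewrite mul1r add0r gE /r; field; rewrite gt_eqF // gauss_gt0.
pose e x := E (1 * x + xi); have He : sch e by exact: sch_affine.
have be : (fun x => a x + - r * gauss x) = (fun x => x * e x + xi * e x).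
  by apply/funext => x; have := EE (1 * x + xi); rewrite /e !mul1r addrK => ->; ring.
have := congr1 (fun f => f xi) (congr1 T be).
rewrite /= TD //; last exact: schZ.
rewrite TD //; [|exact: schMx|exact: schZ].
rewrite !TZ // TM // mulrC => K.
have {K} -> : T a xi = r * T gauss xi by move: K; rewrite mulrC; lra.
by rewrite /r; field; rewrite gt_eqF // gauss_gt0.
Qed.

(** The real part of the square of the Fourier transform. *)
Lemma Fourier_square_even a xi : sch a ->
  Fcos (Fcos a) xi - Fsin (Fsin a) xi = Fcos (@gauss R) 0 ^+ 2 * a (- xi).
Proof.
move=> Ha; have := @intertwine (fun a xi => Fcos (Fcos a) xi - Fsin (Fsin a) xi) a xi.
have F0 : Fsin (@gauss R) = (fun x => 0 * gauss x).
  by apply/funext => y; rewrite Fsin_gauss mul0r.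
have Hg := @sch_gauss R.
move: Fcos_gauss; set c := Fcos gauss 0 => C.
rewrite F0 FsinZ // F0 C FcosZ // C => -> //.
- by field; rewrite gt_eqF // gauss_gt0.
- move=> b b' Hb Hb'; apply/funext => y; rewrite FcosD // FsinD //.
  rewrite FcosD ?FsinD; [|exact: sch_Fsin|exact: sch_Fsin|exact: sch_Fcos|exact: sch_Fcos].
  by rewrite opprD addrACA.
- move=> d b Hb; apply/funext => y; rewrite (FcosZ d Hb) (FsinZ d Hb).
  by rewrite (FcosZ d (sch_Fcos Hb)) (FsinZ d (sch_Fsin Hb)) mulrBr.
- move=> b Hb; apply/funext => y.
  have Hc := sch_Fcos Hb; have Hs := sch_Fsin Hb; have Hm := schMx Hb.
  have -> : Fcos (fun x => x * b x) = derive1 (Fsin b).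
    by apply/esym/der_funE => x; exact: Fsin_der.
  have -> : Fsin (fun x => x * b x) = (fun x => -1 * derive1 (Fcos b) x).
    by apply/funext => x; rewrite (derE (Fcos_der x Hb)) mulN1r opprK.
  rewrite FsinZ; last exact: sch_derive.
  by rewrite Fcos_parts // Fsin_parts //; ring.
Qed.

(** The imaginary part of the square of the Fourier transform. *)
Lemma Fourier_square_odd a xi : sch a ->
  Fsin (Fcos a) xi + Fcos (Fsin a) xi = 0.
Proof.
move=> Ha; have := @intertwine (fun a xi => Fsin (Fcos a) xi + Fcos (Fsin a) xi) a xi.
have F0 : Fsin (@gauss R) = (fun x => 0 * gauss x).
  by apply/funext => y; rewrite Fsin_gauss mul0r.
have Hg := @sch_gauss R.
rewrite F0 FcosZ // Fcos_gauss FsinZ // F0 => -> //.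
- by rewrite !mul0r mulr0 add0r mul0r mul0r.
- move=> b b' Hb Hb'; apply/funext => y; rewrite FcosD // FsinD //.
  rewrite FcosD ?FsinD; [|exact: sch_Fcos|exact: sch_Fcos|exact: sch_Fsin|exact: sch_Fsin].
  by rewrite addrACA.
- move=> d b Hb; apply/funext => y; rewrite (FcosZ d Hb) (FsinZ d Hb).
  by rewrite (FsinZ d (sch_Fcos Hb)) (FcosZ d (sch_Fsin Hb)) mulrDr.
- move=> b Hb; apply/funext => y.
  have Hc := sch_Fcos Hb; have Hs := sch_Fsin Hb; have Hm := schMx Hb.
  have -> : Fcos (fun x => x * b x) = derive1 (Fsin b).
    by apply/esym/der_funE => x; exact: Fsin_der.
  have -> : Fsin (fun x => x * b x) = (fun x => -1 * derive1 (Fcos b) x).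
    by apply/funext => x; rewrite (derE (Fcos_der x Hb)) mulN1r opprK.
  rewrite FcosZ; last exact: sch_derive.
  by rewrite Fcos_parts // Fsin_parts //; ring.
Qed.

End RealFourier.

(** * The Gamma integral *)

Section GammaIntegral.
Context {R : realType}.
Notation mu := (@lebesgue_measure R).
Implicit Types (a b f g h u v : R -> R) (x y c X s eps : R).

Definition dexp eps x : R := expR (- (eps * x)).

Lemma dexp_der eps x : is_derive x 1 (dexp eps) (- eps * dexp eps x).
Proof.
have K : is_derive x 1 (fun x => - eps * x) (- eps).
  by apply: (der_congr (der_aff (- eps) 0 x)) => // ?; rewrite addr0.
apply: (der_congr (@dercomp _ expR _ x _ _ (is_derive_expR _) K)) => [t|].
  by rewrite /dexp mulNr.
by rewrite /dexp mulrC (mulNr eps x).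
Qed.

Lemma dexp_gt0 eps x : 0 < dexp eps x. Proof. exact: expR_gt0. Qed.

Lemma dexp_hcont eps : hcont (dexp eps).
Proof. by move=> x _; exact: der_continuous (dexp_der eps x). Qed.

Lemma dexp_hdecay eps : 0 < eps -> hdecay (dexp eps).
Proof.
move=> e0 p; exists (p`!%:R / eps ^+ p) => x x0.
have ex0 : 0 <= eps * x by rewrite mulr_ge0 // ltW.
have h : (eps * x) ^+ p / p`!%:R <= expR (eps * x).
  case: (p) => [|n]; last by rewrite (le_trans _ (expR_ge1Dxn n ex0)) // lerDr.
  by rewrite expr0 fact0 divr1 -expR0 ler_expR.
rewrite ler_pdivrMr ?ltr0n ?fact_gt0 // in h.
rewrite gtr0_norm ?dexp_gt0 // /dexp expRN ler_pdivrMr ?expR_gt0 //.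
rewrite mulrAC ler_pdivlMr ?exprn_gt0 //.
by rewrite mulrC -exprMn (le_trans h) // mulrC.
Qed.

Definition gammaI s := mellin (s - 1) (dexp 1).

Lemma gammaI_gt0 s : 0 < s -> 0 < gammaI s.
Proof.
move=> s0; apply: mellin_gt0; [by rewrite ltrBrDl subrr|exact: dexp_hcont| |].
  exact: dexp_hdecay.
by move=> x _; exact: dexp_gt0.
Qed.

Lemma gammaIS s : 0 < s -> gammaI (s + 1) = s * gammaI s.
Proof.
move=> s0; have s1 : -1 < s by apply: lt_trans s0; rewrite ltrN10.
rewrite /gammaI addrK; have := mellin_parts s0 (fun x _ => dexp_der 1 x).
rewrite mellinZ //; [|exact: dexp_hcont|exact: dexp_hdecay].
rewrite mulN1r mulNr => K; apply: oppr_inj; apply: K => //.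
- by apply: hcontZ; exact: dexp_hcont.
- exact: dexp_hdecay.
- by apply: hdecayZ; exact: dexp_hdecay.
Qed.

Lemma gammaI1 : gammaI 1 = 1.
Proof.
have dn (x : R) : 0 < x -> is_derive x 1 (fun x => -1 * dexp 1 x) (dexp 1 x).
  by move=> _; apply: is_derive_eq (derZ (-1) (dexp_der 1 x)) _; rewrite mulrA mulrNN !mul1r.
rewrite /gammaI subrr (mellin0_parts dn).
- by rewrite mulN1r opprK /dexp mulr0 oppr0 expR0.
- exact: dexp_hcont.
- by apply: hdecayZ; exact: dexp_hdecay.
- exact: dexp_hdecay.
- by apply: cvg_at_right_filter; exact: der_continuous (derZ (-1) (dexp_der 1 0)).
Qed.

Lemma gammaI_continuous s : 0 < s -> {for s, continuous gammaI}.
Proof.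
move=> s0; have s1 : -1 < s - 1 by rewrite ltrBrDl subrr.
have := mellin_continuous s1 (@dexp_hcont 1) (dexp_hdecay ltr01).
apply: (@continuous_comp _ _ _ (fun s => s - 1) (mellin^~ (dexp 1))).
by apply: cvgB; [exact: cvg_id|exact: cvg_cst].
Qed.

Lemma mellin_scale s c a : -1 < s -> 0 < c -> hcont a -> hdecay a ->
  hdecay (fun x => a (c * x)) ->
  mellin s (fun x => a (c * x)) = c `^ (- (s + 1)) * mellin s a.
Proof.
move=> s1 c0 ca da dac.
have cac : hcont (fun x => a (c * x)).
  move=> x x0; apply: (@continuous_comp _ _ _ ( *%R c) a); first exact: mulrl_continuous.
  by apply: ca; rewrite mulr_gt0.
pose D : set (measurableTypeR R) := `]0, +oo[%classic.
pose f := (fun x => x `^ s * a x) \_ D.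
have mphi : measurable_fun [set: measurableTypeR R] ( *%R c : measurableTypeR R -> measurableTypeR R).
  exact: mulrl_measurable.
have E : ( *%R c) @^-1` D = D.
  by apply/seteqP; split => x; rewrite /D /= !in_itv /= !andbT pmulr_rgt0.
have fE x : D x -> f (c * x) = c `^ s * (x `^ s * a (c * x)).
  move=> Dx; have x0 := in0y Dx.
  rewrite /f patchE mem_set; last by rewrite /D /= in_itv /= andbT mulr_gt0.
  by rewrite powRM ?ltW // mulrA.
have := @Rint_pushforward R ( *%R c) c mphi c0 _ f D mbl0y.
rewrite E => K.
have {K} : \int[mu]_(x in D) f (c * x) = c^-1 * \int[mu]_(x in D) f x.
  apply: K.
  - move=> u v uv; rewrite preimage_scale_itv // lebesgue_measure_itv /= lte_fin.
    by rewrite ltr_pM2r ?invr_gt0 // uv -EFinB; congr EFin; ring.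
  - apply/(measurable_restrictT _ _).1 => //; first exact: mbl0y.
    exact: mellin_meas.
  - apply: intg_eq (intgZ (c `^ s) mbl0y (mellin_intg s1 cac dac)); last exact: mbl0y.
    by move=> x /set_mem Dx; rewrite /= fE.
have -> : \int[mu]_(x in D) f x = mellin s a.
  by apply: eq_Rintegral => x Dx; rewrite /f patchE Dx.
have -> : \int[mu]_(x in D) f (c * x) = c `^ s * mellin s (fun x => a (c * x)).
  rewrite -RintegralZl; [|exact: mbl0y|exact: mellin_intg].
  by apply: eq_Rintegral => x /set_mem Dx; rewrite fE.
move=> K; rewrite powRN powRD; last by rewrite (gt_eqF c0) implybT.
rewrite powRr1 ?ltW // invfM -mulrA -K mulrA mulVf ?mul1r //.
by rewrite gt_eqF // powR_gt0.
Qed.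

Lemma mellin_dexp s eps : 0 < s -> 0 < eps ->
  mellin (s - 1) (dexp eps) = eps `^ (- s) * gammaI s.
Proof.
move=> s0 e0; have s1 : -1 < s - 1 by rewrite ltrBrDl subrr.
have E : (fun x => dexp 1 (eps * x)) = dexp eps.
  by apply/funext => x; rewrite /dexp mul1r.
rewrite -{1}E mellin_scale ?subrK ?E //.
- exact: dexp_hcont.
- exact: dexp_hdecay.
- exact: dexp_hdecay.
Qed.

End GammaIntegral.

(** * Transforms of damped powers *)

Section DampedKernel.
Context {R : realType}.
Notation mu := (@lebesgue_measure R).
Variables (eps : R) (e0 : 0 < eps).
Implicit Types (x y s : R).

(** [dcos] and [dsin] are the real and imaginary parts of the integral over
    the half-line of x^s exp(- (eps - i y) x). *)
Definition dcos s y := mellin s (fun x => dexp eps x * cos (y * x)).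
Definition dsin s y := mellin s (fun x => dexp eps x * sin (y * x)).

Lemma hcont_dcos y : hcont (fun x => dexp eps x * cos (y * x)).
Proof. by apply: hcontM; [exact: dexp_hcont|move=> x _; exact: cosx_continuous]. Qed.

Lemma hcont_dsin y : hcont (fun x => dexp eps x * sin (y * x)).
Proof. by apply: hcontM; [exact: dexp_hcont|move=> x _; exact: sinx_continuous]. Qed.

Lemma hdecay_dcos y : hdecay (fun x => dexp eps x * cos (y * x)).
Proof.
by apply: (@hdecayMb _ 1) => [x _|]; [exact: normr_cos_le1|exact: dexp_hdecay].
Qed.

Lemma hdecay_dsin y : hdecay (fun x => dexp eps x * sin (y * x)).
Proof.
by apply: (@hdecayMb _ 1) => [x _|]; [exact: normr_sin_le1|exact: dexp_hdecay].
Qed.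

Let hc := hcont_dcos. Let hs := hcont_dsin.
Let kc := hdecay_dcos. Let ks := hdecay_dsin.

Lemma dcos_der s y : -1 < s -> is_derive y 1 (dcos s) (- dsin (s + 1) y).
Proof.
move=> s1; have s2 : -1 < s + 1 by apply: lt_trans s1 _; rewrite ltrDl.
have ie := mellin_intg s2 (@dexp_hcont R eps) (dexp_hdecay e0).
apply: is_derive_eq.
  apply: (@der_underint R (fun t x => x `^ s * (dexp eps x * cos (t * x)))
    (fun t x => - (x `^ (s + 1) * (dexp eps x * sin (t * x))))
    (fun x => x `^ (s + 1) * dexp eps x) _ y mbl0y).
  - by move=> t; exact: mellin_intg.
  - move=> t x /in0y x0; have K : is_derive t 1 (fun t => t * x) x.
      by apply: (der_congr (der_aff x 0 t)) => // ?; rewrite addr0 mulrC.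
    apply: is_derive_eq (derZ _ (derZ _ (@dercomp _ cos _ t _ _ (is_derive_cos _) K))) _.
    by rewrite -powRS //; ring.
  - by move=> x; rewrite mulr_ge0 ?powR_ge0 // ltW // dexp_gt0.
  - exact: ie.
  - move=> t x _; rewrite normrN mulrA normrM ger0_norm; last first.
      by rewrite mulr_ge0 ?powR_ge0 // ltW // dexp_gt0.
    by rewrite ler_piMr ?normr_sin_le1 // mulr_ge0 ?powR_ge0 // ltW // dexp_gt0.
rewrite -[RHS]mulN1r /dsin /mellin -RintegralZl; [|exact: mbl0y|exact: mellin_intg].
by apply: eq_Rintegral => x _; rewrite mulN1r.
Qed.

Lemma dsin_der s y : -1 < s -> is_derive y 1 (dsin s) (dcos (s + 1) y).
Proof.
move=> s1; have s2 : -1 < s + 1 by apply: lt_trans s1 _; rewrite ltrDl.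
have ie := mellin_intg s2 (@dexp_hcont R eps) (dexp_hdecay e0).
apply: (@der_underint R (fun t x => x `^ s * (dexp eps x * sin (t * x)))
  (fun t x => x `^ (s + 1) * (dexp eps x * cos (t * x)))
  (fun x => x `^ (s + 1) * dexp eps x) _ y mbl0y).
- by move=> t; exact: mellin_intg.
- move=> t x /in0y x0; have K : is_derive t 1 (fun t => t * x) x.
    by apply: (der_congr (der_aff x 0 t)) => // ?; rewrite addr0 mulrC.
  apply: is_derive_eq (derZ _ (derZ _ (@dercomp _ sin _ t _ _ (is_derive_sin _) K))) _.
  by rewrite -powRS //; ring.
- by move=> x; rewrite mulr_ge0 ?powR_ge0 // ltW // dexp_gt0.
- exact: ie.
- move=> t x _; rewrite mulrA normrM ger0_norm; last first.
    by rewrite mulr_ge0 ?powR_ge0 // ltW // dexp_gt0.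
  by rewrite ler_piMr ?normr_cos_le1 // mulr_ge0 ?powR_ge0 // ltW // dexp_gt0.
Qed.

Lemma dcos_parts s y : 0 < s -> eps * dcos s y + y * dsin s y = s * dcos (s - 1) y.
Proof.
move=> s0; have s1 : -1 < s by apply: lt_trans s0; rewrite ltrN10.
have dab x : 0 < x -> is_derive x 1 (fun x => dexp eps x * cos (y * x))
    (- eps * (dexp eps x * cos (y * x)) + - y * (dexp eps x * sin (y * x))).
  move=> _; apply: is_derive_eq (derM (dexp_der eps x) (der_cosx y x)) _; ring.
have := mellin_parts s0 dab; rewrite mellinD ?mellinZ //;
  try (by apply: hcontZ); try (by apply: hdecayZ).
rewrite -/(dcos s y) -/(dsin s y) -/(dcos (s - 1) y) => K.
suff : - eps * dcos s y + - y * dsin s y = - s * dcos (s - 1) y.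
  by move: (dcos s y) (dsin s y) (dcos (s - 1) y) => u v w; lra.
apply: K => //; first by apply: hcontD; exact: hcontZ.
by apply: hdecayD; exact: hdecayZ.
Qed.

Lemma dsin_parts s y : 0 < s -> eps * dsin s y - y * dcos s y = s * dsin (s - 1) y.
Proof.
move=> s0; have s1 : -1 < s by apply: lt_trans s0; rewrite ltrN10.
have dab x : 0 < x -> is_derive x 1 (fun x => dexp eps x * sin (y * x))
    (- eps * (dexp eps x * sin (y * x)) + y * (dexp eps x * cos (y * x))).
  move=> _; apply: is_derive_eq (derM (dexp_der eps x) (der_sinx y x)) _; ring.
have := mellin_parts s0 dab; rewrite mellinD ?mellinZ //;
  try (by apply: hcontZ); try (by apply: hdecayZ).
rewrite -/(dcos s y) -/(dsin s y) -/(dsin (s - 1) y) => K.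
suff : - eps * dsin s y + y * dcos s y = - s * dsin (s - 1) y.
  by move: (dcos s y) (dsin s y) (dsin (s - 1) y) => u v w; lra.
apply: K => //; first by apply: hcontD; exact: hcontZ.
by apply: hdecayD; exact: hdecayZ.
Qed.

Let q y := eps ^+ 2 + y ^+ 2.
Let q0 y : 0 < q y. Proof. by rewrite /q ltr_wpDr ?sqr_ge0 ?exprn_gt0. Qed.

Lemma der_modulus s y :
  is_derive y 1 (fun y => q y `^ (s / 2)) (s * y / q y * q y `^ (s / 2)).
Proof.
have K : is_derive y 1 q (2 * y).
  apply: is_derive_eq (derD (der_cst _ y) (derXn 2 y)) _.
  by rewrite add0r expr1.
apply: is_derive_eq (@dercomp _ (fun t => t `^ (s / 2)) q y _ _ (der_powR _ (q0 y)) K) _.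
have <- : q y * q y `^ (s / 2 - 1) = q y `^ (s / 2).
  by rewrite powRS // subrK.
by field; rewrite gt_eqF.
Qed.

Lemma der_phase s y :
  is_derive y 1 (fun y => s * atan (y / eps)) (s * eps / q y).
Proof.
have K : is_derive y 1 (fun y => y / eps) eps^-1.
  by apply: (der_congr (der_aff eps^-1 0 y)) => // t; rewrite addr0 mulrC.
apply: is_derive_eq (derZ s (@dercomp _ atan _ y _ _ (is_derive1_atan _) K)) _.
rewrite /q; field; rewrite (gt_eqF e0) /= andbT gt_eqF //; exact: q0.
Qed.

(** The integral P + i Q of x^(s-1) exp(- (eps - i y) x) equals Gamma(s) (eps
    - i y)^(-s), here in polar form. Differentiation under the integral and
    integration by parts give (eps - i y) (P + i Q)' = i s (P + i Q), so that
    (P + i Q) (eps - i y)^s does not depend on y; at y = 0 it is Gamma(s). *)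
Lemma dcos_dsin s y : 0 < s ->
  dcos (s - 1) y = gammaI s * q y `^ (- (s / 2)) * cos (s * atan (y / eps)) /\
  dsin (s - 1) y = gammaI s * q y `^ (- (s / 2)) * sin (s * atan (y / eps)).
Proof.
move=> s0; have s1 : -1 < s - 1 by rewrite ltrBrDl subrr.
pose P := dcos (s - 1); pose Q := dsin (s - 1).
pose c y := cos (s * atan (y / eps)); pose d y := sin (s * atan (y / eps)).
pose r y := q y `^ (s / 2).
have dc (z : R) : is_derive z 1 c (- (d z * (s * eps / q z))).
  by apply: is_derive_eq (@dercomp _ cos _ z _ _ (is_derive_cos _) (der_phase s z)) _; rewrite mulNr.
have dd (z : R) : is_derive z 1 d (c z * (s * eps / q z)).
  exact: @dercomp _ sin _ z _ _ (is_derive_sin _) (der_phase s z).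
have dP (z : R) : is_derive z 1 P (- dsin s z).
  by apply: is_derive_eq (dcos_der z s1) _; rewrite subrK.
have dQ (z : R) : is_derive z 1 Q (dcos s z).
  by apply: is_derive_eq (dsin_der z s1) _; rewrite subrK.
have rel z : dcos s z = s * (eps * P z - z * Q z) / q z /\
             dsin s z = s * (z * P z + eps * Q z) / q z.
  have h1 := dcos_parts z s0; have h2 := dsin_parts z s0.
  have qz : q z != 0 by rewrite gt_eqF.
  split; apply: (mulIf qz); rewrite mulfVK //.
    rewrite (_ : s * (eps * P z - z * Q z) = eps * (s * P z) - z * (s * Q z)); last by ring.
    by rewrite -h1 -h2 /q; ring.
  rewrite (_ : s * (z * P z + eps * Q z) = z * (s * P z) + eps * (s * Q z)); last by ring.
  by rewrite -h1 -h2 /q; ring.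
(* The real part of (P + i Q) (eps - i y)^s; below, its imaginary part. *)
have W z : r z * (P z * c z + Q z * d z) = r 0 * (P 0 * c 0 + Q 0 * d 0).
  apply: (@is_derive_0_is_cst _ (fun z => r z * (P z * c z + Q z * d z))) => w.
  apply: is_derive_eq (derM (der_modulus s w)
    (derD (derM (dP w) (dc w)) (derM (dQ w) (dd w)))) _.
  rewrite -/(r w); have [-> ->] := rel w.
  move: (P w) (Q w) (c w) (d w) (r w) => p' q' c' d' r'.
  by field; rewrite gt_eqF.
have V z : r z * (Q z * c z - P z * d z) = r 0 * (Q 0 * c 0 - P 0 * d 0).
  apply: (@is_derive_0_is_cst _ (fun z => r z * (Q z * c z - P z * d z))) => w.
  apply: is_derive_eq (derM (der_modulus s w)
    (derB (derM (dQ w) (dc w)) (derM (dP w) (dd w)))) _.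
  rewrite -/(r w); have [-> ->] := rel w.
  move: (P w) (Q w) (c w) (d w) (r w) => p' q' c' d' r'.
  by field; rewrite gt_eqF.
have c0 : c 0 = 1 by rewrite /c mul0r atan0 mulr0 cos0.
have d0 : d 0 = 0 by rewrite /d mul0r atan0 mulr0 sin0.
have r0E : r 0 = eps `^ s.
  rewrite /r /q expr0n addr0 -powR_mulrn ?ltW // -powRrM; congr (_ `^ _).
  by field.
have P0 : P 0 = eps `^ (- s) * gammaI s.
  rewrite -mellin_dexp //; apply: eq_mellin => x _.
  by rewrite mul0r cos0 mulr1.
have Q0 : Q 0 = 0.
  rewrite /Q /dsin (@eq_mellin _ _ _ (fun x => 0 * dexp eps x)).
    by rewrite mellinZ ?mul0r //; [exact: dexp_hcont|exact: dexp_hdecay].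
  by move=> x _; rewrite mul0r sin0 mulr0 mul0r.
have rp : 0 < r y by exact: powR_gt0.
have trig : c y ^+ 2 + d y ^+ 2 = 1 by exact: cos2Dsin2.
move: (W y) (V y); rewrite c0 d0 Q0 !mulr0 mul0r subrr mulr0 mulr1 addr0.
rewrite P0 r0E mulrA -powRD ?(gt_eqF e0) ?implybT // subrr powRr0 mul1r => W1 /eqP.
rewrite mulf_eq0 (gt_eqF rp) /= => /eqP V1.
rewrite -/(c y) -/(d y) -/(P y) -/(Q y) powRN -/(r y) -W1.
have rn : r y != 0 by rewrite gt_eqF.
split.
  transitivity (P y * (c y ^+ 2 + d y ^+ 2) + (Q y * c y - P y * d y) * d y).
    by rewrite trig V1 mulr1 mul0r addr0.
  by field.
transitivity (Q y * (c y ^+ 2 + d y ^+ 2) - (Q y * c y - P y * d y) * c y).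
  by rewrite trig V1 mulr1 mul0r subr0.
by field.
Qed.

End DampedKernel.

(** * Fubini and dominated convergence *)

Section Fubini.
Context {R : realType}.
Notation mu := (@lebesgue_measure R).
Implicit Types (a b f g h u v k : R -> R) (x y c X s eps : R).

Lemma Rint_EFin (D : set (measurableTypeR R)) f : measurable D -> intg D f ->
  (\int[mu]_(x in D) (f x)%:E = (\int[mu]_(x in D) f x)%:E)%E.
Proof. by move=> mD If; rewrite /Rintegral fineK //; exact: integrable_fin_num. Qed.

(** The kernel is bounded, so |u(x) v(y)| dominates the integrand on the
    plane. *)
Lemma kernel_Fubini k u v : continuous k -> (forall t : R, `|k t| <= 1) ->
  intg setT u -> intg setT v ->
  \int[mu]_x (u x * \int[mu]_y (k (x * y) * v y)) =
  \int[mu]_y (v y * \int[mu]_x (k (y * x) * u x)).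
Proof.
move=> ck k1 iu iv.
have mk : measurable_fun [set: measurableTypeR R] k.
  by apply: meas_cont => // t _; exact: ck.
have mu_ := intg_meas iu; have mv := intg_meas iv.
have slice x v' : intg setT v' -> intg setT (fun y => k (x * y) * v' y).
  move=> iv'; apply: (@intg_le _ _ _ (fun y => `|v' y|)) => //.
  - apply: measurable_funM; last exact: intg_meas.
    by apply: measurableT_comp => //; exact: mulrl_measurable.
  - by move=> y _; rewrite normrM ler_piMl.
  - exact: integrable_norm iv'.
pose f (z : measurableTypeR R * measurableTypeR R) := (u z.1 * (k (z.1 * z.2) * v z.2))%:E.
have mf : measurable_fun setT f.
  apply/measurable_EFinP; apply: measurable_funM.
    exact: measurableT_comp.
  apply: measurable_funM; last exact: measurableT_comp.
  by apply: measurableT_comp => //; apply: measurable_funM.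
have If : (mu \x mu)%E.-integrable setT f.
  apply/integrable12ltyP => //.
  apply: (@le_lt_trans _ _ (\int[mu]_x (`|u x| * \int[mu]_y `|v y|)%:E)%E).
    apply: ge0_le_integral => //.
    - by move=> x _; exact: integral_ge0.
    - apply: (@measurable_fun_fubini_tonelli_F _ _ _ _ _ mu (fun z => `|f z|)%E) => //.
      exact: measurableT_comp.
    - apply/measurable_EFinP; apply: measurable_funM => //.
      exact: measurableT_comp.
    move=> x _; have iv' := integrable_norm iv.
    rewrite -RintegralZl // -Rint_EFin //; last exact: intgZ.
    apply: ge0_le_integral => //.
    - apply: measurableT_comp => //; apply: (measurableT_comp mf).
      exact: measurable_pair1.
    - by apply/measurable_EFinP; apply: measurable_funM => //; exact: measurableT_comp.
    - by move=> y _; rewrite /f /= lee_fin !normrM ler_wpM2l // ler_piMl.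
  set C := \int[mu]_y `|v y|.
  have C0 : 0 <= C by exact: Rintegral_ge0.
  pose U x : R := C * `|u x|.
  rewrite [X in (X < _)%E](_ : _ = (\int[mu]_x `|(EFin \o U) x|)%E).
    by have /integrableP[] := intgZ C measurableT (integrable_norm iu).
  by apply: eq_integral => x _ /=; rewrite /U normrM normr_id (ger0_norm C0) mulrC.
have inner1 x : (\int[mu]_y f (x, y) = (u x * \int[mu]_y (k (x * y) * v y))%:E)%E.
  rewrite -RintegralZl //; last exact: slice.
  by rewrite -Rint_EFin //; apply: intgZ => //; exact: slice.
have inner2 y : (\int[mu]_x f (x, y) = (v y * \int[mu]_x (k (y * x) * u x))%:E)%E.
  rewrite -RintegralZl //; last exact: slice.
  rewrite -Rint_EFin //; last by apply: intgZ => //; exact: slice.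
  by apply: eq_integral => x _; rewrite /f /=; congr EFin; rewrite (mulrC y); ring.
have := Fubini If.
under eq_integral do rewrite inner1.
under [RHS]eq_integral do rewrite inner2.
by move=> K; rewrite /Rintegral -K.
Qed.

Lemma Rint_dominated (D : set (measurableTypeR R)) (f_ : nat -> R -> R) f g :
  measurable D -> (forall n, measurable_fun D (f_ n)) ->
  (forall x, D x -> f_ n x @[n --> \oo] --> f x) ->
  (forall n x, D x -> `|f_ n x| <= g x) -> intg D g ->
  \int[mu]_(x in D) f_ n x @[n --> \oo] --> \int[mu]_(x in D) f x.
Proof.
move=> mD mf ff fg ig.
have mf' : measurable_fun D (EFin \o f).
  have K x : D x -> (f_ n x)%:E @[n --> \oo] --> (f x)%:E.
    by move=> Dx; apply: cvg_EFin; [exact: nearW|exact: ff].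
  have mE n : measurable_fun D (fun x => (f_ n x)%:E) by apply/measurable_EFinP; exact: mf.
  exact: emeasurable_fun_cvg mE K.
have If : intg D f.
  apply: intg_le ig => //; first exact/measurable_EFinP.
  move=> x Dx; apply: (cvgr_to_le (cvg_norm (ff x Dx))).
  by apply: nearW => n; exact: fg.
suff /fine_cvgP[_] : (\int[mu]_(x in D) (f_ n x)%:E)%E @[n --> \oo] -->
    (fine (\int[mu]_(x in D) (f x)%:E))%:E by [].
rewrite fineK; last exact: integrable_fin_num.
apply: (@dominated_cvg _ _ _ mu _ mD (fun n x => (f_ n x)%:E) _ (EFin \o g)) => //.
- by move=> n; apply/measurable_EFinP; exact: mf.
- by move=> x Dx; apply: cvg_EFin; [exact: nearW|exact: ff].
Qed.

End Fubini.

(** * Transforms of powers between -1 and 0 *)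

Section MellinFourier.
Context {R : realType}.
Notation mu := (@lebesgue_measure R).
Implicit Types (a b f g h u v k : R -> R) (x y c X s eps : R).

Definition even2 a x := a x + a (- x).
Definition odd2 a x := a x - a (- x).

Lemma sch_even2 a : sch a -> sch (even2 a).
Proof. by move=> Ha; apply: schD => //; exact: sch_opp. Qed.

Lemma sch_odd2 a : sch a -> sch (odd2 a).
Proof. by move=> Ha; apply: schB => //; exact: sch_opp. Qed.

(** Extended by zero to the line, to which [kernel_Fubini] applies. *)
Definition damped s eps x : R := (fun x => x `^ (s - 1) * dexp eps x) \_ `]0, +oo[ x.

Lemma intg_damped s eps : 0 < s -> 0 < eps -> intg setT (damped s eps).
Proof.
move=> s0 e0; have s1 : -1 < s - 1 by rewrite ltrBrDl subrr.
have := mellin_intg s1 (@dexp_hcont R eps) (dexp_hdecay e0).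
by move=> /(integrable_mkcond _ mbl0y); rewrite restrict_EFin.
Qed.

Lemma Rint_damped s eps f :
  \int[mu]_x (f x * damped s eps x) = mellin (s - 1) (fun x => dexp eps x * f x).
Proof.
rewrite /mellin [RHS]Rintegral_mkcond; apply: eq_Rintegral => x _.
by rewrite /damped !patchE; case: ifP => _; [ring|rewrite mulr0].
Qed.

Lemma dampedE s eps f :
  \int[mu]_x (damped s eps x * f x) = mellin (s - 1) (fun x => dexp eps x * f x).
Proof. by rewrite -Rint_damped; apply: eq_Rintegral => x _; rewrite mulrC. Qed.

Lemma dcosN eps s y : dcos eps s (- y) = dcos eps s y.
Proof. by apply: eq_mellin => x _; rewrite mulNr cosN. Qed.

Lemma dsinN eps s y : 0 < eps -> -1 < s -> dsin eps s (- y) = - dsin eps s y.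
Proof.
move=> e0 s1; rewrite -[RHS]mulN1r -mellinZ //.
- by apply: eq_mellin => x _; rewrite mulNr sinN mulrN mulN1r.
- exact: hcont_dsin.
- exact: hdecay_dsin.
Qed.

(** Fubini moves the transform from a to the damped power; the kernel obtained
    is even in y, so the integral over the line folds to the half-line. *)
Lemma damped_Fcos s eps a : 0 < s -> 0 < eps -> sch a ->
  mellin (s - 1) (fun x => dexp eps x * Fcos a x) =
  mellin 0 (fun y => dcos eps (s - 1) y * even2 a y).
Proof.
move=> s0 e0 Ha; have s1 : -1 < s - 1 by rewrite ltrBrDl subrr.
have [ca da] := (sch_continuous Ha, sch_decay Ha).
have cK : continuous (dcos eps (s - 1)).
  by move=> y; exact: der_continuous (dcos_der e0 y s1).
have bK y : `|dcos eps (s - 1) y| <= mellin (s - 1) (dexp eps).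
  apply: Rint_le; [exact: mbl0y|by apply: mellin_meas; exact: hcont_dcos| |].
    move=> x _; rewrite normrM (ger0_norm (powR_ge0 _ _)) ler_wpM2l ?powR_ge0 //.
    by rewrite normrM gtr0_norm ?dexp_gt0 // ler_piMr ?normr_cos_le1 // ltW ?dexp_gt0.
  by apply: mellin_intg => //; [exact: dexp_hcont|exact: dexp_hdecay].
have iK b : sch b -> intg setT (fun y => b y * dcos eps (s - 1) y).
  move=> Hb; apply: (@intg_le _ _ _ (fun y => mellin (s - 1) (dexp eps) * `|b y|)) => //.
  - by apply: meas_cont => // y _; apply: cvgM; [exact: sch_continuous|exact: cK].
  - by move=> y _; rewrite normrM mulrC ler_wpM2r.
  - apply: intgZ => //; have := integrable_norm (intg_decay (sch_continuous Hb) (sch_decay Hb)).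
    exact.
rewrite -dampedE (kernel_Fubini (@continuous_cos R) (@normr_cos_le1 R)
  (intg_damped s0 e0) (intg_decay ca da)).
under eq_Rintegral do rewrite Rint_damped.
rewrite Rint_split //.
- have iD b : sch b -> intg `]0, +oo[ (fun y => b y * dcos eps (s - 1) y).
    by move=> /iK; apply: intgS => //; exact: mbl0y.
  have iN : intg `]0, +oo[ (fun y => a (- y) * dcos eps (s - 1) (- y)).
    apply: intg_eq (iD _ (sch_opp Ha)); last exact: mbl0y.
    by move=> y _; rewrite dcosN.
  rewrite -RintegralD //; last exact: iD.
  apply: eq_Rintegral => y _; rewrite powRr0 mul1r.
  rewrite -/(dcos eps (s - 1) (- y)) -/(dcos eps (s - 1) y) dcosN /even2.
  by rewrite -mulrDl mulrC.
- by apply: intg_meas; exact: iK.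
- exact: iK.
- apply: intg_eq (iK _ (sch_opp Ha)) => // y _.
  by rewrite -/(dcos eps (s - 1) (- y)) dcosN.
Qed.

Lemma damped_Fsin s eps a : 0 < s -> 0 < eps -> sch a ->
  mellin (s - 1) (fun x => dexp eps x * Fsin a x) =
  mellin 0 (fun y => dsin eps (s - 1) y * odd2 a y).
Proof.
move=> s0 e0 Ha; have s1 : -1 < s - 1 by rewrite ltrBrDl subrr.
have [ca da] := (sch_continuous Ha, sch_decay Ha).
have cK : continuous (dsin eps (s - 1)).
  by move=> y; exact: der_continuous (dsin_der e0 y s1).
have bK y : `|dsin eps (s - 1) y| <= mellin (s - 1) (dexp eps).
  apply: Rint_le; [exact: mbl0y|by apply: mellin_meas; exact: hcont_dsin| |].
    move=> x _; rewrite normrM (ger0_norm (powR_ge0 _ _)) ler_wpM2l ?powR_ge0 //.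
    by rewrite normrM gtr0_norm ?dexp_gt0 // ler_piMr ?normr_sin_le1 // ltW ?dexp_gt0.
  by apply: mellin_intg => //; [exact: dexp_hcont|exact: dexp_hdecay].
have iK b : sch b -> intg setT (fun y => b y * dsin eps (s - 1) y).
  move=> Hb; apply: (@intg_le _ _ _ (fun y => mellin (s - 1) (dexp eps) * `|b y|)) => //.
  - by apply: meas_cont => // y _; apply: cvgM; [exact: sch_continuous|exact: cK].
  - by move=> y _; rewrite normrM mulrC ler_wpM2r.
  - apply: intgZ => //; have := integrable_norm (intg_decay (sch_continuous Hb) (sch_decay Hb)).
    exact.
rewrite -dampedE (kernel_Fubini (@continuous_sin R) (@normr_sin_le1 R)
  (intg_damped s0 e0) (intg_decay ca da)).
under eq_Rintegral do rewrite Rint_damped.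
rewrite Rint_split //.
- have iD b : sch b -> intg `]0, +oo[ (fun y => b y * dsin eps (s - 1) y).
    by move=> /iK; apply: intgS => //; exact: mbl0y.
  have iN : intg `]0, +oo[ (fun y => a (- y) * dsin eps (s - 1) (- y)).
    apply: intg_eq (intgN mbl0y (iD _ (sch_opp Ha))); last exact: mbl0y.
    by move=> y _; rewrite dsinN // mulrN.
  rewrite -RintegralD //; last exact: iD.
  apply: eq_Rintegral => y _; rewrite powRr0 mul1r.
  rewrite -/(dsin eps (s - 1) (- y)) -/(dsin eps (s - 1) y) dsinN // /odd2.
  by rewrite mulrN -mulrBl mulrC.
- by apply: intg_meas; exact: iK.
- exact: iK.
- apply: intg_eq (intgN measurableT (iK _ (sch_opp Ha))) => // y _.
  by rewrite -/(dsin eps (s - 1) (- y)) dsinN // mulrN.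
Qed.

Let eps_ n : R := n.+1%:R^-1.

Let eps_gt0 n : 0 < eps_ n. Proof. by rewrite invr_gt0 ltr0n. Qed.

Let cvg_eps : eps_ n @[n --> \oo] --> (0 : R).
Proof. exact: cvg_harmonic. Qed.

Lemma undamp s b : 0 < s -> hcont b -> hdecay b ->
  mellin (s - 1) (fun x => dexp (eps_ n) x * b x) @[n --> \oo] --> mellin (s - 1) b.
Proof.
move=> s0 cb db; have s1 : -1 < s - 1 by rewrite ltrBrDl subrr.
apply: (@Rint_dominated _ _ _ _ (fun x => `|x `^ (s - 1) * b x|)).
- exact: mbl0y.
- by move=> n; apply: mellin_meas; apply: hcontM => //; exact: dexp_hcont.
- move=> x x0; apply: cvgM; first exact: cvg_cst.
  rewrite -[X in _ --> X]mul1r; apply: cvgM; last exact: cvg_cst.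
  have -> : 1 = expR (- (0 * x)) by rewrite mul0r oppr0 expR0.
  apply: (@cvg_comp _ _ _ (fun n => - (eps_ n * x)) expR _ (nbhs (- (0 * x)))).
    by apply: cvgN; apply: cvgM => //; exact: cvg_cst.
  exact: continuous_expR.
- move=> n x /in0y x0; rewrite mulrCA normrM ler_piMl //.
  rewrite gtr0_norm ?dexp_gt0 // /dexp expR_le1 oppr_le0.
  by rewrite mulr_ge0 // ltW.
- by have := integrable_norm (mellin_intg s1 cb db).
Qed.

Lemma cvg_phase (k : R -> R) s y : continuous k -> 0 < y ->
  k (s * atan (y / eps_ n)) @[n --> \oo] --> k (s * (pi / 2)).
Proof.
move=> ck y0.
apply: (@cvg_comp _ _ _ (fun n => s * atan (y / eps_ n)) k _ (nbhs (s * (pi / 2))));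
  last exact: ck.
apply: cvgM; first exact: cvg_cst.
apply: (@cvg_comp _ _ _ (fun n => y / eps_ n) atan _ (pinfty_nbhs R)); last exact: cvgy_atan.
apply/cvgryPge => A; near=> n; rewrite /eps_ invrK -ler_pdivrMl //.
apply: (@le_trans _ _ n%:R); last by rewrite ler_nat.
by near: n; exact: nbhs_infty_ger.
Unshelve. all: by end_near. Qed.

Lemma cvg_modulus s y : 0 < y ->
  (eps_ n ^+ 2 + y ^+ 2) `^ (- (s / 2)) @[n --> \oo] --> y `^ (- s).
Proof.
move=> y0.
have -> : y `^ (- s) = (0 ^+ 2 + y ^+ 2) `^ (- (s / 2)).
  rewrite expr0n add0r -powR_mulrn ?ltW // -powRrM; congr (_ `^ _); by field.
have q0 : 0 < 0 ^+ 2 + y ^+ 2 :> R by rewrite expr0n add0r exprn_gt0.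
apply: (@cvg_comp _ _ _ (fun n => eps_ n ^+ 2 + y ^+ 2) (fun t => t `^ (- (s / 2)))
  _ (nbhs (0 ^+ 2 + y ^+ 2))); last exact: powR_continuous.
by apply: cvgD; [apply: cvgM; exact: cvg_eps|exact: cvg_cst].
Qed.

Lemma modulus_le s eps y : 0 < s -> 0 < y -> (eps ^+ 2 + y ^+ 2) `^ (- (s / 2)) <= y `^ (- s).
Proof.
move=> s0 y0.
have -> : y `^ (- s) = (y ^+ 2) `^ (- (s / 2)).
  rewrite -powR_mulrn ?ltW // -powRrM; congr (_ `^ _); by field.
rewrite !powRN lef_pV2 ?posrE ?powR_gt0 ?exprn_gt0 //; last first.
  by rewrite ltr_wpDl ?sqr_ge0 ?exprn_gt0.
apply: ge0_ler_powR; rewrite ?nnegrE ?addr_ge0 ?sqr_ge0 //; first by rewrite divr_ge0 // ltW.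
by rewrite lerDr sqr_ge0.
Qed.

(** As eps tends to 0 the modulus of (eps - i y)^(-s) increases to y^(-s),
    which is integrable near 0 since s < 1, and its phase tends to s pi / 2. *)
Lemma undamp_kernel (k : R -> R) s b : continuous k -> (forall t, `|k t| <= 1) ->
  0 < s < 1 -> sch b ->
  mellin 0 (fun y => gammaI s * (eps_ n ^+ 2 + y ^+ 2) `^ (- (s / 2)) *
                     k (s * atan (y / eps_ n)) * b y) @[n --> \oo] -->
  gammaI s * k (s * (pi / 2)) * mellin (- s) b.
Proof.
move=> ck k1 /andP[s0 s1] Hb; have sN : -1 < - s by rewrite ltrN2.
have [cb db] := (sch_hcont Hb, sch_hdecay Hb).
have -> : gammaI s * k (s * (pi / 2)) * mellin (- s) b =
   \int[mu]_(y in `]0, +oo[) (gammaI s * k (s * (pi / 2)) * (y `^ (- s) * b y)).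
  by rewrite RintegralZl; [|exact: mbl0y|exact: mellin_intg].
have g0 := gammaI_gt0 s0.
apply: (@Rint_dominated _ _ _ _ (fun y => gammaI s * `|y `^ (- s) * b y|)).
- exact: mbl0y.
- move=> n; apply: mellin_meas; apply: hcontM; last exact: sch_hcont.
  apply: hcontM.
    apply: hcontZ => y y0.
    apply: (@continuous_comp _ _ _ (fun y => eps_ n ^+ 2 + y ^+ 2) (fun t => t `^ (- (s / 2)))).
      by apply: cvgD; [exact: cvg_cst|exact: exprn_continuous].
    by apply: powR_continuous; rewrite ltr_wpDl ?sqr_ge0 ?exprn_gt0.
  move=> y y0; apply: (@continuous_comp _ _ _ (fun y => s * atan (y / eps_ n)) k); last exact: ck.
  exact: der_continuous (der_phase (eps_gt0 n) s y).
- move=> y /in0y y0; rewrite powRr0.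
  rewrite (_ : gammaI s * k (s * (pi / 2)) * (y `^ (- s) * b y) =
    1 * (gammaI s * y `^ (- s) * k (s * (pi / 2)) * b y)); last by ring.
  apply: cvgM; first exact: cvg_cst.
  apply: cvgM; last exact: cvg_cst.
  apply: cvgM; last exact: cvg_phase.
  by apply: cvgM; [exact: cvg_cst|exact: cvg_modulus].
- move=> n y /in0y y0; rewrite powRr0 mul1r !normrM (gtr0_norm g0).
  rewrite -!mulrA ler_wpM2l ?(ltW g0) // mulrA ler_wpM2r //.
  rewrite -[leRHS]mulr1 ler_pM //.
  by rewrite !ger0_norm ?powR_ge0 // modulus_le.
- apply: intgZ; first exact: mbl0y.
  by have := integrable_norm (mellin_intg sN cb db).
Qed.

(** Both sides of [damped_Fcos] have limits as eps tends to 0. *)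
Lemma mellin_Fcos s a : 0 < s < 1 -> sch a ->
  mellin (s - 1) (Fcos a) = gammaI s * cos (s * (pi / 2)) * mellin (- s) (even2 a).
Proof.
move=> s01 Ha; have /andP[s0 s1] := s01; have HF := sch_Fcos Ha.
have c1 := undamp s0 (sch_hcont HF) (sch_hdecay HF).
have c2 := undamp_kernel (@continuous_cos R) (@normr_cos_le1 R) s01 (sch_even2 Ha).
apply: (cvg_unique (@Rhausdorff R) c1); apply: cvg_trans c2; apply: near_eq_cvg.
apply: nearW => n; rewrite damped_Fcos //; apply: eq_mellin => y _.
by have [-> _] := dcos_dsin (eps_gt0 n) y s0.
Qed.

Lemma mellin_Fsin s a : 0 < s < 1 -> sch a ->
  mellin (s - 1) (Fsin a) = gammaI s * sin (s * (pi / 2)) * mellin (- s) (odd2 a).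
Proof.
move=> s01 Ha; have /andP[s0 s1] := s01; have HF := sch_Fsin Ha.
have c1 := undamp s0 (sch_hcont HF) (sch_hdecay HF).
have c2 := undamp_kernel (@continuous_sin R) (@normr_sin_le1 R) s01 (sch_odd2 Ha).
apply: (cvg_unique (@Rhausdorff R) c1); apply: cvg_trans c2; apply: near_eq_cvg.
apply: nearW => n; rewrite damped_Fsin //; apply: eq_mellin => y _.
by have [_ ->] := dcos_dsin (eps_gt0 n) y s0.
Qed.

End MellinFourier.

(** * Regularized powers *)

Section Regularization.
Context {R : realType}.
Notation mu := (@lebesgue_measure R).
Implicit Types (a b f g h : R -> R) (x y c X s alpha : R) (m n : nat).

(** There are m terms, of degrees less than m. *)
Definition taylor m a x : R := \sum_(j < m) (x ^+ j / j`!%:R) * derive1n j a 0.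

Definition trem m a x : R := a x - taylor m a x.

Definition rplusm m alpha a : R :=
  \int[mu]_(x in `]0, 1]) (x `^ alpha * trem m a x) +
  \int[mu]_(x in `[1, +oo[) (x `^ alpha * a x) +
  \sum_(j < m) derive1n j a 0 / (j`!%:R * (alpha + j%:R + 1)).

(** [x_plus] on real functions. *)
Definition rplus alpha := rplusm (Num.truncn (- alpha)) alpha.

Lemma taylor_der m a x : is_derive x 1 (taylor m.+1 a) (taylor m (derive1 a) x).
Proof.
elim: m => [|m IH].
  apply: (der_congr (der_cst (derive1n 0 a 0) x)) => [t|].
    by rewrite /taylor big_ord_recr big_ord0 /= add0r expr0 fact0 divr1 mul1r.
  by rewrite /taylor big_ord0.
have K := derD IH (derZ (derive1n m.+1 a 0 / (m.+1)`!%:R) (derXn m.+1 x)).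
apply: (der_congr K) => [t|]; first by rewrite /taylor [in RHS]big_ord_recr /=; ring.
rewrite /taylor [in RHS]big_ord_recr /= -derive1Sn -derive1nS; congr (_ + _).
rewrite factS natrM; field.
by rewrite pnatr_eq0 -lt0n fact_gt0 /= nat1r pnatr_eq0.
Qed.

Lemma taylorS0 m a : taylor m.+1 a 0 = a 0.
Proof.
rewrite /taylor big_ord_recl /= expr0 fact0 divr1 mul1r big1 ?addr0 // => i _.
by rewrite expr0n /= mul0r mul0r.
Qed.

Lemma trem_der m a x : sch a -> is_derive x 1 (trem m.+1 a) (trem m (derive1 a) x).
Proof. by move=> Ha; exact: derB (sch_der Ha x) (taylor_der m a x). Qed.

Lemma taylor_continuous m a : continuous (taylor m a).
Proof.
move=> x; case: m => [|m]; last exact: der_continuous (taylor_der m a x).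
have -> : taylor 0 a = fun=> 0 by apply/funext => y; rewrite /taylor big_ord0.
exact: cvg_cst.
Qed.

Lemma trem_continuous m a : sch a -> continuous (trem m a).
Proof. by move=> Ha x; apply: cvgB; [exact: sch_continuous|exact: taylor_continuous]. Qed.

(** Induction on m: the derivative of the remainder of a is that of a' at the
    previous order. *)
Lemma trem_bound m a : sch a -> exists2 C, 0 < C & forall x, 0 <= x <= 1 -> `|trem m a x| <= C * x ^+ m.
Proof.
elim: m a => [|m IH] a Ha.
  have [C C0 HC] := decay_bound 0 (sch_decay Ha); exists C => // x _.
  by have := HC x; rewrite expr0 mul1r mulr1 /trem /taylor big_ord0 subr0.
have [C C0 HC] := IH _ (sch_derive Ha); exists C => // x /andP[x0 x1].
have r0 : trem m.+1 a 0 = 0 by rewrite /trem taylorS0 subrr.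
move: x0; rewrite le_eqVlt => /predU1P[<-|x0].
  by rewrite r0 normr0 mulr_ge0 // ltW.
have [||c] := @MVT _ (trem m.+1 a) (trem m (derive1 a)) 0 x x0.
- by move=> y _; exact: trem_der.
- by apply: continuous_subspaceT; exact: trem_continuous.
rewrite in_itv /= => /andP[c0 cx]; rewrite r0 !subr0 => ->.
rewrite normrM (gtr0_norm x0) exprSr mulrA ler_wpM2r ?(ltW x0) //.
apply: le_trans (HC c _) _; first by rewrite (ltW c0) (le_trans (ltW cx)).
by rewrite ler_wpM2l ?(ltW C0) // lerXn2r ?nnegrE ?ltW.
Qed.

Lemma intg_trem m n s a : -1 < s + n%:R -> (n <= m)%N -> sch a ->
  intg `]0, 1] (fun x => x `^ s * trem m a x).
Proof.
move=> s1 nm Ha; have [C C0 HC] := trem_bound m Ha.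
apply: (@intg_le _ _ _ (fun x => C * x `^ (s + n%:R))) => //.
- apply: meas_cont => //.
  by move=> x /in01 /andP[x0 _]; apply: cvgM; [exact: powR_continuous|exact: trem_continuous].
- move=> x /in01 /andP[x0 x1]; rewrite normrM ger0_norm ?powR_ge0 //.
  rewrite powRD; last by rewrite (gt_eqF x0) implybT.
  rewrite powR_mulrn ?(ltW x0) // mulrCA ler_wpM2l ?powR_ge0 //.
  apply: le_trans (HC x _) _; first by rewrite (ltW x0).
  by rewrite ler_wpM2l ?(ltW C0) // ler_wiXn2l // ltW.
- by apply: intgZ => //; exact: intg_powR01.
Qed.

Lemma in1y x : `[1, +oo[%classic x -> 1 <= x.
Proof. by rewrite /= in_itv /= andbT. Qed.

Lemma intg_tail s a : sch a -> intg `[1, +oo[ (fun x => x `^ s * a x).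
Proof.
move=> Ha; have [M M0 HM] := mellin_bound s s (sch_hdecay Ha).
apply: (@intg_le _ _ _ (fun x => (M * 2) * x ^- 2)) => //.
- apply: meas_cont => //.
  move=> x /in1y x1; have x0 : 0 < x by apply: lt_le_trans x1.
  by apply: cvgM; [exact: powR_continuous|exact: sch_continuous].
- move=> x /in1y x1; have x0 : 0 < x by apply: lt_le_trans x1.
  have := HM s x; rewrite lexx => /(_ isT x0) h; apply: (le_trans h).
  rewrite -mulrA ler_wpM2l ?(ltW M0) // /majorant; case: ifPn => [x2|_].
    have -> : x = 1 by apply/eqP; rewrite eq_le x1 x2.
    by rewrite powR1 expr1n invr1 mulr1 ler1n.
  by rewrite ler_peMl ?ler1n // invr_ge0 sqr_ge0.
- by apply: intgZ => //; exact: intg_inv2.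
Qed.

(** Integration by parts on ]0, 1] for the Taylor remainder and on [1, +oo[
    for a. The boundary terms at 1 leave the value there of the Taylor
    polynomial, which the finite sums absorb. *)
Lemma rplusm_derive m alpha a : -1 < alpha + m%:R -> alpha != 0 ->
  (forall j : nat, (j <= m)%N -> alpha + j%:R != 0) -> sch a ->
  rplusm m alpha (derive1 a) = - alpha * rplusm m.+1 (alpha - 1) a.
Proof.
move=> am a0 aj Ha; have Ha' := sch_derive Ha.
have am1 : -1 < (alpha - 1) + m.+1%:R.
  by apply: lt_le_trans am _; rewrite -natr1; lra.
have i1 := intg_trem am (leqnn m) Ha'.
have i2 := intg_trem am1 (leqnn m.+1) Ha.
have j1 := intg_tail alpha Ha'; have j2 := intg_tail (alpha - 1) Ha.
have dr x : 0 < x -> is_derive x 1 (fun x => x `^ alpha * trem m.+1 a x)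
    (alpha * (x `^ (alpha - 1) * trem m.+1 a x) + x `^ alpha * trem m (derive1 a) x).
  move=> x0; apply: is_derive_eq (derM (der_powR alpha x0) (trem_der m x Ha)) _.
  by rewrite mulrA.
have dt x : 0 < x -> is_derive x 1 (fun x => x `^ alpha * a x)
    (alpha * (x `^ (alpha - 1) * a x) + x `^ alpha * derive1 a x).
  move=> x0; apply: is_derive_eq (derM (der_powR alpha x0) (sch_der Ha x)) _.
  by rewrite mulrA.
have E1 : \int[mu]_(x in `]0, 1]) (x `^ alpha * trem m (derive1 a) x) =
    trem m.+1 a 1 - alpha * \int[mu]_(x in `]0, 1]) (x `^ (alpha - 1) * trem m.+1 a x).
  have := @FTC_0c _ _ _ 0 1 ltr01 (fun x hx => dr x (proj1 (andP hx))).
  rewrite powR1 mul1r subr0 RintegralD //; last exact: intgZ.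
  rewrite RintegralZl //.
  move=> K; apply/eqP; rewrite eq_sym subr_eq addrC eq_sym; apply/eqP; apply: K.
  - move=> x /andP[x0 _]; apply: cvgD.
      apply: cvgM; first exact: cvg_cst.
      by apply: cvgM; [exact: powR_continuous|exact: trem_continuous].
    by apply: cvgM; [exact: powR_continuous|exact: trem_continuous].
  - by apply: intgD => //; exact: intgZ.
  have [C C0 HC] := trem_bound m.+1 Ha.
  have as0 : 0 < alpha + m.+1%:R by rewrite -natr1; lra.
  apply/cvgr0Pnorm_le => e e0; near=> x.
  have x0 : 0 < x by near: x; exact: nbhs_right_gt.
  have x1 : x <= 1 by near: x; exact: nbhs_right_le.
  rewrite normrM ger0_norm ?powR_ge0 //.
  apply: (@le_trans _ _ (`|x `^ (alpha + m.+1%:R)| * C)).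
    rewrite [`|x `^ _|]ger0_norm ?powR_ge0 // powRD; last by rewrite (gt_eqF x0) implybT.
    rewrite powR_mulrn ?(ltW x0) // -mulrA ler_wpM2l ?powR_ge0 // [X in _ <= X]mulrC.
    by apply: HC; rewrite x1 ltW.
  rewrite -ler_pdivlMr //; near: x; move: (cvg_powR0 as0) => /cvgr0Pnorm_le; apply.
  by rewrite divr_gt0.
have E2 : \int[mu]_(x in `[1, +oo[) (x `^ alpha * derive1 a x) =
    - a 1 - alpha * \int[mu]_(x in `[1, +oo[) (x `^ (alpha - 1) * a x).
  have := @FTC_cy _ _ _ 0 1 (fun x hx => dt x (lt_le_trans ltr01 hx)).
  rewrite powR1 mul1r sub0r RintegralD //; last exact: intgZ.
  rewrite RintegralZl //.
  move=> K; apply/eqP; rewrite eq_sym subr_eq addrC eq_sym; apply/eqP; apply: K.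
  - move=> x x1; have x0 : 0 < x by apply: lt_le_trans x1.
    apply: cvgD.
      apply: cvgM; first exact: cvg_cst.
      by apply: cvgM; [exact: powR_continuous|exact: sch_continuous].
    by apply: cvgM; [exact: powR_continuous|exact: sch_continuous].
  - by apply: intgD => //; exact: intgZ.
  - by apply: cvg_mellin_pinfty; exact: sch_hdecay.
rewrite /rplusm E1 E2 /trem.
set I1 := \int[mu]_(x in `]0, 1]) _; set I2 := \int[mu]_(x in `[1, +oo[) _.
have -> : taylor m.+1 a 1 = \sum_(j < m.+1) derive1n j a 0 / j`!%:R.
  by apply: eq_bigr => j _; rewrite expr1n mul1r mulrC.
have S : \sum_(j < m) derive1n j (derive1 a) 0 / (j`!%:R * (alpha + j%:R + 1)) -
    \sum_(j < m.+1) derive1n j a 0 / j`!%:R =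
    - alpha * \sum_(j < m.+1) derive1n j a 0 / (j`!%:R * (alpha - 1 + j%:R + 1)).
  rewrite big_ord_recl [in RHS]big_ord_recl /= mulrDr mulr_sumr opprD addrCA; congr (_ + _).
    by rewrite fact0 mulr1n mul1r invr1 mulr1 addr0 subrK mulNr mulrC mulfVK.
  rewrite -sumrB; apply: eq_bigr => j _; rewrite -derive1Sn /bump /= add1n factS natrM.
  have h1 : j`!%:R != 0 :> R by rewrite pnatr_eq0 -lt0n fact_gt0.
  have h2 : j.+1%:R != 0 :> R by rewrite pnatr_eq0.
  have h3 := aj j.+1 (ltn_ord j).
  rewrite (_ : alpha - 1 + j.+1%:R + 1 = alpha + j.+1%:R); last by ring.
  rewrite (_ : alpha + j%:R + 1 = alpha + j.+1%:R); last by rewrite -natr1 addrA.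
  move: h1 h2 h3 (derive1n j.+1 a 0); rewrite -natr1; set N := j%:R; set F := j`!%:R.
  move=> h1 h2 h3 d; field; rewrite h1 h3 /= ?h2 //.
rewrite mulrDr -S mulrDr; ring.
Unshelve. all: by end_near. Qed.

Lemma truncn_opp0 alpha : -1 < alpha -> Num.truncn (- alpha) = 0%N.
Proof. by move=> h; apply/truncn0Pn; rewrite -ltNge ltrNl. Qed.

Lemma truncn_oppS alpha : alpha <= 0 ->
  Num.truncn (- (alpha - 1)) = (Num.truncn (- alpha)).+1.
Proof.
move=> h; have h0 : 0 <= - alpha by rewrite oppr_ge0.
have /andP[h1 h2] := truncn_itv h0.
apply: truncn_def; rewrite opprB addrC -natr1 lerD2r h1 /=.
by rewrite -(natr1 (_.+1)) ltrD2r.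
Qed.

Lemma truncn_gtN1 alpha : -1 < alpha + (Num.truncn (- alpha))%:R.
Proof. by have := truncnS_gt (- alpha); rewrite -natr1; lra. Qed.

Lemma rplusE alpha a : -1 < alpha -> sch a -> rplus alpha a = mellin alpha a.
Proof.
move=> h Ha; rewrite /rplus /rplusm truncn_opp0 // big_ord0 addr0 /mellin.
have iM := mellin_intg h (sch_hcont Ha) (sch_hdecay Ha).
have -> : `]0, +oo[%classic = `]0, 1]%classic `|` `]1, +oo[%classic :> set (measurableTypeR R).
  by rewrite -itv_bndbnd_setU // bnd_simp.
have m1 : mble (`]1, +oo[%classic : set R) by exact: measurable_itv.
rewrite Rintegral_setU //.
- congr (_ + _).
    by apply: eq_Rintegral => x _; rewrite /trem /taylor big_ord0 subr0.
  rewrite Rintegral_itv_obnd_cbnd //; apply: intgS (intg_tail alpha Ha) => //.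
  by move=> x; rewrite /= !in_itv /= !andbT; exact: ltW.
- by rewrite -itv_bndbnd_setU // bnd_simp.
- apply/disj_setPS => x [/=]; rewrite !in_itv /= andbT => /andP[_ h1] h2.
  by move: (lt_le_trans h2 h1); rewrite ltxx.
Qed.

Definition nonint alpha := alpha \isn't a Num.int.

Lemma nonint_neq alpha (n : int) : nonint alpha -> alpha != n%:~R.
Proof. by apply: contraNneq => ->; exact: intr_int. Qed.

Lemma nonintD alpha (n : int) : nonint alpha -> nonint (alpha + n%:~R).
Proof.
apply: contraNN => h; rewrite -(addrK n%:~R alpha).
by apply: rpredB => //; exact: intr_int.
Qed.

Lemma nonintN alpha : nonint alpha -> nonint (- alpha).
Proof. by rewrite /nonint rpredN. Qed.

Lemma nonintS alpha : nonint alpha -> nonint (alpha + 1).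
Proof. by move=> /(nonintD 1). Qed.

Lemma nonintP alpha : nonint alpha -> nonint (alpha - 1).
Proof. by move=> /(nonintD (-1)); rewrite rmorphN1. Qed.

(** x_+^alpha has the derivative alpha x_+^(alpha-1); this rule relates the
    exponents of consecutive unit intervals. *)
Lemma rplus_derive alpha a : nonint alpha -> sch a ->
  rplus alpha (derive1 a) = - alpha * rplus (alpha - 1) a.
Proof.
move=> ha Ha; have Ha' := sch_derive Ha.
have [a0|a0] := leP alpha 0.
  rewrite {2}/rplus truncn_oppS //; apply: rplusm_derive => //.
  - exact: truncn_gtN1.
  - exact: (nonint_neq 0 ha).
  - by move=> j _; exact: (nonint_neq 0 (nonintD j ha)).
have h1 : -1 < alpha by apply: lt_trans a0; rewrite ltrN10.
have h2 : -1 < alpha - 1 by rewrite ltrBrDl subrr.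
by rewrite !rplusE // mellin_sch_parts.
Qed.

Lemma rplusMx alpha a : -1 < alpha -> sch a ->
  rplus alpha (fun x => x * a x) = rplus (alpha + 1) a.
Proof.
move=> h Ha; rewrite !rplusE //; [exact: mellinMx| |exact: schMx].
by apply: lt_trans h _; rewrite ltrDl.
Qed.

End Regularization.

(** * Transforms of non-integer powers *)

Section FourierHomogeneous.
Context {R : realType}.
Notation mu := (@lebesgue_measure R).
Implicit Types (a b f g h : R -> R) (x y c X s alpha : R) (m n : nat).

Lemma GammaE s : Gamma s =
  gammaI (s + (Num.truncn (1 - s))%:R) / \prod_(j < Num.truncn (1 - s)) (s + j%:R).
Proof.
rewrite /Gamma /gammaI /mellin; congr (_ / _); apply: eq_Rintegral => x _.
by rewrite /dexp mul1r.
Qed.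

Lemma Gamma_gt0E s : 0 < s -> Gamma s = gammaI s.
Proof.
move=> s0; rewrite GammaE; have -> : Num.truncn (1 - s) = 0%N.
  by apply/truncn0Pn; rewrite -ltNge ltrBlDl ltrDr.
by rewrite big_ord0 divr1 addr0.
Qed.

Lemma GammaS s : nonint s -> Gamma (s + 1) = s * Gamma s.
Proof.
move=> ns; have [s0|s0] := leP s 0; last first.
  by rewrite !Gamma_gt0E ?addr_gt0 // gammaIS.
rewrite !GammaE (_ : 1 - s = - (s - 1)); last by rewrite opprB.
rewrite truncn_oppS // (_ : 1 - (s + 1) = - s); last by rewrite opprD addrCA subrr addr0.
set m := Num.truncn (- s).
rewrite big_ord_recl /= addr0 invfM mulrCA [s * (s^-1 * _)]mulrA mulfV ?mul1r; last first.
  exact: (nonint_neq 0 ns).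
congr (_ / _); first by rewrite -natr1 addrAC addrA.
by apply: eq_bigr => j _; rewrite /bump /= add1n -natr1 -addrA (addrC 1).
Qed.

Lemma odd2_Mx a : odd2 (fun x => x * a x) = (fun x => x * even2 a x).
Proof. by apply/funext => x; rewrite /odd2 /even2; ring. Qed.

Lemma even2_Mx a : even2 (fun x => x * a x) = (fun x => x * odd2 a x).
Proof. by apply/funext => x; rewrite /odd2 /even2; ring. Qed.

Lemma derive1_even2 a : sch a -> derive1 (even2 a) = odd2 (derive1 a).
Proof.
move=> Ha; apply: der_funE => x; rewrite /even2.
have K := @dercomp _ a (fun x => - x) x _ _ (sch_der Ha _) (derN (der_id x)).
by apply: is_derive_eq (derD (sch_der Ha x) K) _; rewrite mulrN1.
Qed.

Lemma derive1_odd2 a : sch a -> derive1 (odd2 a) = even2 (derive1 a).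
Proof.
move=> Ha; apply: der_funE => x; rewrite /odd2.
have K := @dercomp _ a (fun x => - x) x _ _ (sch_der Ha _) (derN (der_id x)).
by apply: is_derive_eq (derB (sch_der Ha x) K) _; rewrite mulrN1 opprK.
Qed.

Lemma derive1_Fcos a : sch a -> derive1 (Fcos a) = (fun xi => - Fsin (fun x => x * a x) xi).
Proof. by move=> Ha; apply: der_funE => x; exact: Fcos_der. Qed.

Lemma derive1_Fsin a : sch a -> derive1 (Fsin a) = Fcos (fun x => x * a x).
Proof. by move=> Ha; apply: der_funE => x; exact: Fsin_der. Qed.

(** The Fourier transform of x_+^alpha on a real test function, split into
    real and imaginary parts. *)
Definition Fourier_rule alpha := forall a, sch a ->
  rplus alpha (Fcos a) =
    Gamma (alpha + 1) * cos ((alpha + 1) * pi / 2) * rplus (- alpha - 1) (even2 a) /\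
  rplus alpha (Fsin a) =
    Gamma (alpha + 1) * sin ((alpha + 1) * pi / 2) * rplus (- alpha - 1) (odd2 a).

Lemma Fourier_rule_base alpha : -1 < alpha < 0 -> Fourier_rule alpha.
Proof.
move=> /andP[h1 h2] a Ha; have s01 : 0 < alpha + 1 < 1 by lra.
have h3 : -1 < - alpha - 1 by lra.
have := mellin_Fcos s01 Ha; have := mellin_Fsin s01 Ha.
rewrite addrK mulrA opprD => Es Ec.
rewrite !rplusE //; [|exact: sch_odd2|exact: sch_Fsin|exact: sch_even2|exact: sch_Fcos].
by rewrite Gamma_gt0E ?Es ?Ec //; case/andP: s01.
Qed.

Lemma derive1nZ c a m : sch a -> derive1n m (fun x => c * a x) = (fun x => c * derive1n m a x).
Proof.
elim: m a => [//|m IH] a Ha; rewrite !derive1Sn -IH; last exact: sch_derive.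
by congr derive1n; apply: der_funE => x; exact: derZ (sch_der Ha x).
Qed.

Lemma rplusZ c alpha a : sch a -> rplus alpha (fun x => c * a x) = c * rplus alpha a.
Proof.
move=> Ha; rewrite /rplus /rplusm.
set m := Num.truncn (- alpha); have am : -1 < alpha + m%:R by exact: truncn_gtN1.
have i1 := intg_trem am (leqnn m) Ha; have i2 := intg_tail alpha Ha.
rewrite !mulrDr -!RintegralZl //; congr (_ + _ + _).
- apply: eq_Rintegral => x _; rewrite /trem [RHS]mulrCA; congr (_ * _); rewrite [RHS]mulrBr; congr (_ - _).
  rewrite /taylor mulr_sumr; apply: eq_bigr => j _.
  by rewrite derive1nZ // mulrCA.
- by apply: eq_Rintegral => x _; rewrite mulrCA.
- by rewrite mulr_sumr; apply: eq_bigr => j _; rewrite derive1nZ // mulrA.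
Qed.

Lemma rplusN alpha a : sch a -> rplus alpha (fun x => - a x) = - rplus alpha a.
Proof.
by move=> Ha; rewrite -[RHS]mulN1r -rplusZ //; under [in RHS]eq_fun do rewrite mulN1r.
Qed.

(** Apply the rule to x a(x). Its transforms are derivatives of those of a,
    and [rplus_derive] lowers the exponent on the left; on the right the
    factor x raises - alpha - 1 by one. *)
Lemma Fourier_rule_down alpha : nonint alpha -> alpha < 0 ->
  Fourier_rule alpha -> Fourier_rule (alpha - 1).
Proof.
move=> na a0 IH a Ha; have Hx := schMx Ha; have [E1 E2] := IH _ Hx.
have an0 : alpha != 0 by exact: (nonint_neq 0 na).
have h : -1 < - alpha - 1 by lra.
have K1 := rplus_derive na (sch_Fcos Ha); have K2 := rplus_derive na (sch_Fsin Ha).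
rewrite derive1_Fcos // rplusN // in K1; last exact: sch_Fsin.
rewrite derive1_Fsin // in K2.
rewrite E2 odd2_Mx rplusMx // in K1; last exact: sch_even2.
rewrite E1 even2_Mx rplusMx // in K2; last exact: sch_odd2.
rewrite !subrK (_ : - (alpha - 1) - 1 = - alpha); last by ring.
rewrite subrK GammaS // in K1; rewrite subrK GammaS // in K2.
have t : (alpha + 1) * pi / 2 = alpha * pi / 2 + pi / 2 by ring.
rewrite t sinDpihalf in K1; rewrite t cosDpihalf in K2.
split; apply: (mulfI an0).
  by apply: oppr_inj; rewrite -[LHS]mulNr -K1; ring.
by apply: oppr_inj; rewrite -[LHS]mulNr -K2; ring.
Qed.

(** Apply the rule to a'. Its transforms are those of a multiplied by xi,
    which raises the exponent on the left; on the right [rplus_derive] lowers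
    - alpha - 1 by one. *)
Lemma Fourier_rule_up alpha : nonint alpha -> -1 < alpha ->
  Fourier_rule alpha -> Fourier_rule (alpha + 1).
Proof.
move=> na a1 IH a Ha; have Ha' := sch_derive Ha; have [E1 E2] := IH _ Ha'.
have nb : nonint (- alpha - 1) by exact: nonintP (nonintN na).
have K1 := rplus_derive nb (sch_even2 Ha); have K2 := rplus_derive nb (sch_odd2 Ha).
rewrite derive1_even2 // in K1; rewrite derive1_odd2 // in K2.
rewrite K2 in E1; rewrite K1 in E2.
rewrite -!rplusMx //; [|exact: sch_Fsin|exact: sch_Fcos].
have -> : (fun x => x * Fsin a x) = Fcos (derive1 a).
  by apply/funext => x; rewrite Fcos_parts.
have -> : (fun x => x * Fcos a x) = (fun x => - Fsin (derive1 a) x).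
  by apply/funext => x; rewrite Fsin_parts // opprK.
rewrite rplusN //; last exact: sch_Fsin.
rewrite E1 E2 (_ : - (alpha + 1) - 1 = - alpha - 1 - 1); last by ring.
rewrite (GammaS (nonintS na)).
have t : (alpha + 1 + 1) * pi / 2 = (alpha + 1) * pi / 2 + pi / 2 by ring.
by rewrite t sinDpihalf cosDpihalf; split; ring.
Qed.

Lemma Fourier_rule_shift beta n : -1 < beta < 0 ->
  Fourier_rule (beta + n%:R) /\ Fourier_rule (beta - n%:R).
Proof.
move=> b01; have /andP[b1 b0] := b01.
have nb : nonint beta.
  apply/negP => /intrP [z zE]; move: b1 b0; rewrite zE -[X in X < _]mulrN1z.
  by rewrite -[X in _ -> _ < X -> _](mulr0z 1) !ltr_int; lia.
elim: n => [|n [IHu IHd]].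
  by rewrite addr0 subr0; split; exact: Fourier_rule_base.
split.
  rewrite -natr1 addrA; apply: Fourier_rule_up => //; first exact: (nonintD n nb).
  by rewrite (lt_le_trans b1) // lerDl.
rewrite -natr1 opprD addrA; apply: Fourier_rule_down => //.
  by have := nonintD (- n%:Z) nb; rewrite mulrNz.
by rewrite (le_lt_trans _ b0) // gerBl.
Qed.

Lemma Fourier_rule_nonint alpha : nonint alpha -> Fourier_rule alpha.
Proof.
(* The integer translate of alpha that lies between -1 and 0. *)
move=> na; pose z := Num.floor alpha + 1; pose beta := alpha - z%:~R.
have /andP[h1 h2] := floor_itv alpha.
have b1 : -1 < beta < 0.
  rewrite /beta subr_lt0 h2 andbT /z intrD opprD addrA -ltrBlDr opprK addNr subr_gt0.
  rewrite lt_neqAle h1 andbT eq_sym; exact: nonint_neq.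
have -> : alpha = beta + z%:~R by rewrite subrK.
case: (intP z) => [|n|n]; first by have [] := Fourier_rule_shift 0 b1.
  by have [] := Fourier_rule_shift n.+1 b1.
by have [_] := Fourier_rule_shift n.+1 b1; rewrite mulrNz.
Qed.

End FourierHomogeneous.

Local Open Scope complex_scope.
Notation re := (@complex.Re _).
Notation im := (@complex.Im _).
Notation normc := ComplexField.Normc.normc.

(** * Complex-valued functions and Fourier inversion *)

Section ComplexLayer.
Context {R : realType}.
Implicit Types (a b : R -> R) (phi psi : R -> R[i]) (z w : R[i]) (x c : R).

Lemma cext z w : re z = re w -> im z = im w -> z = w.
Proof. by case: z w => [? ?] [? ?] /= -> ->. Qed.

Lemma reM z w : re (z * w) = re z * re w - im z * im w. Proof. by case: z w => [? ?] []. Qed.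
Lemma imM z w : im (z * w) = re z * im w + im z * re w. Proof. by case: z w => [? ?] []. Qed.
Lemma reD z w : re (z + w) = re z + re w. Proof. by case: z w => [? ?] []. Qed.
Lemma imD z w : im (z + w) = im z + im w. Proof. by case: z w => [? ?] []. Qed.
Lemma reN z : re (- z) = - re z. Proof. by case: z. Qed.
Lemma imN z : im (- z) = - im z. Proof. by case: z. Qed.
Lemma reMR c z : re (c%:C * z) = c * re z. Proof. by case: z => ? ? /=; rewrite mul0r subr0. Qed.
Lemma imMR c z : im (c%:C * z) = c * im z. Proof. by case: z => ? ? /=; rewrite mul0r addr0. Qed.
Definition reimE := (reMR, imMR, reM, imM, reD, imD, reN, imN).

Lemma normc_re z : `|re z| <= normc z.
Proof.
case: z => x y /=; rewrite -sqrtr_sqr; apply: ler_wsqrtr.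
by rewrite lerDl sqr_ge0.
Qed.

Lemma normc_im z : `|im z| <= normc z.
Proof.
case: z => x y /=; rewrite -sqrtr_sqr; apply: ler_wsqrtr.
by rewrite lerDr sqr_ge0.
Qed.

Lemma normc_le z : normc z <= `|re z| + `|im z|.
Proof.
case: z => x y /=; rewrite -[leRHS]ger0_norm ?addr_ge0 // -sqrtr_sqr; apply: ler_wsqrtr.
rewrite sqrrD !real_normK ?num_real // addrAC lerDl.
by rewrite mulrn_wge0 // mulr_ge0.
Qed.

Definition cpl a b x : R[i] := a x +i* b x.

Lemma cplE phi : phi = cpl (re \o phi) (im \o phi).
Proof. by apply/funext => x; rewrite /cpl /=; case: (phi x). Qed.

Lemma cderive_cpl n a b x : cderive n (cpl a b) x = derive1n n a x +i* derive1n n b x.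
Proof. by []. Qed.

Lemma schwartz_cpl a b : schwartz (cpl a b) <-> sch a /\ sch b.
Proof.
split.
  move=> [H1 H2]; split; split.
  - by move=> n x; have [] := H1 n x.
  - move=> p q; have [M HM] := H2 p q; exists M => x; apply: le_trans (HM x).
    by rewrite ler_wpM2l ?exprn_ge0 //; exact: (normc_re (cderive q (cpl a b) x)).
  - by move=> n x; have [] := H1 n x.
  - move=> p q; have [M HM] := H2 p q; exists M => x; apply: le_trans (HM x).
    by rewrite ler_wpM2l ?exprn_ge0 //; exact: (normc_im (cderive q (cpl a b) x)).
move=> [[A1 A2] [B1 B2]]; split; first by move=> n x; split; [exact: A1|exact: B1].
move=> p q; have [[M HM] [N HN]] := (A2 p q, B2 p q); exists (M + N) => x.
apply: le_trans (lerD (HM x) (HN x)); rewrite -mulrDr ler_wpM2l ?exprn_ge0 //.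
exact: (normc_le (cderive q (cpl a b) x)).
Qed.

Lemma schwartzP phi : schwartz phi <-> sch (re \o phi) /\ sch (im \o phi).
Proof. by rewrite {1}(cplE phi); exact: schwartz_cpl. Qed.

Lemma schwartz_opp phi : schwartz phi -> schwartz (fun x => phi (- x)).
Proof. by rewrite !schwartzP => -[/sch_opp ? /sch_opp]. Qed.

Lemma schwartz_scale c phi : c != 0 -> schwartz phi -> schwartz (fun x => phi (x * c)).
Proof.
move=> c0; rewrite !schwartzP => -[/(sch_scale c0) Ha /(sch_scale c0) Hb]; split.
  by move: Ha; congr sch; apply/funext => x /=; rewrite mulrC.
by move: Hb; congr sch; apply/funext => x /=; rewrite mulrC.
Qed.

Lemma schwartzD phi psi : schwartz phi -> schwartz psi -> schwartz (fun x => phi x + psi x).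
Proof.
rewrite !schwartzP => -[Ha Hb] [Hc Hd]; split.
  by have := schD Ha Hc; congr sch; apply/funext => x /=; rewrite reimE.
by have := schD Hb Hd; congr sch; apply/funext => x /=; rewrite reimE.
Qed.

Lemma schwartzZ z phi : schwartz phi -> schwartz (fun x => z * phi x).
Proof.
rewrite !schwartzP => -[Ha Hb]; split.
  have := schB (schZ (re z) Ha) (schZ (im z) Hb).
  by congr sch; apply/funext => x /=; rewrite !reimE.
have := schD (schZ (re z) Hb) (schZ (im z) Ha).
by congr sch; apply/funext => x /=; rewrite !reimE.
Qed.

Lemma schwartz0 : schwartz (fun=> 0 : R[i]).
Proof. by apply/schwartzP; split; exact: sch0. Qed.

Lemma fourierE phi : schwartz phi -> fourier phi =
  cpl (fun xi => Fcos (re \o phi) xi - Fsin (im \o phi) xi)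
      (fun xi => Fsin (re \o phi) xi + Fcos (im \o phi) xi).
Proof.
move=> /schwartzP [Ha Hb]; apply/funext => xi; rewrite /fourier /cintegral /cpl.
have [ca da] := (sch_continuous Ha, sch_decay Ha).
have [cb db] := (sch_continuous Hb, sch_decay Hb).
congr (_ +i* _).
  rewrite /Fcos /Fsin -RintegralB //; [|exact: intg_cos|exact: intg_sin].
  by apply: eq_Rintegral => x _; rewrite reimE.
rewrite /Fcos /Fsin -RintegralD //; [|exact: intg_sin|exact: intg_cos].
by apply: eq_Rintegral => x _; rewrite reimE /= addrC.
Qed.

Lemma schwartz_fourier phi : schwartz phi -> schwartz (fourier phi).
Proof.
move=> H; rewrite fourierE //; move/schwartzP: H => [Ha Hb]; apply/schwartz_cpl; split.
  by apply: schB; [exact: sch_Fcos|exact: sch_Fsin].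
by apply: schD; [exact: sch_Fsin|exact: sch_Fcos].
Qed.

Lemma fourier_opp phi xi : schwartz phi ->
  fourier (fun x => phi (- x)) xi = fourier phi (- xi).
Proof.
move=> H; have HN := schwartz_opp H; rewrite !fourierE //.
move/schwartzP: H => [Ha Hb]; move/schwartzP: HN => [HaN HbN].
have K (k : R -> R) a : continuous k -> (forall t, `|k t| <= 1) -> sch a ->
    \int[lebesgue_measure]_x (k (xi * x) * a (- x)) =
    \int[lebesgue_measure]_x (k (- xi * x) * a x).
  move=> ck k1 Hs.
  have ckx e : continuous (fun x : R => k (e * x)).
    by move=> x; apply: (@continuous_comp _ _ _ ( *%R e) k); [exact: mulrl_continuous|exact: ck].
  have I e b : sch b -> intg setT (fun x => k (e * x) * b x).
    by move=> Hc; apply: intg_kernel => //; [exact: sch_continuous|exact: sch_decay].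
  have := @Rint_opp R (fun x => k (- xi * x) * a x) setT measurableT.
  rewrite (_ : [set x | setT (- x)] = setT) //.
  move=> <-.
  - by apply: eq_Rintegral => x _; rewrite mulrNN.
  - by apply: intg_meas; exact: I.
  - apply: intg_eq (I xi _ (sch_opp Hs)) => // x _.
    by rewrite /= mulrNN.
have Kc a : sch a -> Fcos (a \o -%R) xi = Fcos a (- xi).
  by move=> Hs; apply: K => //; [exact: continuous_cos|exact: normr_cos_le1].
have Ks a : sch a -> Fsin (a \o -%R) xi = Fsin a (- xi).
  by move=> Hs; apply: K => //; [exact: continuous_sin|exact: normr_sin_le1].
by rewrite /cpl -!Kc // -!Ks.
Qed.

Lemma fourier_linear z phi psi : schwartz phi -> schwartz psi ->
  fourier (fun x => z * phi x + psi x) = (fun xi => z * fourier phi xi + fourier psi xi).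
Proof.
move=> H1 H2; have H3 := schwartzD (schwartzZ z H1) H2; rewrite !fourierE //.
move/schwartzP: H1 => [Ha Hb]; move/schwartzP: H2 => [Hc Hd].
have Ere : re \o (fun x => z * phi x + psi x) =
    (fun x => (re z * (re \o phi) x + - im z * (im \o phi) x) + (re \o psi) x).
  by apply/funext => x /=; rewrite !reimE mulNr.
have Eim : im \o (fun x => z * phi x + psi x) =
    (fun x => (re z * (im \o phi) x + im z * (re \o phi) x) + (im \o psi) x).
  by apply/funext => x /=; rewrite !reimE.
apply/funext => xi; rewrite Ere Eim /cpl.
have [h1 h2] := (schZ (re z) Ha, schZ (- im z) Hb).
have [h3 h4] := (schZ (re z) Hb, schZ (im z) Ha).
rewrite (FcosD (schD h1 h2) Hc) (FcosD h1 h2) (FcosZ _ Ha) (FcosZ _ Hb).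
rewrite (FsinD (schD h1 h2) Hc) (FsinD h1 h2) (FsinZ _ Ha) (FsinZ _ Hb).
rewrite (FcosD (schD h3 h4) Hd) (FcosD h3 h4) (FcosZ _ Ha) (FcosZ _ Hb).
rewrite (FsinD (schD h3 h4) Hd) (FsinD h3 h4) (FsinZ _ Ha) (FsinZ _ Hb).
move: (Fcos _ xi) (Fsin _ xi) (Fcos _ xi) (Fsin _ xi) (Fcos _ xi) (Fsin _ xi) (Fcos _ xi) (Fsin _ xi).
by move=> *; apply: cext; rewrite !reimE /=; ring.
Qed.

(** This is 2 pi, the square of the integral of the Gaussian. *)
Definition fourier_const : R := Fcos (@gauss R) 0 ^+ 2.

Lemma fourier_const_gt0 : 0 < fourier_const.
Proof. by rewrite exprn_gt0 // Fcos_gauss0_gt0. Qed.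

Lemma fourier_fourier phi xi : schwartz phi ->
  fourier (fourier phi) xi = fourier_const%:C * phi (- xi).
Proof.
move=> H; have HF := schwartz_fourier H; rewrite fourierE // fourierE //.
move/schwartzP: H => [Ha Hb].
set a := re \o phi in Ha *; set b := im \o phi in Hb *.
have [HCa HSa] := (sch_Fcos Ha, sch_Fsin Ha); have [HCb HSb] := (sch_Fcos Hb, sch_Fsin Hb).
have e1 := Fourier_square_even xi Ha; have e2 := Fourier_square_even xi Hb.
have o1 := Fourier_square_odd xi Ha; have o2 := Fourier_square_odd xi Hb.
have E1 : re \o cpl (fun xi => Fcos a xi - Fsin b xi) (fun xi => Fsin a xi + Fcos b xi) =
  (fun xi => Fcos a xi + -1 * Fsin b xi) by apply/funext => x /=; rewrite mulN1r.
have E2 : im \o cpl (fun xi => Fcos a xi - Fsin b xi) (fun xi => Fsin a xi + Fcos b xi) =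
  (fun xi => Fsin a xi + Fcos b xi) by [].
rewrite E1 E2 /cpl (FcosD HCa (schZ (-1) HSb)) (FcosZ _ HSb) (FsinD HSa HCb).
rewrite (FsinD HCa (schZ (-1) HSb)) (FsinZ _ HSb) (FcosD HSa HCb).
rewrite -/(fourier_const) in e1 e2.
apply: cext; rewrite !reimE /=.
  rewrite -[re (phi _)]/(a (- xi)) -e1; move: o2.
  move: (Fcos (Fcos a) xi) (Fcos (Fsin b) xi) (Fsin (Fsin a) xi) (Fsin (Fcos b) xi).
  by clear; move=> u v w t; lra.
rewrite -[im (phi _)]/(b (- xi)) -e2; move: o1.
move: (Fsin (Fcos a) xi) (Fsin (Fsin b) xi) (Fcos (Fsin a) xi) (Fcos (Fcos b) xi).
by clear; move=> u v w t; lra.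
Qed.

Definition fourier_inv phi : R -> R[i] :=
  fun x => fourier_const^-1%:C * fourier (fun y => phi (- y)) x.

Lemma schwartz_fourier_inv phi : schwartz phi -> schwartz (fourier_inv phi).
Proof. by move=> H; apply: schwartzZ; apply: schwartz_fourier; exact: schwartz_opp. Qed.

Lemma constVK z : fourier_const^-1%:C * (fourier_const%:C * z) = z.
Proof.
apply: cext; rewrite !reimE mulrA mulVf ?mul1r //; exact/lt0r_neq0/fourier_const_gt0.
Qed.

Lemma fourier_invK phi : schwartz phi -> fourier (fourier_inv phi) = phi.
Proof.
move=> H; have HN := schwartz_opp H; have HF := schwartz_fourier HN.
rewrite /fourier_inv.
have := fourier_linear fourier_const^-1%:C HF schwartz0.
under eq_fun do rewrite addr0.
move=> ->; apply/funext => x; rewrite fourier_fourier // opprK constVK.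
rewrite [X in _ + X](_ : _ = 0) ?addr0 //.
rewrite /fourier /cintegral; apply: cext; rewrite /= /Rintegral integral0_eq // => y _;
  by rewrite !mulr0 ?subr0 ?addr0.
Qed.

Lemma fourierK phi : schwartz phi -> fourier_inv (fourier phi) = phi.
Proof.
move=> H; apply/funext => x; rewrite /fourier_inv.
have -> : (fun y => fourier phi (- y)) = fourier (fun y => phi (- y)).
  by apply/funext => y; rewrite fourier_opp.
by rewrite fourier_fourier ?opprK ?constVK //; exact: schwartz_opp.
Qed.

Lemma fourier_dilate c phi xi : 0 < c -> schwartz phi ->
  fourier (fun x => phi (x * c)) xi = c^-1%:C * fourier phi (xi / c).
Proof.
move=> c0 H; have HN := schwartz_scale (lt0r_neq0 c0) H; rewrite !fourierE //.
move/schwartzP: H => [Ha Hb]; move/schwartzP: HN => [HaN HbN].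
have K (k : R -> R) a : continuous k -> (forall t, `|k t| <= 1) -> sch a ->
    \int[lebesgue_measure]_x (k (xi * x) * a (x * c)) =
    c^-1 * \int[lebesgue_measure]_x (k (xi / c * x) * a x).
  move=> ck k1 Hs.
  have ckx e : continuous (fun x : R => k (e * x)).
    by move=> x; apply: (@continuous_comp _ _ _ ( *%R e) k); [exact: mulrl_continuous|exact: ck].
  have I e b : sch b -> intg setT (fun x => k (e * x) * b x).
    by move=> Hc; apply: intg_kernel => //; [exact: sch_continuous|exact: sch_decay].
  have E x : xi / c * (c * x) = xi * x by rewrite mulrA mulfVK ?lt0r_neq0.
  rewrite -(Rint_scale c0).
  - by apply: eq_Rintegral => x _; rewrite E [x * c]mulrC.
  - by apply: intg_meas; exact: I.
  - apply: intg_eq (I xi _ (sch_scale (lt0r_neq0 c0) Hs)) => // x _.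
    by rewrite E.
have Kc a : sch a -> Fcos (a \o ( *%R^~ c)) xi = c^-1 * Fcos a (xi / c).
  by move=> Hs; apply: K => //; [exact: continuous_cos|exact: normr_cos_le1].
have Ks a : sch a -> Fsin (a \o ( *%R^~ c)) xi = c^-1 * Fsin a (xi / c).
  by move=> Hs; apply: K => //; [exact: continuous_sin|exact: normr_sin_le1].
rewrite /cpl; apply: cext; rewrite !reimE /= ?mulrBr ?mulrDr.
  by rewrite -Kc // -Ks.
by rewrite -Kc // -Ks.
Qed.

End ComplexLayer.

Local Open Scope complex_scope.

(** * Seminorms and continuity of the Fourier transform *)

Section Seminorms.
Context {R : realType}.
Implicit Types (a b c : R -> R) (phi psi : R -> R[i]) (x d : R) (N p q : nat).

(** The seminorms of indices at most N, which define a neighbourhood of 0 in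
    the Schwartz topology, are bounded by d. *)
Definition norms_le N d a := forall p q, (p <= N)%N -> (q <= N)%N -> forall x,
  `|x| ^+ p * `|derive1n q a x| <= d.

Lemma sch_derive1n q a : sch a -> sch (derive1n q a).
Proof. by move=> Ha; elim: q => [//|q IH]; rewrite derive1nS; exact: sch_derive. Qed.

Lemma der_derive1n q a x : sch a -> is_derive x 1 (derive1n q a) (derive1n q.+1 a x).
Proof. by move=> Ha; rewrite derive1nS; exact: sch_der (sch_derive1n q Ha) x. Qed.

Lemma derive1nD q a b : sch a -> sch b ->
  derive1n q (fun x => a x + b x) = (fun x => derive1n q a x + derive1n q b x).
Proof.
elim: q a b => [//|q IH] a b Ha Hb; rewrite !derive1Sn -IH; [|exact: sch_derive..].
by congr derive1n; apply: der_funE => x; apply: derD; exact: sch_der.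
Qed.

Lemma derive1nB q a b : sch a -> sch b ->
  derive1n q (fun x => a x - b x) = (fun x => derive1n q a x - derive1n q b x).
Proof.
move=> Ha Hb; have := derive1nD q Ha (schZ (-1) Hb); rewrite derive1nZ //.
under eq_fun do rewrite mulN1r.
by move=> ->; apply/funext => x; rewrite mulN1r.
Qed.

Lemma derive1n_scale q (l : R) a : l != 0 -> sch a ->
  derive1n q (fun x => a (l * x)) = (fun x => l ^+ q * derive1n q a (l * x)).
Proof.
move=> l0; elim: q a => [|q IH] a Ha; first by apply/funext => x; rewrite expr0 mul1r.
have K : derive1 (fun x => a (l * x)) = (fun x => l * derive1 a (l * x)).
  apply: der_funE => x; have Kx : is_derive x 1 (fun x => l * x) l.
    by apply: (der_congr (der_aff l 0 x)) => // ?; rewrite addr0.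
  by apply: is_derive_eq (@dercomp _ a _ x _ _ (sch_der Ha _) Kx) _; rewrite mulrC.
rewrite derive1Sn K derive1nZ; last by apply: sch_scale => //; exact: sch_derive.
rewrite IH; last exact: sch_derive.
by apply/funext => x; rewrite -derive1Sn exprS mulrA.
Qed.

Lemma derive1nMx q a x : sch a ->
  derive1n q (fun x => x * a x) x = x * derive1n q a x + q%:R * derive1n q.-1 a x.
Proof.
move=> Ha; suff -> : derive1n q (fun x => x * a x) =
    (fun x => x * derive1n q a x + q%:R * derive1n q.-1 a x) by [].
elim: q => [|q IH]; first by apply/funext => y; rewrite mul0r addr0.
rewrite derive1nS IH; apply: der_funE => y.
have D := derD (derM (der_id y) (der_derive1n q y Ha)) (derZ q%:R (der_derive1n q.-1 y Ha)).
apply: is_derive_eq D _; rewrite mul1r addrAC addrC; congr (_ + _).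
rewrite -nat1r mulrDl mul1r; congr (_ + _).
by case: (q) => [|n //]; rewrite !mul0r.
Qed.

Lemma norms_le_ge0 N d a : norms_le N d a -> 0 <= d.
Proof. by move=> /(_ 0%N 0%N isT isT 0); exact: le_trans. Qed.

Lemma norms_leW N N' d a : (N <= N')%N -> norms_le N' d a -> norms_le N d a.
Proof. by move=> NN H p q pN qN; apply: H; exact: leq_trans NN. Qed.

Lemma norms_le_derive N d a : norms_le N.+1 d a -> norms_le N d (derive1 a).
Proof. by move=> H p q pN qN x; rewrite -derive1Sn; apply: H => //; exact: leqW. Qed.

Lemma norms_le_Mx N d a : sch a -> norms_le N.+1 d a -> norms_le N (N.+1%:R * d) (fun x => x * a x).
Proof.
move=> Ha H p q pN qN x; rewrite derive1nMx //.
have d0 := norms_le_ge0 H.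
apply: (@le_trans _ _ (`|x| ^+ p.+1 * `|derive1n q a x| +
    q%:R * (`|x| ^+ p * `|derive1n q.-1 a x|))).
  rewrite exprSr -mulrA -normrM mulrCA -mulrDr ler_wpM2l ?exprn_ge0 //.
  by rewrite (le_trans (ler_normD _ _)) // [in leLHS]normrM [`|_%:R * _|]normrM normr_nat -normrM.
rewrite -nat1r mulrDl mul1r lerD //; first by apply: H => //; exact: leqW.
apply: ler_pM => //; first by rewrite ler_nat.
by apply: H; [exact: leqW|rewrite (leq_trans (leq_pred q)) // leqW].
Qed.

Lemma sch_norms_le N a : sch a -> exists2 M, 0 < M & norms_le N M a.
Proof.
move=> [_ Ha].
have /choice[M HM] : forall i : 'I_N.+1 * 'I_N.+1, exists M, forall x,
    `|x| ^+ i.1 * `|derive1n i.2 a x| <= M by move=> i; exact: Ha.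
exists (1 + \sum_i `|M i|); first by rewrite ltr_pwDl // sumr_ge0.
move=> p q pN qN x; have := HM (Ordinal (pN : (p < N.+1)%N), Ordinal (qN : (q < N.+1)%N)) x.
move=> /= h; apply: (le_trans h); apply: (le_trans (ler_norm _)).
rewrite (bigD1 (Ordinal (pN : (p < N.+1)%N), Ordinal (qN : (q < N.+1)%N))) //= addrCA lerDl.
by rewrite addr_ge0 // sumr_ge0.
Qed.

(** T is bounded in the supremum norm by finitely many seminorms. The two
    stability properties below reduce all seminorms of the transforms to
    [controlled_Fourier]. *)
Definition controlled (T : (R -> R) -> R -> R) := exists N K, 0 < K /\
  forall a d, sch a -> norms_le N d a -> forall x, `|T a x| <= K * d.

Lemma controlled_eq T T' : (forall a x, sch a -> `|T' a x| = `|T a x|) ->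
  controlled T -> controlled T'.
Proof.
by move=> E [N [K [K0 H]]]; exists N, K; split=> // a d Ha Hd x; rewrite E //; exact: H.
Qed.

Lemma controlled_derive T : controlled T -> controlled (fun a => T (derive1 a)).
Proof.
move=> [N [K [K0 H]]]; exists N.+1, K; split=> // a d Ha Hd.
by apply: H; [exact: sch_derive|exact: norms_le_derive].
Qed.

Lemma controlled_Mx T : controlled T -> controlled (fun a => T (fun x => x * a x)).
Proof.
move=> [N [K [K0 H]]]; exists N.+1, (K * N.+1%:R); split; first by rewrite mulr_gt0 ?ltr0n.
by move=> a d Ha Hd x; rewrite -mulrA; apply: H; [exact: schMx|exact: norms_le_Mx].
Qed.

Lemma controlled_Fourier : controlled Fcos /\ controlled Fsin.
Proof.
have [K K0 HK] := @kernel_bound R.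
have dom a d : norms_le 2 d a -> forall x, `|a x| <= 2 * d * (1 + x ^+ 2)^-1.
  move=> Hd x; rewrite ler_pdivlMr; last by rewrite ltr_pwDl // sqr_ge0.
  have := Hd 0%N 0%N isT isT x; have := Hd 2 0%N isT isT x.
  by rewrite real_normK ?num_real // expr0 mul1r /=; move: `|a x| (x ^+ 2) => u v; nra.
split; exists 2%N, (K * 2); (split; first by rewrite mulr_gt0) => a d Ha Hd x;
  rewrite -mulrA; apply: HK; try exact: sch_continuous; try exact: dom.
- exact: cosx_continuous.
- by move=> y; exact: normr_cos_le1.
- exact: sinx_continuous.
- by move=> y; exact: normr_sin_le1.
Qed.

(** Powers of xi times derivatives of the transforms are themselves
    transforms, of derivatives of the function and of its multiples by powers
    of x. *)
Lemma controlled_Fourier_pq q p :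
  controlled (fun a x => x ^+ p * derive1n q (Fcos a) x) /\
  controlled (fun a x => x ^+ p * derive1n q (Fsin a) x).
Proof.
elim: q => [|q [IHc IHs]].
  elim: p => [|p [IHc IHs]].
    have [Hc Hs] := controlled_Fourier.
    by split; [apply: controlled_eq Hc|apply: controlled_eq Hs] => a x _; rewrite expr0 mul1r.
  split.
    apply: controlled_eq (controlled_derive IHs) => a x Ha.
    by rewrite /= Fsin_parts // mulrN normrN mulrA exprSr.
  apply: controlled_eq (controlled_derive IHc) => a x Ha.
  by rewrite /= Fcos_parts // mulrA exprSr.
split.
  apply: controlled_eq (controlled_Mx IHs) => a x Ha.
  rewrite derive1Sn derive1_Fcos //.
  have -> : (fun xi => - Fsin (fun x => x * a x) xi) = (fun xi => -1 * Fsin (fun x => x * a x) xi).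
    by apply/funext => y; rewrite mulN1r.
  rewrite derive1nZ; last by apply: sch_Fsin; exact: schMx.
  by rewrite mulN1r mulrN normrN.
apply: controlled_eq (controlled_Mx IHc) => a x Ha.
by rewrite derive1Sn derive1_Fsin.
Qed.

Lemma Fourier_norms_le N : exists N' K, 0 < K /\ forall a d, sch a -> norms_le N' d a ->
  norms_le N (K * d) (Fcos a) /\ norms_le N (K * d) (Fsin a).
Proof.
pose T (i : bool * ('I_N.+1 * 'I_N.+1)) a x : R :=
  x ^+ i.2.1 * derive1n i.2.2 ((if i.1 then Fcos else Fsin) a) x.
have HT i : controlled (T i).
  by case: i => [[] [p q]]; have [? ?] := controlled_Fourier_pq q p.
have /choice[N_ /choice[K_ HK]] := HT.
exists (\max_i N_ i)%N, (1 + \sum_i K_ i).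
have K0 i : 0 < K_ i by have [] := HK i.
have S0 : 0 <= \sum_i K_ i by apply: sumr_ge0 => i _; exact: ltW.
split; first by rewrite ltr_pwDl.
move=> a d Ha Hd; have d0 := norms_le_ge0 Hd.
have B i x : `|T i a x| <= (1 + \sum_i K_ i) * d.
  have [_ h] := HK i; apply: (le_trans (h a d Ha _ x)).
    by apply: norms_leW Hd; exact: (leq_bigmax i).
  rewrite ler_wpM2r // (bigD1 i) //= addrCA lerDl addr_ge0 //.
  by apply: sumr_ge0 => j _; exact: ltW.
split=> p q pN qN x.
  have := B (true, (Ordinal (pN : (p < N.+1)%N), Ordinal (qN : (q < N.+1)%N))) x.
  by rewrite /T /= normrM normrX.
have := B (false, (Ordinal (pN : (p < N.+1)%N), Ordinal (qN : (q < N.+1)%N))) x.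
by rewrite /T /= normrM normrX.
Qed.

Definition cnorms_le N d phi := forall p q, (p <= N)%N -> (q <= N)%N -> forall x,
  `|x| ^+ p * normc (cderive q phi x) <= d.

Lemma cnorms_le_parts N d phi : cnorms_le N d phi -> norms_le N d (re \o phi) /\ norms_le N d (im \o phi).
Proof.
move=> H; split=> p q pN qN x; apply: le_trans (H p q pN qN x);
  rewrite ler_wpM2l ?exprn_ge0 //.
  exact: (normc_re (cderive q phi x)).
exact: (normc_im (cderive q phi x)).
Qed.

Lemma cnorms_le_cpl N d e a b : norms_le N d a -> norms_le N e b -> cnorms_le N (d + e) (cpl a b).
Proof.
move=> Ha Hb p q pN qN x; apply: le_trans (lerD (Ha p q pN qN x) (Hb p q pN qN x)).
rewrite -mulrDr ler_wpM2l ?exprn_ge0 //; exact: (normc_le (cderive q (cpl a b) x)).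
Qed.

Lemma norms_leD N d e a b : sch a -> sch b -> norms_le N d a -> norms_le N e b -> norms_le N (d + e) (fun x => a x + b x).
Proof.
move=> Ha Hb Hd He p q pN qN x; rewrite derive1nD //.
apply: le_trans (lerD (Hd p q pN qN x) (He p q pN qN x)).
by rewrite -mulrDr ler_wpM2l ?exprn_ge0 // ler_normD.
Qed.

Lemma norms_leB N d e a b : sch a -> sch b -> norms_le N d a -> norms_le N e b -> norms_le N (d + e) (fun x => a x - b x).
Proof.
move=> Ha Hb Hd He p q pN qN x; rewrite derive1nB //.
apply: le_trans (lerD (Hd p q pN qN x) (He p q pN qN x)).
by rewrite -mulrDr ler_wpM2l ?exprn_ge0 // ler_normB.
Qed.

Lemma fourier_cnorms_le N : exists N' K, 0 < K /\ forall phi d, schwartz phi ->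
  cnorms_le N' d phi -> cnorms_le N (K * d) (fourier phi).
Proof.
have [N' [K [K0 H]]] := Fourier_norms_le N; exists N', (K * 4); split; first by rewrite mulr_gt0.
move=> phi d Hphi /cnorms_le_parts [Ba Bb]; have [Ha Hb] := (schwartzP phi).1 Hphi.
have [ca sa] := H _ _ Ha Ba; have [cb sb] := H _ _ Hb Bb.
rewrite fourierE // (_ : K * 4 * d = (K * d + K * d) + (K * d + K * d)); last by ring.
apply: cnorms_le_cpl.
  by apply: norms_leB => //; [exact: sch_Fcos|exact: sch_Fsin].
by apply: norms_leD => //; [exact: sch_Fsin|exact: sch_Fcos].
Qed.

End Seminorms.

(** * Operations on tempered distributions *)

Section TemperedOperations.
Context {R : realType}.
Implicit Types (phi psi : R -> R[i]) (f g h : @functional R).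

Lemma schwartzB phi psi : schwartz phi -> schwartz psi -> schwartz (fun x => phi x - psi x).
Proof.
move=> H1 H2; have := schwartzD H1 (schwartzZ (-1) H2).
by under eq_fun do rewrite mulN1r.
Qed.

Lemma fourierB phi psi : schwartz phi -> schwartz psi ->
  fourier (fun x => phi x - psi x) = (fun xi => fourier phi xi - fourier psi xi).
Proof.
move=> H1 H2; have := fourier_linear (-1) H2 H1.
under eq_fun do rewrite mulN1r addrC.
by move=> ->; apply/funext => xi; rewrite mulN1r addrC.
Qed.

Lemma tempered_fourierD f : tempered f -> tempered (fourierD f).
Proof.
move=> [Lf Cf]; split.
  move=> z phi psi H1 H2; rewrite /fourierD fourier_linear //.
  by apply: Lf; exact: schwartz_fourier.
move=> phi H1 eps e0; have [N [d [d0 Hd]]] := Cf _ (schwartz_fourier H1) eps e0.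
have [N' [K [K0 HK]]] := @fourier_cnorms_le R N.
exists N', (d / K); split; first by rewrite divr_gt0.
move=> psi H2 Hs; apply: Hd; first exact: schwartz_fourier.
have := HK _ _ (schwartzB H2 H1) Hs; rewrite fourierB // mulrC divfK //.
exact: lt0r_neq0.
Qed.

Lemma tempered_opp f : tempered f -> tempered (fun phi => f (fun x => phi (- x))).
Proof.
move=> [Lf Cf]; split.
  by move=> z phi psi H1 H2; apply: (Lf z (fun x => phi (- x)) (fun x => psi (- x)));
    exact: schwartz_opp.
move=> phi H1 eps e0; have [N [d [d0 Hd]]] := Cf _ (schwartz_opp H1) eps e0.
exists N, d; split => // psi H2 Hs; apply: Hd; first exact: schwartz_opp.
move=> p q pN qN x; have := Hs p q pN qN (- x).
have /schwartzP[Ha Hb] := schwartzB H2 H1.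
have n1 : (-1 : R) != 0 by rewrite oppr_eq0 oner_eq0.
have E a : sch a -> derive1n q (fun x => a (- x)) x = (-1) ^+ q * derive1n q a (- x).
  move=> Hs'; have := derive1n_scale q n1 Hs'; under eq_fun do rewrite mulN1r.
  by move=> ->; rewrite mulN1r.
have -> : cderive q (fun y => psi (- y) - phi (- y)) x =
    ((-1) ^+ q)%:C * cderive q (fun y => psi y - phi y) (- x).
  apply: cext.
    by rewrite reMR; exact: (E _ Ha).
  by rewrite imMR; exact: (E _ Hb).
rewrite ComplexField.Normc.normcM normrN [X in _ <= _ -> _ * (X * _) <= _](_ : _ = 1) ?mul1r //.
by rewrite /= expr0n addr0 sqrtr_sqr normrX normrN1 expr1n.
Qed.

Lemma temperedZ (z : R[i]) f : tempered f -> tempered (fun phi => z * f phi).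
Proof.
move=> [Lf Cf]; split.
  by move=> w phi psi H1 H2; rewrite Lf // mulrDr mulrCA.
move=> phi H1 eps e0.
have z1 : 0 < normc z + 1 by rewrite ltr_wpDl // (le_trans _ (normc_re z)).
have [N [d [d0 Hd]]] := Cf phi H1 (eps / (normc z + 1)) (divr_gt0 e0 z1).
exists N, d; split => // psi H2 Hs; rewrite -mulrBr ComplexField.Normc.normcM.
apply: (@le_lt_trans _ _ ((normc z + 1) * normc (f psi - f phi))).
  by rewrite ler_wpM2r ?lerDl // (le_trans _ (normc_re _)).
by rewrite mulrC -ltr_pdivlMr //; exact: Hd.
Qed.

Lemma tempered0 f : tempered f -> f (fun=> 0) = 0.
Proof.
move=> [Lf _]; have := Lf 1 _ _ schwartz0 schwartz0.
under [X in f X]eq_fun do rewrite mulr0 addr0.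
by rewrite mul1r => /eqP; rewrite -subr_eq0 opprD addNKr oppr_eq0 => /eqP.
Qed.

Lemma tempered_small f : tempered f -> forall eps, 0 < eps ->
  exists N d, 0 < d /\ forall psi, schwartz psi -> cnorms_le N d psi -> normc (f psi) < eps.
Proof.
move=> Tf eps e0; have [_ Cf] := Tf; have [N [d [d0 Hd]]] := Cf _ schwartz0 eps e0.
exists N, d; split => // psi H Hs; have := Hd psi H; rewrite tempered0 // subr0; apply.
by under eq_fun do rewrite subr0.
Qed.

Lemma eqD_tempered f g : eqD f g -> tempered f -> tempered g.
Proof.
move=> E [Lf Cf]; split.
  by move=> z phi psi H1 H2; rewrite -!E // ?Lf //; apply: schwartzD => //; exact: schwartzZ.
move=> phi H1 eps e0; have [N [d [d0 Hd]]] := Cf phi H1 eps e0.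
by exists N, d; split => // psi H2 Hs; rewrite -!E //; exact: Hd.
Qed.

End TemperedOperations.

(** * The derivative of a dilation *)

Section DilationDerivative.
Context {R : realType}.
Implicit Types (a b : R -> R) (x l mu : R) (N p q : nat).

Lemma MVT_near1 (f df : R -> R) (e l : R) :
  (forall t : R, `|t - 1| < e -> is_derive t 1 f (df t)) -> `|l - 1| < e ->
  exists2 c, `|c - 1| <= `|l - 1| & f l - f 1 = df c * (l - 1).
Proof.
move=> D le; have C (t : R) : `|t - 1| < e -> {for t, continuous f}.
  by move=> /D; exact: der_continuous.
have [l1|l1] := leP l 1.
  have H (t : R) : t \in `[l, 1] -> `|t - 1| <= `|l - 1|.
    by rewrite in_itv /= => /andP[lt t1]; rewrite !ler0_norm ?subr_le0 // lerN2 lerB.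
  have [||c cI E] := @MVT_segment _ f df l 1 l1.
  - move=> t tI; apply: D; apply: le_lt_trans le; apply: H; exact: subset_itv_oo_cc.
  - apply: continuous_in_subspaceT => t; rewrite inE /= => tI.
    by apply: C; apply: le_lt_trans le; exact: H.
  by exists c; [exact: H|rewrite -opprB E; ring].
have H (t : R) : t \in `[1, l] -> `|t - 1| <= `|l - 1|.
  by rewrite in_itv /= => /andP[lt t1]; rewrite !ger0_norm ?subr_ge0 ?(ltW l1) // lerB.
have [||c cI E] := @MVT_segment _ f df 1 l (ltW l1).
- move=> t tI; apply: D; apply: le_lt_trans le; apply: H; exact: subset_itv_oo_cc.
- apply: continuous_in_subspaceT => t; rewrite inE /= => tI.
  by apply: C; apply: le_lt_trans le; exact: H.
by exists c; [exact: H|].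
Qed.

(** The derivative of order q of b(mu x) in x. *)
Definition dil q b x mu := mu ^+ q * derive1n q b (mu * x).

(** Differentiating b(mu x) in mu amounts to replacing b by x b'(x) and
    dividing by mu; this commutes with the derivatives in x. *)
Lemma der_dil q b x mu : sch b -> mu != 0 ->
  is_derive mu 1 (dil q b x) (mu^-1 * dil q (fun y => y * derive1 b y) x mu).
Proof.
move=> Hb mu0; have Dx : is_derive mu 1 (fun t => t * x) x.
  by apply: (der_congr (der_aff x 0 mu)) => // t; rewrite addr0 mulrC.
have D := derM (derXn q mu) (@dercomp _ _ (fun t => t * x) mu _ _ (der_derive1n q (mu * x) Hb) Dx).
apply: is_derive_eq D _; rewrite /dil derive1nMx; last exact: sch_derive.
rewrite -derive1Sn; case: q => [|q]; first by rewrite !mul0r /= expr0; field.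
by rewrite -derive1Sn exprS /=; field.
Qed.

Lemma dil_bound N M b x mu p q : norms_le N M b -> (p <= N)%N -> (q <= N)%N ->
  `|mu - 1| <= 2^-1 -> `|x| ^+ p * `|dil q b x mu| <= 4 ^+ N * M.
Proof.
move=> HM pN qN; rewrite ler_distl => /andP[m1 m2].
have m12 : 2^-1 <= mu by lra.
have m32 : mu <= 2 by lra.
have mu0 : 0 < mu by lra.
rewrite /dil normrM normrX gtr0_norm //.
have -> : `|x| ^+ p * (mu ^+ q * `|derive1n q b (mu * x)|) =
    (mu ^+ q * mu^-1 ^+ p) * (`|mu * x| ^+ p * `|derive1n q b (mu * x)|).
  rewrite normrM (gtr0_norm mu0) exprMn exprVn.
  by field; rewrite expf_neq0 // gt_eqF.
apply: ler_pM; rewrite ?mulr_ge0 ?exprn_ge0 // ?invr_ge0 ?(ltW mu0) //; last exact: HM.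
have -> : 4 = 2 * 2 :> R by ring.
rewrite exprMn; apply: ler_pM; rewrite ?exprn_ge0 // ?invr_ge0 ?(ltW mu0) //.
  apply: (@le_trans _ _ (2 ^+ q)); first by rewrite lerXn2r ?nnegrE ?(ltW mu0).
  by rewrite ler_weXn2l // ler1n.
apply: (@le_trans _ _ (2 ^+ p)); last by rewrite ler_weXn2l // ler1n.
rewrite lerXn2r ?nnegrE ?invr_ge0 ?(ltW mu0) //.
by rewrite -[leRHS]invrK lef_pV2 // posrE // invr_gt0.
Qed.

(** The error of the difference quotient at l = 1 of the dilations of a. *)
Definition slope l a x := (l - 1)^-1 * (a (l * x) - a x) - x * derive1 a x.

Lemma sch_slope l a : l != 0 -> sch a -> sch (slope l a).
Proof.
move=> l0 Ha; apply: schB; last by apply: schMx; exact: sch_derive.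
by apply: schZ; apply: schB => //; exact: sch_scale.
Qed.

Lemma derive1n_slope q l a x : l != 0 -> sch a -> derive1n q (slope l a) x =
  (l - 1)^-1 * (dil q a x l - dil q a x 1) - derive1n q (fun y => y * derive1 a y) x.
Proof.
move=> l0 Ha; have Hl := sch_scale l0 Ha; have Hc := schMx (sch_derive Ha).
rewrite derive1nB //; last by apply: schZ; exact: schB.
rewrite derive1nZ; last exact: schB.
by rewrite derive1nB // derive1n_scale // /dil expr1n !mul1r.
Qed.

(** The mean value theorem, used twice in the dilation parameter, bounds the
    error by |l - 1| times a second derivative at a point of [1/2, 3/2], and
    this is controlled by seminorms of x a' and x (x a')'. *)
Lemma slope_norms_le N a : sch a -> exists2 K, 0 < K &
  forall l, l != 1 -> `|l - 1| < 2^-1 -> norms_le N (K * `|l - 1|) (slope l a).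
Proof.
move=> Ha; pose E b y : R := y * derive1 b y.
have HE b : sch b -> sch (E b) by move=> Hb; exact: schMx (sch_derive Hb).
have [M1 M10 H1] := sch_norms_le N (HE _ Ha); have [M2 M20 H2] := sch_norms_le N (HE _ (HE _ Ha)).
exists (4 * (4 ^+ N * M2 + 4 ^+ N * M1)).
  by rewrite mulr_gt0 // addr_gt0 // mulr_gt0 // exprn_gt0.
move=> l l1 le p q pN qN x.
have half (t : R) : `|t - 1| < 2^-1 -> 2^-1 < t.
  by rewrite ltr_distl => /andP[+ _]; lra.
have t0 (t : R) : `|t - 1| < 2^-1 -> t != 0 by move=> /half tt; rewrite gt_eqF //; lra.
rewrite derive1n_slope ?t0 // -/(E a).
have [c cl ->] := @MVT_near1 (dil q a x) (fun t => t^-1 * dil q (E a) x t) 2^-1 l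
  (fun t tt => der_dil q x Ha (t0 t tt)) le.
rewrite [_^-1 * _]mulrC mulfK; last by rewrite subr_eq0.
have cle := le_lt_trans cl le.
have D (t : R) : `|t - 1| < 2^-1 -> is_derive t 1 (fun t => t^-1 * dil q (E a) x t)
    (t^-1 ^+ 2 * (dil q (E (E a)) x t - dil q (E a) x t)).
  move=> tt; have tn := t0 t tt.
  have D := derM (is_deriveV tn (der_id t)) (der_dil q x (HE _ Ha) tn).
  apply: is_derive_eq D _; rewrite -/(E (E a)) /GRing.scale /= mulr1.
  by move: (dil _ _ _ _) (dil _ (E (E a)) _ _) => u v; field.
have -> : derive1n q (E a) x = 1^-1 * dil q (E a) x 1 by rewrite /dil expr1n invr1 !mul1r.
have [e el ->] := @MVT_near1 _ _ 2^-1 c D cle.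
have ele := le_lt_trans el cle.
rewrite normrM mulrA; apply: ler_pM => //; rewrite ?mulr_ge0 ?exprn_ge0 //.
rewrite normrM mulrCA.
apply: ler_pM => //; rewrite ?mulr_ge0 ?exprn_ge0 //.
  rewrite normrX (_ : 4 = 2 ^+ 2); last by ring.
  rewrite lerXn2r ?nnegrE // normfV gtr0_norm; last by have := half e ele; lra.
  by rewrite -[leRHS]invrK lef_pV2 ?posrE ?invr_gt0 //; have := half e ele; lra.
apply: (@le_trans _ _ (`|x| ^+ p * (`|dil q (E (E a)) x e| + `|dil q (E a) x e|))).
  by rewrite ler_wpM2l ?exprn_ge0 // ler_normB.
by rewrite mulrDr; apply: lerD; apply: dil_bound => //; exact: ltW.
Qed.

End DilationDerivative.

(** * Homogeneity of limits and the Euler equation *)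

Section HomogeneousDistributions.
Context {R : realType}.
Implicit Types (phi : R -> R[i]) (g : @functional R) (a b rho : R -> R) (x s : R).

Lemma ccvgZ (k : R -> R) (k0 : R) (u : R -> R[i]) (l : R[i]) (F : set_system R) {FF : Filter F} :
  k @ F --> k0 -> ccvg F u l -> ccvg F (fun t => (k t)%:C * u t) (k0%:C * l).
Proof.
move=> Hk [Hr Hi]; split; rewrite ?reMR ?imMR; under eq_fun do rewrite ?reMR ?imMR; exact: cvgM.
Qed.

Lemma ccvg_unique (F : set_system R) {FF : ProperFilter F} (u : R -> R[i]) l l' :
  ccvg F u l -> ccvg F u l' -> l = l'.
Proof.
by move=> [a1 a2] [b1 b2]; apply: cext; [exact: cvg_unique a1 b1|exact: cvg_unique a2 b2].
Qed.

Lemma ccvg_near (F : set_system R) {FF : Filter F} (u v : R -> R[i]) l :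
  (\forall t \near F, u t = v t) -> ccvg F u l -> ccvg F v l.
Proof.
move=> E [a1 a2]; split; [move: a1|move: a2]; apply: cvg_trans;
  by apply: near_eq_cvg; apply: filterS E => t ->.
Qed.

Lemma cvg_comp_mulr (T : topologicalType) (u : R -> T) (l : T) (r : R) :
  0 < r -> u @ +oo%R --> l -> (fun t => u (t * r)) @ +oo%R --> l.
Proof.
move=> r0 Hu; apply: (@cvg_comp _ _ _ (fun t => t * r) u _ +oo%R) Hu.
by apply: gt0_cvgMly.
Qed.

(** v is u seen at the scale t r, so that the two limits differ by the limit
    of rho(t r) / rho(t). *)
Lemma homogeneous_limit rho (beta r : R) (u v : R -> R[i]) (l m : R[i]) :
  automodel beta rho -> 0 < r ->
  (forall t, 0 < t -> v t = u (t * r)) ->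
  ccvg +oo%R (fun t => ((rho t)^-1)%:C * u t) l ->
  ccvg +oo%R (fun t => ((rho t)^-1)%:C * v t) m ->
  m = (r `^ beta)%:C * l.
Proof.
move=> [p0 _ Hrho] r0 E Hu Hv.
have Hur : ccvg +oo%R (fun t => ((rho (t * r))^-1)%:C * u (t * r)) l.
  by case: Hu => a1 a2; split; [exact: (cvg_comp_mulr r0 a1)|exact: (cvg_comp_mulr r0 a2)].
apply: (ccvg_unique Hv); apply: ccvg_near (ccvgZ (Hrho r r0) Hur).
near=> t.
have t0 : 0 < t by near: t; exact: nbhs_pinfty_gt.
rewrite E // mulrA -rmorphM /=.
congr (_%:C * _); field.
by rewrite !gt_eqF // p0 // mulr_gt0.
Unshelve. all: by end_near. Qed.

Definition homogeneous g (deg : R) := forall s phi, 0 < s -> schwartz phi ->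
  dilate g s phi = (s `^ deg)%:C * g phi.

Lemma dilate_dilate g (s t : R) phi : 0 < s -> 0 < t ->
  dilate (dilate g t) s phi = dilate g (t * s) phi.
Proof.
move=> s0 t0; rewrite /dilate mulrA -rmorphM /= -invfM (mulrC s); congr (_ * _).
congr g; by apply/funext => x; rewrite invfM mulrA.
Qed.

Lemma homogeneous_infty f deg g : quasi_asymp_infty f deg g -> homogeneous g deg.
Proof.
move=> [_ _ _ [rho Hrho H]] s phi s0 Hphi.
have Hs : schwartz (fun x => phi (x / s)).
  by apply: schwartz_scale => //; rewrite invr_neq0 // gt_eqF.
have si : (s^-1)%:C * s%:C = 1 :> R[i] by rewrite -rmorphM /= mulVf ?gt_eqF.
have K : (fun _ : R => s^-1) @ +oo%R --> s^-1 by apply: cvg_cst.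
apply: (homogeneous_limit Hrho s0 _ (H _ Hphi)
  (v := fun t => (s^-1)%:C * dilate f t (fun x => phi (x / s)))).
  by move=> t t0; rewrite -[LHS]/(dilate (dilate f t) s phi) dilate_dilate.
by apply: ccvg_near (ccvgZ K (H _ Hs)); near=> t; rewrite mulrCA.
Unshelve. all: by end_near. Qed.

Lemma homogeneous_zero f deg g : quasi_asymp_zero f deg g -> homogeneous g deg.
Proof.
move=> [_ _ _ [rho Hrho H]] s phi s0 Hphi.
have Hs : schwartz (fun x => phi (x / s)).
  by apply: schwartz_scale => //; rewrite invr_neq0 // gt_eqF.
have K : (fun _ : R => s^-1) @ +oo%R --> s^-1 by apply: cvg_cst.
have -> : s `^ deg = s^-1 `^ (- deg).
  by rewrite -[in RHS](powR_inv1 (ltW s0)) -powRrM mulN1r opprK.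
apply: (homogeneous_limit Hrho _ _ (H _ Hphi)
  (v := fun t => (s^-1)%:C * dilate f t^-1 (fun x => phi (x / s)))).
- by rewrite invr_gt0.
- move=> t t0; rewrite -[LHS]/(dilate (dilate f t^-1) s phi) dilate_dilate ?invr_gt0 //.
  by rewrite invfM invrK.
- by apply: ccvg_near (ccvgZ K (H _ Hs)); near=> t; rewrite mulrCA.
Unshelve. all: by end_near. Qed.

Lemma normc_eq0_small (z : R[i]) : (forall eps : R, 0 < eps -> normc z < eps) -> z = 0.
Proof.
move=> H; apply: ComplexField.Normc.eq0_normc; apply/eqP/negPn/negP => z0.
have n0 : 0 <= normc z by apply: le_trans (normc_re z).
by have := H (normc z); rewrite ltxx lt0r z0 n0 => /(_ isT).
Qed.

Lemma temperedD g phi psi : tempered g -> schwartz phi -> schwartz psi ->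
  g (fun x => phi x + psi x) = g phi + g psi.
Proof.
move=> [Lg _] H1 H2; have := Lg 1 _ _ H1 H2; rewrite mul1r => <-.
by congr g; apply/funext => x; rewrite mul1r.
Qed.

Lemma temperedM g (z : R[i]) phi : tempered g -> schwartz phi ->
  g (fun x => z * phi x) = z * g phi.
Proof.
move=> Tg H; have [Lg _] := Tg; have := Lg z _ _ H schwartz0; rewrite tempered0 // addr0 => <-.
by congr g; apply/funext => x; rewrite addr0.
Qed.

Lemma temperedB g phi psi : tempered g -> schwartz phi -> schwartz psi ->
  g (fun x => phi x - psi x) = g phi - g psi.
Proof.
move=> Tg H1 H2; have := temperedD Tg H1 (schwartzZ (-1) H2).
rewrite temperedM // mulN1r => <-.
by congr g; apply/funext => x; rewrite mulN1r.
Qed.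

(** [euler (deg + 1)] is minus the transpose of x d/dx - deg, which kills
    homogeneous distributions of degree deg. *)
Definition euler (c : R) a x := x * derive1 a x + c * a x.

Lemma powR_slope (c : R) : forall eps : R, 0 < eps -> exists2 eta : R, 0 < eta &
  forall l, l != 1 -> `|l - 1| < eta -> `|(l `^ c - 1) / (l - 1) - c| < eps.
Proof.
move=> eps e0.
have C : {for 1, continuous (fun t : R => c * t `^ (c - 1))}.
  have /der_continuous := derZ c (der_powR (c - 1) (@ltr01 R)); exact.
move/cvgrPdist_lt : C => /(_ _ e0); rewrite powR1 mulr1 near_nbhs.
move=> /nbhs_ballP[eta /= eta0 H].
exists (Num.min eta 1); first by rewrite lt_min eta0 ltr01.
move=> l l1; rewrite lt_min => /andP[le l1'].
have D (t : R) : `|t - 1| < 1 -> is_derive t 1 (fun t : R => t `^ c) (c * t `^ (c - 1)).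
  by rewrite ltr_distl => /andP[+ _]; rewrite subrr; exact: der_powR.
have [e el] := @MVT_near1 R _ _ 1 l D l1'; rewrite powR1 => ->.
rewrite mulfK ?subr_eq0 // distrC; apply: H.
by rewrite /ball /= distrC; exact: le_lt_trans el le.
Qed.

(** Homogeneity says g(phi(l x)) = l^(-deg-1) g(phi). Differentiate at l = 1:
    by [slope_norms_le] the difference quotients of the dilations converge in
    the Schwartz topology. *)
Lemma euler_equation g deg phi : tempered g -> homogeneous g deg -> schwartz phi ->
  g (cpl (euler (deg + 1) (re \o phi)) (euler (deg + 1) (im \o phi))) = 0.
Proof.
move=> Tg Hg Hphi; have /schwartzP[Ha Hb] := Hphi.
pose X := cpl (fun x => x * derive1 (re \o phi) x) (fun x => x * derive1 (im \o phi) x).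
have HX : schwartz X by apply/schwartz_cpl; split; apply: schMx; exact: sch_derive.
have -> : cpl (euler (deg + 1) (re \o phi)) (euler (deg + 1) (im \o phi)) =
    (fun x => (deg + 1)%:C * phi x + X x).
  by apply/funext => x; apply: cext; rewrite !reimE /euler /= addrC.
rewrite temperedD ?temperedM //; last exact: schwartzZ.
apply: normc_eq0_small => eps e0.
have e2 : 0 < eps / 2 by rewrite divr_gt0.
have n0 : 0 <= normc (g phi) by apply: le_trans (normc_re _).
have [N [d [d0 Hd]]] := tempered_small Tg e2.
have [K1 K10 H1] := slope_norms_le N Ha; have [K2 K20 H2] := slope_norms_le N Hb.
have [eta eta0 Heta] := @powR_slope (- (deg + 1)) _ (divr_gt0 e2 (ltr_wpDl n0 ltr01)).
pose h := Num.min (4^-1) (Num.min (eta / 2) (d / (K1 + K2))).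
have h0 : 0 < h by rewrite !lt_min !divr_gt0 ?addr_gt0 // invr_gt0 ltr0n.
have [h1 h2 h3] : [/\ h <= 4^-1, h <= eta / 2 & h <= d / (K1 + K2)].
  by rewrite !ge_min !lexx ?orbT.
pose l := 1 + h.
have lh : l - 1 = h by rewrite /l addrAC subrr add0r.
have nlh : `|l - 1| = h by rewrite lh gtr0_norm.
have l0 : 0 < l by rewrite addr_gt0.
have lN : l != 0 by rewrite gt_eqF.
have l1 : l != 1 by rewrite -subr_eq0 lh gt_eqF.
(* The error of the difference quotient, small in the Schwartz topology. *)
pose S := cpl (slope l (re \o phi)) (slope l (im \o phi)).
have HS : schwartz S by apply/schwartz_cpl; split; exact: sch_slope.
have GS : normc (g S) < eps / 2.
  apply: Hd => // p q pN qN x.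
  have lh2 : `|l - 1| < 2^-1 by rewrite nlh; apply: le_lt_trans h1 _; lra.
  apply: (le_trans (cnorms_le_cpl (H1 l l1 lh2) (H2 l l1 lh2) pN qN x)).
  by rewrite -mulrDl nlh mulrC -ler_pdivlMr // addr_gt0.
have SD : schwartz (fun x => phi (x * l)) by exact: schwartz_scale.
have E1 : g (fun x => phi (x * l)) = (l `^ (- (deg + 1)))%:C * g phi.
  have li : 0 < l^-1 by rewrite invr_gt0.
  have := Hg l^-1 phi li Hphi; rewrite /dilate invrK => /(congr1 (fun z => (l^-1)%:C * z)).
  rewrite mulrA -rmorphM /= mulVf // mul1r mulrA -rmorphM /= => ->; congr (_%:C * _).
  rewrite -(powR_inv1 (ltW l0)) -powRrM -powRD; last by rewrite lN implybT.
  by congr (_ `^ _); ring.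
have ES : g S = (((l `^ (- (deg + 1)) - 1) / (l - 1)))%:C * g phi - g X.
  have -> : S = (fun x => ((l - 1)^-1)%:C * (phi (x * l) - phi x) - X x).
    by apply/funext => x; apply: cext; rewrite !reimE /slope /= (mulrC x l).
  rewrite temperedB //; last by apply: schwartzZ; exact: schwartzB.
  rewrite temperedM //; last exact: schwartzB.
  rewrite temperedB // E1; congr (_ - _).
  by rewrite rmorphM rmorphB /=; ring.
have -> : (deg + 1)%:C * g phi + g X =
    ((l `^ (- (deg + 1)) - 1) / (l - 1) - - (deg + 1))%:C * g phi - g S.
  by rewrite ES rmorphB rmorphN; ring.
apply: le_lt_trans (le_normcD _ _) _.
rewrite (_ : normc (- g S) = normc (g S)); last first.
  by case: (g S) => u v /=; rewrite !sqrrN.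
rewrite [ltRHS](_ : eps = eps / 2 + eps / 2); last by lra.
apply: ltr_leD (ltW GS); rewrite ComplexField.Normc.normcM.
rewrite (_ : normc (_%:C) = `|(l `^ (- (deg + 1)) - 1) / (l - 1) - - (deg + 1)|); last first.
  by rewrite /= expr0n addr0 sqrtr_sqr.
have K : `|l - 1| < eta by rewrite nlh; apply: le_lt_trans h2 _; lra.
have := Heta l l1 K; rewrite ltr_pdivlMr; last by lra.
apply: le_lt_trans; rewrite ler_wpM2l //; lra.
Qed.

End HomogeneousDistributions.

(** * Homogeneous distributions of degree greater than -1 *)

Section HomogeneousComplex.
Context {R : realType}.
Implicit Types (phi psi : R -> R[i]) (a b : R -> R) (alpha x : R) (z C : R[i]).

Lemma re_sum (m : nat) (F : 'I_m -> R[i]) : re (\sum_(j < m) F j) = \sum_(j < m) re (F j).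
Proof. exact: (big_morph _ reD erefl). Qed.

Lemma im_sum (m : nat) (F : 'I_m -> R[i]) : im (\sum_(j < m) F j) = \sum_(j < m) im (F j).
Proof. exact: (big_morph _ imD erefl). Qed.

Lemma divC z (c : R) : z / c%:C = c^-1%:C * z.
Proof. by rewrite mulrC -fmorphV. Qed.

Lemma x_plusE alpha phi :
  x_plus alpha phi = rplus alpha (re \o phi) +i* rplus alpha (im \o phi).
Proof.
have D z (c : R) : (re (z / c%:C) = re z / c) * (im (z / c%:C) = im z / c).
  by rewrite divC reMR imMR !(mulrC c^-1).
rewrite /x_plus /rplus /rplusm; apply: cext; rewrite ?reD ?imD ?re_sum ?im_sum /cintegral.
  rewrite [re (_ +i* _)]/= [re (_ +i* _)]/=.
  congr (_ + _ + _).
  - apply: eq_Rintegral => x _; rewrite reMR reD reN re_sum /trem /taylor.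
    by congr (_ * (_ - _)); apply: eq_bigr => j _; rewrite reMR.
  - by apply: eq_Rintegral => x _; rewrite reMR.
  - by apply: eq_bigr => j _; rewrite D.
rewrite [im (_ +i* _)]/= [im (_ +i* _)]/=.
congr (_ + _ + _).
- apply: eq_Rintegral => x _; rewrite imMR imD imN im_sum /trem /taylor.
  by congr (_ * (_ - _)); apply: eq_bigr => j _; rewrite imMR.
- by apply: eq_Rintegral => x _; rewrite imMR.
- by apply: eq_bigr => j _; rewrite D.
Qed.

Lemma rplusD alpha a b : sch a -> sch b ->
  rplus alpha (fun x => a x + b x) = rplus alpha a + rplus alpha b.
Proof.
move=> Ha Hb; rewrite /rplus /rplusm.
set m := Num.truncn (- alpha); have am : -1 < alpha + m%:R by exact: truncn_gtN1.
have i1 := intg_trem am (leqnn m) Ha; have i2 := intg_tail alpha Ha.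
have j1 := intg_trem am (leqnn m) Hb; have j2 := intg_tail alpha Hb.
have H (u v w s t r : R) : (u + v + w) + (s + t + r) = (u + s) + (v + t) + (w + r) by ring.
rewrite H -!RintegralD // -big_split /=; congr (_ + _ + _).
- apply: eq_Rintegral => x _; rewrite -mulrDr; congr (_ * _).
  rewrite /trem addrACA -opprD; congr (_ - _).
  by rewrite /taylor -big_split; apply: eq_bigr => j _; rewrite derive1nD // mulrDr.
- by apply: eq_Rintegral => x _; rewrite mulrDr.
- by apply: eq_bigr => j _; rewrite derive1nD // mulrDl.
Qed.

Lemma rplusB alpha a b : sch a -> sch b ->
  rplus alpha (fun x => a x - b x) = rplus alpha a - rplus alpha b.
Proof. by move=> Ha Hb; rewrite rplusD ?rplusN //; exact: schN. Qed.

(** The two real formulas of [Fourier_rule] for the real and imaginary parts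
    of phi, assembled with exp(i theta) = cos theta + i sin theta. *)
Lemma x_plus_fourier alpha phi : nonint alpha -> schwartz phi ->
  x_plus alpha (fourier phi) = (Gamma (alpha + 1))%:C *
    (cexpi ((alpha + 1) * pi / 2) * x_plus (- alpha - 1) phi +
     cexpi (- ((alpha + 1) * pi / 2)) * x_minus (- alpha - 1) phi).
Proof.
move=> na H; rewrite fourierE // /x_minus !x_plusE.
move/schwartzP: H => [Ha Hb].
rewrite [re \o fun x => phi (- x)](_ : _ = fun x => (re \o phi) (- x)) //.
rewrite [im \o fun x => phi (- x)](_ : _ = fun x => (im \o phi) (- x)) //.
move: (re \o phi) (im \o phi) Ha Hb => a b Ha Hb.
rewrite [re \o cpl _ _](_ : _ = fun xi => Fcos a xi - Fsin b xi) //.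
rewrite [im \o cpl _ _](_ : _ = fun xi => Fsin a xi + Fcos b xi) //.
rewrite rplusB ?rplusD; [|exact: sch_Fsin|exact: sch_Fcos|exact: sch_Fcos|exact: sch_Fsin].
have [-> ->] := Fourier_rule_nonint na Ha; have [-> ->] := Fourier_rule_nonint na Hb.
have ev c : sch c -> rplus (- alpha - 1) (even2 c) =
    rplus (- alpha - 1) c + rplus (- alpha - 1) (fun x => c (- x)).
  by move=> Hc; rewrite -rplusD //; exact: sch_opp.
have od c : sch c -> rplus (- alpha - 1) (odd2 c) =
    rplus (- alpha - 1) c - rplus (- alpha - 1) (fun x => c (- x)).
  by move=> Hc; rewrite -rplusB //; exact: sch_opp.
rewrite !ev // !od // /cexpi cosN sinN.
move: (rplus _ a) (rplus _ (fun x => a (- x))) (rplus _ b) (rplus _ (fun x => b (- x))).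
move: (cos _) (sin _) (Gamma _) => c s G P P' Q Q'.
by apply: cext; rewrite !reimE /=; ring.
Qed.

Lemma fourier_oppE phi : schwartz phi ->
  (fun x => fourier phi (- x)) = fourier (fun x => phi (- x)).
Proof. by move=> H; apply/funext => x; rewrite fourier_opp. Qed.

Lemma x_minus_fourier alpha phi : nonint alpha -> schwartz phi ->
  x_minus alpha (fourier phi) = (Gamma (alpha + 1))%:C *
    (cexpi (- ((alpha + 1) * pi / 2)) * x_plus (- alpha - 1) phi +
     cexpi ((alpha + 1) * pi / 2) * x_minus (- alpha - 1) phi).
Proof.
move=> na H; rewrite /x_minus fourier_oppE // x_plus_fourier //; last exact: schwartz_opp.
have -> : x_minus (- alpha - 1) (fun x => phi (- x)) = x_plus (- alpha - 1) phi.
  by rewrite /x_minus; under eq_fun do rewrite opprK.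
by congr (_ * _); exact: addrC.
Qed.

Lemma homogeneous_fourier alpha phi C1 C2 : nonint alpha -> schwartz phi ->
  C1 * x_plus alpha (fourier phi) + C2 * x_minus alpha (fourier phi) =
  (Gamma (alpha + 1))%:C *
    (B1 alpha C1 C2 * x_plus (- alpha - 1) phi + B2 alpha C1 C2 * x_minus (- alpha - 1) phi).
Proof.
move=> na H; rewrite x_plus_fourier // x_minus_fourier // /B1 /B2.
move: (x_plus _ _) (x_minus _ _) (cexpi _) (cexpi _) (_%:C) => p m e e' G; ring.
Qed.

Lemma x_plus_mellin alpha phi : -1 < alpha -> schwartz phi ->
  x_plus alpha phi = mellin alpha (re \o phi) +i* mellin alpha (im \o phi).
Proof. by move=> h /schwartzP[Ha Hb]; rewrite x_plusE !rplusE. Qed.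

Lemma euler_surjective gam phi : -1 < gam -> schwartz phi ->
  x_plus gam phi = 0 -> x_minus gam phi = 0 ->
  exists2 psi, schwartz psi & phi = cpl (euler (gam + 1) (re \o psi)) (euler (gam + 1) (im \o psi)).
Proof.
move=> h H; have HN := schwartz_opp H; rewrite /x_minus !x_plus_mellin //.
move=> [Mra Mia] [Mrb Mib]; move/schwartzP: H => [Ha Hb].
have [a' Ha' Ea] := euler_solvable h Ha Mra Mrb.
have [b' Hb' Eb] := euler_solvable h Hb Mia Mib.
exists (cpl a' b'); first exact/schwartz_cpl.
rewrite [LHS]cplE; congr cpl; apply/funext => x; rewrite /euler.
  by rewrite -Ea.
by rewrite -Eb.
Qed.

Lemma x_plus_linear gam z phi psi : schwartz phi -> schwartz psi ->
  x_plus gam (fun x => z * phi x + psi x) = z * x_plus gam phi + x_plus gam psi.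
Proof.
move=> /schwartzP[Ha Hb] /schwartzP[Hc Hd]; rewrite !x_plusE.
have -> : re \o (fun x => z * phi x + psi x) =
    (fun x => (re z * (re \o phi) x - im z * (im \o phi) x) + (re \o psi) x).
  by apply/funext => x /=; rewrite !reimE.
have -> : im \o (fun x => z * phi x + psi x) =
    (fun x => (re z * (im \o phi) x + im z * (re \o phi) x) + (im \o psi) x).
  by apply/funext => x /=; rewrite !reimE.
move: Ha Hb Hc Hd; move: (re \o phi) (im \o phi) (re \o psi) (im \o psi) => a b c d Ha Hb Hc Hd.
have [h1 h2] := (schZ (re z) Ha, schZ (im z) Hb).
have [h3 h4] := (schZ (re z) Hb, schZ (im z) Ha).
rewrite (rplusD _ (schB h1 h2) Hc) (rplusB _ h1 h2) (rplusD _ (schD h3 h4) Hd) (rplusD _ h3 h4).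
by rewrite !rplusZ //; apply: cext; rewrite !reimE.
Qed.

Lemma x_minus_linear gam z phi psi : schwartz phi -> schwartz psi ->
  x_minus gam (fun x => z * phi x + psi x) = z * x_minus gam phi + x_minus gam psi.
Proof. by move=> H1 H2; apply: x_plus_linear; exact: schwartz_opp. Qed.

(** The Gaussian is even and its product with x is odd, so that x_+ and x_-
    take on them equal and opposite values respectively. *)
Lemma dual_basis gam : -1 < gam -> exists G K : R -> R[i], exists m0 m1 : R[i],
  [/\ schwartz G /\ schwartz K, m0 != 0, m1 != 0,
    x_plus gam G = m0 /\ x_minus gam G = m0 & x_plus gam K = m1 /\ x_minus gam K = - m1].
Proof.
move=> h; pose G := cpl (@gauss R) (fun=> 0); pose K := cpl (fun x => x * gauss x) (fun=> 0).
have SG : schwartz G by apply/schwartz_cpl; split; [exact: sch_gauss|exact: sch0].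
have SK : schwartz K by apply/schwartz_cpl; split; [apply: schMx; exact: sch_gauss|exact: sch0].
have h1 : -1 < gam + 1 by lra.
have M0 s : mellin s (fun=> 0 : R) = 0.
  by rewrite /mellin /Rintegral integral0_eq // => x _; rewrite mulr0.
have gN x : gauss (- x) = gauss x :> R by rewrite /gauss sqrrN.
have pos s : -1 < s -> (mellin s (@gauss R))%:C != 0.
  move=> hs; rewrite fmorph_eq0 gt_eqF //; have Hgs := @sch_gauss R.
  by apply: mellin_gt0 => //; [exact: sch_hcont|exact: sch_hdecay|move=> x _; exact: gauss_gt0].
exists G, K, (mellin gam (@gauss R))%:C, (mellin (gam + 1) (@gauss R))%:C.
have pG : x_plus gam G = (mellin gam (@gauss R))%:C.
  by rewrite x_plus_mellin //; congr (_ +i* _); exact: M0.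
have pK : x_plus gam K = (mellin (gam + 1) (@gauss R))%:C.
  by rewrite x_plus_mellin //; congr (_ +i* _); [exact: (mellinMx gam)|exact: M0].
split; [exact: (conj SG SK)|exact: pos|exact: pos|split; [exact: pG|]|split; [exact: pK|]].
  by rewrite -pG /x_minus; congr x_plus; apply/funext => x; rewrite /G /cpl gN.
rewrite -pK /x_minus -[RHS]mulN1r; have := x_plus_linear gam (-1) SK schwartz0.
have p0 : x_plus gam (fun=> 0 : R[i]) = 0.
  by rewrite x_plus_mellin //; [congr (_ +i* _); exact: M0|exact: schwartz0].
rewrite p0 addr0 => <-; congr x_plus; apply/funext => x.
by apply: cext; rewrite !reimE /= ?gN; ring.
Qed.

(** Subtract from phi the combination of the dual basis on which x_+ and x_-
    take the same values. The difference is in the image of the Euler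
    operator, which g kills. *)
Theorem classification gam (g : @functional R) : -1 < gam -> tempered g -> homogeneous g gam ->
  exists C1 C2, eqD g (fun phi => C1 * x_plus gam phi + C2 * x_minus gam phi).
Proof.
move=> h Tg Hg; have [G [K [m0 [m1 [[SG SK] e0 e1 [pG nG] [pK nK]]]]]] := dual_basis h.
exists (g G / (2 * m0) + g K / (2 * m1)), (g G / (2 * m0) - g K / (2 * m1)).
move=> phi H; pose p := x_plus gam phi; pose m := x_minus gam phi.
pose psi x := - ((p + m) / (2 * m0)) * G x + (- ((p - m) / (2 * m1)) * K x + phi x).
have S1 : schwartz (fun x => - ((p - m) / (2 * m1)) * K x + phi x).
  by apply: schwartzD => //; exact: schwartzZ.
have Spsi : schwartz psi by apply: schwartzD => //; exact: schwartzZ.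
have p0 : x_plus gam psi = 0.
  rewrite !x_plus_linear // pG pK -/p; clear -e0 e1; field.
  by rewrite e0 e1.
have n0 : x_minus gam psi = 0.
  rewrite !x_minus_linear // nG nK -/m; clear -e0 e1; field.
  by rewrite e0 e1.
have [chi Hchi E] := euler_surjective h Spsi p0 n0.
have g0 : g psi = 0 by rewrite E; exact: euler_equation.
have [Lg _] := Tg; move: g0; rewrite /psi !Lg // -/p -/m.
clear -e0 e1; move: (g G) (g K) (g phi) p m => gG gK gf p m E.
have -> : gf = (p + m) / (2 * m0) * gG + (p - m) / (2 * m1) * gK.
  by apply/eqP; rewrite -subr_eq0 -[X in _ == X]E; apply/eqP; ring.
by field; rewrite e0 e1.
Qed.

End HomogeneousComplex.

(** * Limits at the integers *)

Section PuncturedLimits.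
Context {R : realType}.
Implicit Types (u v : R -> R[i]) (l m z : R[i]) (alpha beta x : R) (F : set_system R).

(** Integers are isolated. *)
Lemma near_nonint alpha : alpha \is a Num.int -> \forall beta \near alpha^', nonint beta.
Proof.
move=> /intrP[p ->]; apply/nbhs_ballP; exists 1 => //= beta.
rewrite /ball /= => lt ne; apply/negP => /intrP[q E]; move: lt ne; rewrite {}E.
rewrite -intrB -intr_norm -[X in _ < X]/(1%:~R) ltr_int => pq.
by rewrite eqr_int; apply/negP; lia.
Qed.

Lemma clim_ccvg F {FF : ProperFilter F} u l : ccvg F u l -> clim F u = l.
Proof.
by move=> [h1 h2]; apply: cext; rewrite /clim /=; apply: cvg_lim => //; exact: norm_hausdorff.
Qed.

Lemma ccvg_cst F (FF : Filter F) z : ccvg F (fun=> z) z.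
Proof. by split; exact: cvg_cst. Qed.

Lemma ccvgD F {FF : Filter F} u v l m : ccvg F u l -> ccvg F v m ->
  ccvg F (fun t => u t + v t) (l + m).
Proof.
move=> [h1 h2] [k1 k2]; split; rewrite ?reD ?imD; under eq_fun do rewrite ?reD ?imD; exact: cvgD.
Qed.

Lemma ccvgM F {FF : Filter F} u v l m : ccvg F u l -> ccvg F v m ->
  ccvg F (fun t => u t * v t) (l * m).
Proof.
move=> [h1 h2] [k1 k2]; split; rewrite ?reM ?imM; under eq_fun do rewrite ?reM ?imM.
  by apply: cvgB; exact: cvgM.
by apply: cvgD; exact: cvgM.
Qed.

Lemma ccvg_real F {FF : Filter F} (k : R -> R) (k0 : R) :
  k @ F --> k0 -> ccvg F (fun t => (k t)%:C) k0%:C.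
Proof. by move=> h; split => //=; exact: cvg_cst. Qed.

Lemma cvg_dnbhs (f : R -> R) x : {for x, continuous f} -> f @ x^' --> f x.
Proof. by apply: cvg_trans; apply: cvg_app; exact: cvg_within. Qed.

Lemma x_plus_ccvg alpha phi : -1 < alpha -> schwartz phi ->
  ccvg alpha^' (fun beta => x_plus beta phi) (x_plus alpha phi).
Proof.
move=> h H; have /schwartzP[Ha Hb] := H.
have K a : sch a -> (fun beta => rplus beta a) @ alpha^' --> rplus alpha a.
  move=> Hs; rewrite rplusE //.
  have C := mellin_continuous h (sch_hcont Hs) (sch_hdecay Hs).
  apply: (@cvg_trans _ ((fun beta => mellin beta a) @ alpha^')); last first.
    by apply: cvg_trans C; apply: cvg_app; exact: cvg_within.
  apply: near_eq_cvg; apply: cvg_within; near=> beta.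
  rewrite rplusE //; near: beta; exact: lt_nbhsr.
split; under eq_fun do rewrite x_plusE /=; rewrite x_plusE /=; exact: K.
Unshelve. all: by end_near. Qed.

Lemma continuous_prod (n : nat) (f : nat -> R -> R) x :
  (forall j, {for x, continuous (f j)}) -> {for x, continuous (fun y => \prod_(j < n) f j y)}.
Proof.
move=> cf; elim: n => [|n IH].
  have -> : (fun y => \prod_(j < 0) f j y) = fun=> 1 by apply/funext => y; rewrite big_ord0.
  exact: cvg_cst.
have -> : (fun y => \prod_(j < n.+1) f j y) = (fun y => (\prod_(j < n) f j y) * f n y).
  by apply/funext => y; rewrite big_ord_recr.
by apply: cvgM; [exact: IH|exact: cf].
Qed.

Lemma prod_nat_sub (n : nat) : \prod_(j < n) (j%:R - n%:R) = (-1) ^+ n * n`!%:R :> R.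
Proof.
elim: n => [|n IH]; first by rewrite big_ord0 expr0 mul1r.
rewrite big_ord_recl sub0r (eq_bigr (fun j : 'I_n => j%:R - n%:R)); last first.
  by move=> j _; rewrite /= /bump /= add1n -!natr1; ring.
by rewrite IH factS natrM exprS; ring.
Qed.

Lemma Gamma_prod (n : nat) (s : R) : nonint s -> Gamma (s + n%:R) = Gamma s * \prod_(j < n) (s + j%:R).
Proof.
move=> ns; elim: n => [|n IH]; first by rewrite big_ord0 mulr1 addr0.
have nn : nonint (s + n%:R) by have := nonintD n ns; rewrite -pmulrn.
by have := GammaS nn; rewrite IH -addrA natr1 => ->; rewrite big_ord_recr /= mulrC -mulrA.
Qed.

Lemma sin_slope (c x : R) : (fun t => sin ((t - x) * c) / (t - x)) @ x^' --> c.
Proof.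
have Da : is_derive x 1 (fun t => (t - x) * c) c.
  by apply: (der_congr (der_aff c (- x * c) x)) => // t; rewrite mulrBl mulrC mulNr.
have D := @dercomp _ sin (fun t => (t - x) * c) x _ _ (is_derive_sin _) Da.
rewrite subrr mul0r cos0 mul1r in D.
have /cvg_ex[l Hl] : derivable (fun t => sin ((t - x) * c)) x 1 by case: D.
have El : l = c.
  rewrite -(derE D) derive1E /derive; apply/esym/cvg_lim => //; exact: norm_hausdorff.
rewrite El in Hl.
apply/cvgrPdist_lt => e e0; move/cvgrPdist_lt: Hl => /(_ e e0).
move=> /nbhs_ballP[d /= d0 H]; apply/nbhs_ballP; exists d => //= t tx ne.
have tx0 : t - x != 0 by rewrite subr_eq0.
have := H (t - x); rewrite /ball /= sub0r normrN => /(_ _ tx0); rewrite -[`|t - x|]distrC => /(_ tx).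
rewrite /GRing.scale /= mulr1 subrr mul0r sin0 subr0 addrK mulrC; apply.
Qed.

Lemma cexpiD x y : cexpi (x + y) = cexpi x * cexpi y.
Proof. by rewrite /cexpi cosD sinD; apply: cext; rewrite !reimE /= addrC. Qed.

Lemma cexpi_halfpi (n : nat) : cexpi (n%:R * (pi / 2)) = 'i ^+ n :> R[i].
Proof.
elim: n => [|n IH]; first by rewrite mul0r /cexpi cos0 sin0.
rewrite -natr1 mulrDl mul1r cexpiD IH exprSr; congr (_ * _).
by rewrite /cexpi cos_pihalf sin_pihalf.
Qed.

Lemma cexpi_opp_halfpi (n : nat) : cexpi (- (n%:R * (pi / 2))) = (- 'i) ^+ n :> R[i].
Proof.
elim: n => [|n IH]; first by rewrite mul0r oppr0 /cexpi cos0 sin0.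
rewrite -natr1 mulrDl mul1r opprD cexpiD IH exprSr; congr (_ * _).
by rewrite /cexpi cosN sinN cos_pihalf sin_pihalf; apply: cext => /=; rewrite ?oppr0.
Qed.

(** The equality theta = (beta + k) pi / 2 + pi / 2 - k pi / 2 for theta =
    (beta + 1) pi / 2 turns exp(i theta) + (-1)^k exp(- i theta) into a sine
    that vanishes at beta = - k. *)
Lemma B1_parity beta (k : nat) : B1 beta 1 ((-1) ^+ k) =
  (- 2 * (- 'i) ^+ k) * (sin ((beta + k%:R) * (pi / 2)))%:C.
Proof.
rewrite /B1 mul1r; pose h := (beta + k%:R) * (pi / 2).
have -> : (beta + 1) * pi / 2 = h + (- (k%:R * (pi / 2)) + 1%:R * (pi / 2)) by rewrite /h; ring.
rewrite -/h !opprD opprK !cexpiD cexpi_halfpi cexpi_halfpi !cexpi_opp_halfpi.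
have -> : (-1) ^+ k * (cexpi (- h) * ('i ^+ k * (- 'i) ^+ 1)) =
    cexpi (- h) * ((- 'i) ^+ k * (- 'i)) :> R[i].
  by rewrite [(- 'i) ^+ k]exprNn expr1; ring.
rewrite /cexpi cosN sinN expr1; move: ((- 'i) ^+ k) (cos h) (sin h) => z c s.
by apply: cext; rewrite !reimE /=; ring.
Qed.

Lemma B2_parity beta (k : nat) : B2 beta 1 ((-1) ^+ k) = (-1) ^+ k * B1 beta 1 ((-1) ^+ k).
Proof.
have ss : (-1) ^+ k * (-1) ^+ k = 1 :> R[i] by rewrite -exprMn mulrNN mulr1 expr1n.
rewrite /B1 /B2 !mul1r; move: (cexpi _) (cexpi _) ss => e e'; move: ((-1) ^+ k) => s ss.
by rewrite mulrDr mulrA ss mul1r addrC.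
Qed.

(** Gamma(beta + 1) has a simple pole at beta = - n - 1, which the simple zero
    of the sine in [B1_parity] cancels. The residue is found from the
    functional equation, which gives Gamma(beta + 1 + n + 1), tending to
    Gamma(1) = 1, divided by a product containing beta + n + 1. *)
Lemma pole_limit (n : nat) : ccvg (- n.+1%:R : R)^'
  (fun beta => (Gamma (beta + 1))%:C * B1 beta 1 ((-1) ^+ n.+1))
  (pi%:C * 'i ^+ n.+1 / n`!%:R).
Proof.
set al : R := - n.+1%:R.
pose q beta := gammaI (beta + 1 + n.+1%:R) / (\prod_(j < n) (beta + 1 + j%:R)) *
  (sin ((beta - al) * (pi / 2)) / (beta - al)).
have a1 : al + 1 = - n%:R by rewrite /al -natr1; ring.
have f0 : (n`!%:R : R) != 0 by rewrite pnatr_eq0 -lt0n fact_gt0.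
have s0 : ((-1) ^+ n : R) != 0 by rewrite expf_neq0 // oppr_eq0 oner_eq0.
have Hq : q @ al^' --> ((-1) ^+ n * n`!%:R)^-1 * (pi / 2).
  apply: cvgM; last exact: sin_slope.
  have P0 : \prod_(j < n) (al + 1 + j%:R) = (-1) ^+ n * n`!%:R.
    by rewrite -prod_nat_sub; apply: eq_bigr => j _; rewrite a1 addrC.
  have G0 : al + 1 + n.+1%:R = 1 by rewrite a1 -natr1; ring.
  have Cs (c : R) : {for al, continuous (fun beta => beta + 1 + c)}.
    by apply: cvgD; [apply: cvgD; [exact: cvg_id|exact: cvg_cst]|exact: cvg_cst].
  have CG : (fun beta => gammaI (beta + 1 + n.+1%:R)) @ al^' --> (1 : R).
    rewrite -[X in _ --> X]gammaI1 -[X in _ --> gammaI X]G0.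
    apply: (@cvg_dnbhs (fun beta => gammaI (beta + 1 + n.+1%:R)) al).
    apply: (@continuous_comp _ _ _ (fun beta => beta + 1 + n.+1%:R) gammaI); first exact: Cs.
    by rewrite G0; exact: gammaI_continuous.
  have CP : (fun beta => \prod_(j < n) (beta + 1 + j%:R)) @ al^' --> ((-1) ^+ n * n`!%:R : R).
    rewrite -P0; apply: (@cvg_dnbhs (fun beta => \prod_(j < n) (beta + 1 + j%:R)) al).
    by apply: (@continuous_prod n (fun j beta => beta + 1 + j%:R) al) => j; exact: Cs.
  rewrite -[X in _ --> X]mul1r; apply: cvgM => //.
  by apply: cvgV => //; rewrite mulf_neq0.
have -> : pi%:C * 'i ^+ n.+1 / n`!%:R =
    (((-1) ^+ n * n`!%:R)^-1 * (pi / 2))%:C * (- 2 * (- 'i) ^+ n.+1) :> R[i].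
  have -> : (- 'i) ^+ n.+1 = - ((-1) ^+ n * 'i ^+ n.+1) :> R[i].
    by rewrite [LHS]exprNn [(-1) ^+ n.+1]exprS mulN1r mulNr.
  rewrite !rmorphM /= fmorphV !rmorphM /= fmorphV rmorphXn rmorphN1 !rmorph_nat.
  have c0 : (n`!%:R : R[i]) != 0 by rewrite pnatr_eq0 -lt0n fact_gt0.
  have c1 : ((-1) ^+ n : R[i]) != 0 by rewrite expf_neq0 // oppr_eq0 oner_eq0.
  move: c0 c1 => /=; move: (n`!%:R) ((-1) ^+ n) ('i ^+ n.+1) (pi%:C) => f s z p c0 c1.
  by field; rewrite c0 c1.
have FF : Filter (al^') := dnbhs_filter al.
have Hl := @ccvgM _ FF _ _ _ _ (@ccvg_real _ FF _ _ Hq) (ccvg_cst FF (- 2 * (- 'i) ^+ n.+1)).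
apply: (@ccvg_near R _ FF) Hl.
near=> beta; have nb : nonint beta.
  by near: beta; apply: near_nonint; rewrite rpredN; exact: natr_int.
have nb1 := nonintS nb.
have ba : beta - al != 0 by rewrite subr_eq0 /al -[- n.+1%:R]/(- (n.+1%:Z)%:~R) -intrN; exact: nonint_neq.
have bg : 0 < beta + 1 + n.+1%:R.
  near: beta; apply: cvg_within; near=> beta; rewrite -ltrBlDr -ltrBlDr.
  near: beta; apply: lt_nbhsr; rewrite /al; lra.
rewrite B1_parity [RHS]mulrCA [LHS]mulrC; congr (_ * _).
have EG := Gamma_prod n.+1 nb1; rewrite Gamma_gt0E // big_ord_recr /= in EG.
have P0 : \prod_(j < n) (beta + 1 + j%:R) != 0.
  apply/prodf_neq0 => j _; rewrite -subr_eq0 -[j%:R]opprK subr_eq0.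
  have := nonint_neq (- (j : int)) nb1; rewrite intrN -pmulrn; apply: contraNN => /eqP h.
  by rewrite -subr_eq0 h.
have E : beta + 1 + n%:R = beta - al by rewrite /al -natr1; ring.
rewrite /q EG E /al opprK -rmorphM; congr (_%:C).
move: ba P0; rewrite /al opprK.
move: (\prod_(j < n) _) (Gamma _) (sin _) => P G s.
by move: (_ + _) => d ba P0; field; rewrite ba P0.
Unshelve. all: by end_near. Qed.

End PuncturedLimits.

(** * Transforms at integer exponents *)

Section FourierOfLimits.
Context {R : realType}.
Implicit Types (a b : R -> R) (phi psi u v : R -> R[i]) (l m z C : R[i]) (alpha beta x : R).

(** The formula for non-integer exponents with coefficients 1 and (-1)^(n+1),
    for which the coefficients on the other side are proportional to 1 and
    (-1)^(n+1) as well. *)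
Lemma pole_ccvg (n : nat) phi : schwartz phi ->
  ccvg (- n.+1%:R : R)^'
    (fun beta => x_plus beta (fourier phi) + (-1) ^+ n.+1 * x_minus beta (fourier phi))
    (pi%:C * 'i ^+ n.+1 / n`!%:R * (x_plus n%:R phi + (-1) ^+ n.+1 * x_minus n%:R phi)).
Proof.
move=> H; set al : R := - n.+1%:R; have FF : Filter (al^') := dnbhs_filter al.
have an : - al - 1 = n%:R by rewrite /al opprK -natr1 addrK.
have K psi : schwartz psi -> ccvg (al^') (fun beta => x_plus (- beta - 1) psi) (x_plus n%:R psi).
  move=> Hp; have n1 : -1 < n%:R :> R by rewrite (@lt_le_trans _ _ 0).
  have := x_plus_ccvg n1 Hp; rewrite -an.
  have Cn : {for al, continuous (fun beta => - beta - 1)}.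
    by apply: cvgB; [apply: cvgN; exact: cvg_id|exact: cvg_cst].
  have Cd : (fun beta => - beta - 1) @ al^' --> (- al - 1)^'.
    move=> A /= /nbhs_ballP[e /= e0 He]; apply/nbhs_ballP; exists e => //= t.
    rewrite /ball /= => te tn; apply: He.
      by rewrite /ball /= (_ : _ - _ = - (al - t)) ?normrN //; ring.
    by apply: contraNneq tn => h; apply/eqP; lra.
  by move=> [h1 h2]; split; [exact: (@cvg_comp _ _ _ _ (fun t => re (x_plus t psi)) _ _ _ Cd h1)|exact: (@cvg_comp _ _ _ _ (fun t => im (x_plus t psi)) _ _ _ Cd h2)].
have Kp := K _ H; have Km := K _ (schwartz_opp H).
have Hl := @ccvgM R _ FF _ _ _ _ (pole_limit n)
  (@ccvgD R _ FF _ _ _ _ Kp (@ccvgM R _ FF _ _ _ _ (ccvg_cst FF ((-1) ^+ n.+1)) Km)).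
apply: (@ccvg_near R _ FF) Hl; near=> beta.
have nb : nonint beta by near: beta; apply: near_nonint; rewrite rpredN; exact: natr_int.
have := homogeneous_fourier 1 ((-1) ^+ n.+1) nb H; rewrite mul1r => ->.
rewrite B2_parity -/(x_minus _ phi).
by rewrite -mulrA mulrDr; congr (_ * (_ + _)); rewrite mulrA [_ * B1 _ _ _]mulrC.
Unshelve. all: by end_near. Qed.

Lemma neg_int_nat (n : nat) : neg_int (- n.+1%:R : R).
Proof. by rewrite /neg_int rpredN natr_int oppr_lt0 ltr0n. Qed.

Lemma principal_value_fourier (n : nat) phi : schwartz phi ->
  principal_value n.+1 (fourier phi) =
  pi%:C * 'i ^+ n.+1 / n`!%:R * (x_plus n%:R phi + (-1) ^+ n.+1 * x_minus n%:R phi).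
Proof.
move=> H; have FF : ProperFilter ((- n.+1%:R : R)^') by exact: Proper_dnbhs_numFieldType.
have := pole_ccvg n H; rewrite /principal_value /abs_pow /abs_pow_sign /continued neg_int_nat -signr_odd.
case: ifP => _; rewrite ?expr1 ?expr0 => h; apply: clim_ccvg; apply: ccvg_near h;
  by near=> beta; rewrite ?mulN1r ?mul1r.
Unshelve. all: by end_near. Qed.

Definition cintegrable u := intg setT (re \o u) /\ intg setT (im \o u).

Lemma cintegral_linear z C u v : cintegrable u -> cintegrable v ->
  cintegral setT (fun x => z * u x + C * v x) = z * cintegral setT u + C * cintegral setT v.
Proof.
move=> [u1 u2] [v1 v2]; have lin (p q r s : R) (f g h k : R -> R) :
    intg setT f -> intg setT g -> intg setT h -> intg setT k ->
    \int[lebesgue_measure]_x (p * f x + q * g x + (r * h x + s * k x)) =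
    p * \int[lebesgue_measure]_x f x + q * \int[lebesgue_measure]_x g x +
    (r * \int[lebesgue_measure]_x h x + s * \int[lebesgue_measure]_x k x).
  move=> If Ig Ih Ik.
  have [If' Ig' Ih' Ik'] : [/\ intg setT (fun x => p * f x), intg setT (fun x => q * g x),
      intg setT (fun x => r * h x) & intg setT (fun x => s * k x)].
    by split; exact: intgZ.
  rewrite RintegralD //; [|exact: intgD|exact: intgD].
  rewrite RintegralD // RintegralD // !RintegralZl //.
apply: cext; rewrite /cintegral !reimE /=.
  have := lin (re z) (- im z) (re C) (- im C) _ _ _ _ u1 u2 v1 v2; rewrite !mulNr => <-.
  by apply: eq_Rintegral => x _; rewrite !reimE /= !mulNr.
have := lin (re z) (im z) (re C) (im C) _ _ _ _ u2 u1 v2 v1 => <-.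
by apply: eq_Rintegral => x _; rewrite !reimE /=.
Qed.

Lemma schwartz_cintegrable phi : schwartz phi -> cintegrable phi.
Proof.
by move=> /schwartzP[Ha Hb]; split; apply: intg_decay;
  [exact: sch_continuous|exact: sch_decay|exact: sch_continuous|exact: sch_decay].
Qed.

Definition mulix phi x : R[i] := 'i * x%:C * phi x.

Lemma schwartz_mulix phi : schwartz phi -> schwartz (mulix phi).
Proof.
move=> /schwartzP[Ha Hb].
have -> : mulix phi = cpl (fun x => - (x * (im \o phi) x)) (fun x => x * (re \o phi) x).
  by apply/funext => x; apply: cext; rewrite /mulix -mulrA !reimE /= ; ring.
by apply/schwartz_cpl; split; [apply: schN; exact: schMx|exact: schMx].
Qed.

(** Differentiation in xi multiplies the function by i x. *)
Lemma cderive_fourier (n : nat) phi : schwartz phi ->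
  cderive n (fourier phi) = fourier (iter n mulix phi).
Proof.
elim: n phi => [|n IH] phi H.
  by apply/funext => x; apply: cext.
rewrite iterSr -IH; last exact: schwartz_mulix.
apply/funext => x; rewrite fourierE // fourierE; last exact: schwartz_mulix.
rewrite !cderive_cpl !derive1Sn; move/schwartzP: H => [Ha Hb].
have -> : re \o mulix phi = (fun x => - (x * (im \o phi) x)).
  by apply/funext => y; rewrite /= /mulix -mulrA !reimE /=; ring.
have -> : im \o mulix phi = (fun x => x * (re \o phi) x).
  by apply/funext => y; rewrite /= /mulix -mulrA !reimE /=; ring.
move: (re \o phi) (im \o phi) Ha Hb => a b Ha Hb.
have [Hxa Hxb] := (schMx Ha, schMx Hb).
have EN : (fun x => - (x * b x)) = (fun x => -1 * (x * b x)) by apply/funext => y; rewrite mulN1r.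
congr (_ +i* _); congr (derive1n n _ x); apply: der_funE => y.
  apply: is_derive_eq (derB (Fcos_der y Ha) (Fsin_der y Hb)) _.
  by rewrite EN FcosZ // mulN1r addrC.
apply: is_derive_eq (derD (Fsin_der y Ha) (Fcos_der y Hb)) _.
by rewrite EN FsinZ // mulN1r addrC.
Qed.

Lemma fourier_at0 phi : fourier phi 0 = cintegral setT phi.
Proof.
rewrite /fourier; congr (cintegral _ _); apply/funext => x.
by rewrite mul0r /cexpi cos0 sin0; apply: cext; rewrite !reimE /=; ring.
Qed.

Lemma iter_mulix (n : nat) phi x : iter n mulix phi x = ('i * x%:C) ^+ n * phi x.
Proof.
by elim: n => [|n IH]; rewrite ?expr0 ?mul1r // iterS /mulix IH exprS mulrA.
Qed.

Lemma schwartz_iter_mulix (n : nat) phi : schwartz phi -> schwartz (iter n mulix phi).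
Proof. by move=> H; elim: n => [//|n IH]; rewrite iterS; exact: schwartz_mulix. Qed.

Lemma delta_deriv_fourier (n : nat) phi : schwartz phi ->
  delta_deriv n (fourier phi) = (-1) ^+ n * cintegral setT (iter n mulix phi).
Proof. by move=> H; rewrite /delta_deriv cderive_fourier // fourier_at0. Qed.

Lemma schXn (n : nat) a : sch a -> sch (fun x => x ^+ n * a x).
Proof.
move=> Ha; elim: n => [|n IH]; first by under eq_fun do rewrite expr0 mul1r.
by under eq_fun do rewrite exprS -mulrA; exact: schMx.
Qed.

Lemma intg_sg (n : nat) a : sch a -> intg setT (fun x => x ^+ n * Num.sg x * a x).
Proof.
move=> Ha; have Hn := schXn n Ha; have cn := sch_continuous Hn.
have mn : measurable_fun [set: measurableTypeR R] (fun x => x ^+ n * a x).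
  exact: continuous_measurable_fun.
apply: (@intg_le R setT _ (fun x => `|x ^+ n * a x|)) => //.
- have -> : (fun x => x ^+ n * Num.sg x * a x) = (fun x : R =>
      if 0 < x then x ^+ n * a x else if x < 0 then - (x ^+ n * a x) else 0).
    apply/funext => x; case: ltgtP => h.
    + by rewrite gtr0_sg // mulr1.
    + by rewrite ltr0_sg // mulrN1 mulNr.
    + by rewrite -h sgr0 mulr0 mul0r.
  apply: measurable_fun_ifT => //; first exact: measurable_fun_ltr.
  apply: measurable_fun_ifT => //; first exact: measurable_fun_ltr.
  exact: measurableT_comp.
- move=> x _; rewrite mulrAC normrM ler_piMr // normr_sg.
  by case: eqP => // _; rewrite ?lexx ?ler01.
- by apply: integrable_norm => //; apply: intg_decay => //; exact: sch_decay.
Qed.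

Lemma Rint_sg (n : nat) a : sch a ->
  \int[lebesgue_measure]_x (x ^+ n * Num.sg x * a x) =
  rplus n%:R a + (-1) ^+ n.+1 * rplus n%:R (fun x => a (- x)).
Proof.
move=> Ha; have HN := sch_opp Ha.
have n1 : -1 < n%:R :> R by rewrite (@lt_le_trans _ _ 0).
have E x : (- x) ^+ n * Num.sg (- x) * a (- x) = (-1) ^+ n.+1 * (x ^+ n * Num.sg x * a (- x)).
  rewrite [(- x) ^+ n]exprNn sgrN exprS.
  by move: (Num.sg x) (x ^+ n) ((-1) ^+ n) (a _) => *; ring.
rewrite Rint_split; first last.
- apply: intg_eq (intgZ ((-1) ^+ n.+1) measurableT (intg_sg n HN)) => //.
- exact: intg_sg.
- by apply: intg_meas; exact: intg_sg.
rewrite !rplusE // /mellin; congr (_ + _).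
  by apply: eq_Rintegral => x /set_mem /in0y x0; rewrite gtr0_sg // mulr1 powR_mulrn // ltW.
rewrite -RintegralZl //; last exact: mellin_intg (sch_hcont HN) (sch_hdecay HN).
apply: eq_Rintegral => x /set_mem /in0y x0.
by rewrite E gtr0_sg // mulr1 powR_mulrn // ltW.
Qed.

Lemma cintegral_sg (n : nat) phi : schwartz phi ->
  cintegral setT (fun x => (x ^+ n * Num.sg x)%:C * phi x) =
  x_plus n%:R phi + (-1) ^+ n.+1 * x_minus n%:R phi.
Proof.
move=> /schwartzP[Ha Hb]; rewrite /x_minus !x_plusE.
have -> : (-1) ^+ n.+1 = ((-1) ^+ n.+1)%:C :> R[i] by rewrite rmorphXn rmorphN1.
apply: cext; rewrite !reimE /=; rewrite -(Rint_sg n Ha) || rewrite -(Rint_sg n Hb).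
  by apply: eq_Rintegral => x _; rewrite reMR.
by apply: eq_Rintegral => x _; rewrite imMR.
Qed.

(** At non-integer exponents this is [homogeneous_fourier], at natural
    exponents its limit, where the left-hand side is continuous in the
    exponent, and at negative integers it follows from
    [principal_value_fourier] and [delta_deriv_fourier]. *)
Theorem fourier_limit_infty alpha C1 C2 :
  eqD (fourierD (limit_infty alpha C1 C2)) (limit_zero alpha C1 C2).
Proof.
move=> phi H; rewrite /fourierD /limit_infty /limit_zero.
have HF := schwartz_fourier H.
have [ni|ni] := boolP (neg_int alpha).
  move: (ni) => /andP[/intrP[p Ep] a0].
  have [n En] : exists n : nat, alpha = - n.+1%:R.
    move: a0; rewrite Ep ltrz0; case: p {Ep} => // n _; exists n.
    by rewrite NegzE mulrNz.
  have -> : Num.truncn (- alpha) = n.+1 by rewrite En opprK natrK.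
  rewrite principal_value_fourier // delta_deriv_fourier //= -cintegral_sg //.
  have I1 : cintegrable (fun x => (x ^+ n * Num.sg x)%:C * phi x).
    move/schwartzP: H => [Ha Hb]; split.
      by apply: intg_eq (intg_sg n Ha) => // x _; rewrite /= reMR.
    by apply: intg_eq (intg_sg n Hb) => // x _; rewrite /= imMR.
  have I2 := schwartz_cintegrable (schwartz_iter_mulix n H).
  rewrite !mulrA -cintegral_linear //; congr (cintegral _ _); apply/funext => x.
  rewrite iter_mulix mulrDl.
  have -> : (- 'i * x%:C) ^+ n = (-1) ^+ n * ('i * x%:C) ^+ n by rewrite mulNr [LHS]exprNn.
  by rewrite !mulrA.
have aN n : alpha != - n.+1%:R.
  by apply: contraNneq ni => ->; exact: neg_int_nat.
rewrite /continued; case: ifPn => [an|an].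
  have FF : ProperFilter (alpha^') by exact: Proper_dnbhs_numFieldType.
  have /natrP[n En] := an.
  have a1 : -1 < alpha by rewrite En (@lt_le_trans _ _ 0).
  apply/esym/clim_ccvg.
  have Kp := x_plus_ccvg a1 HF; have Km := x_plus_ccvg a1 (schwartz_opp HF).
  have F' : Filter (alpha^') := dnbhs_filter alpha.
  have Hl := @ccvgD R _ F' _ _ _ _ (@ccvgM R _ F' _ _ _ _ (ccvg_cst F' C1) Kp)
    (@ccvgM R _ F' _ _ _ _ (ccvg_cst F' C2) Km).
  apply: (@ccvg_near R _ F') Hl; near=> beta.
  apply: homogeneous_fourier => //; near: beta; apply: near_nonint.
  by rewrite En natr_int.
rewrite homogeneous_fourier //.
apply/negP => ai; have := natrEint alpha; rewrite ai (negbTE an) /= => /esym /negbT.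
by rewrite -ltNge => a0; move: ni; rewrite /neg_int ai a0.
Unshelve. all: by end_near. Qed.

End FourierOfLimits.

(** * Exchange of infinity and zero *)

Section Transfer.
Context {R : realType}.
Implicit Types (phi psi : R -> R[i]) (f g h : @functional R) (rho : R -> R).
Implicit Types (alpha gam delta s t : R) (C D : R[i]).

(** Dilation of a function by t dilates its transform by 1/t and divides it by
    t. *)
Lemma dilate_fourier f t phi : tempered f -> 0 < t -> schwartz phi ->
  dilate (fourierD f) t^-1 phi = t%:C * dilate f t (fourier phi).
Proof.
move=> Tf t0 H; rewrite /dilate /fourierD invrK.
have -> : fourier (fun x => phi (x * t)) = (fun xi => (t^-1)%:C * fourier phi (xi / t)).
  by apply/funext => xi; rewrite fourier_dilate.
rewrite temperedM //; apply: schwartz_scale; last exact: schwartz_fourier.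
by rewrite invr_neq0 // gt_eqF.
Qed.

Lemma homogeneous_fourierD h gam : tempered h -> homogeneous h gam ->
  homogeneous (fourierD h) (- gam - 1).
Proof.
move=> Th Hh s phi s0 H; have si : 0 < s^-1 by rewrite invr_gt0.
have := dilate_fourier Th si H; rewrite invrK => ->.
rewrite Hh //; last exact: schwartz_fourier.
rewrite mulrA -rmorphM /=; congr (_%:C * _).
rewrite -{1}(powR_inv1 (ltW s0)) -(powR_inv1 (ltW s0)) -powRrM -powRD; last by rewrite (gt_eqF s0) implybT.
by congr (_ `^ _); ring.
Qed.

Lemma fourier_inv_eq h : tempered h -> eqD (fun phi => h (fourier_inv phi))
  (fun phi => (@fourier_const R)^-1%:C * fourierD h (fun x => phi (- x))).
Proof.
move=> Th phi H; rewrite /fourier_inv temperedM //.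
by apply: schwartz_fourier; exact: schwartz_opp.
Qed.

Lemma eqD_sym f g : eqD f g -> eqD g f. Proof. by move=> E phi H; rewrite E. Qed.

Lemma tempered_fourier_inv h : tempered h -> tempered (fun phi => h (fourier_inv phi)).
Proof.
move=> Th; apply: eqD_tempered (eqD_sym (fourier_inv_eq Th)) _.
by apply: temperedZ; apply: (tempered_opp (f := fourierD h)); exact: tempered_fourierD.
Qed.

Lemma homogeneous_fourier_inv h gam : tempered h -> homogeneous h gam ->
  homogeneous (fun phi => h (fourier_inv phi)) (- gam - 1).
Proof.
move=> Th Hh s phi s0 H.
have Hs : schwartz (fun x => phi (x / s)).
  by apply: schwartz_scale => //; rewrite invr_neq0 // gt_eqF.
have E := fourier_inv_eq Th; rewrite {1}/dilate !E //.
have := homogeneous_fourierD Th Hh s0 (schwartz_opp H); rewrite /dilate.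
under eq_fun do rewrite -mulNr.
by rewrite mulrCA => ->; rewrite mulrCA.
Qed.

Lemma cintegral_Xn (n : nat) phi : schwartz phi ->
  cintegral setT (fun x => (x ^+ n)%:C * phi x) = x_plus n%:R phi + (-1) ^+ n * x_minus n%:R phi.
Proof.
move=> /schwartzP[Ha Hb]; rewrite /x_minus !x_plusE.
have K (a : R -> R) : sch a -> \int[lebesgue_measure]_x (x ^+ n * a x) =
    rplus n%:R a + (-1) ^+ n * rplus n%:R (fun x => a (- x)).
  move=> Hs; have HN := sch_opp Hs; have Hn := schXn n Hs.
  have n1 : -1 < n%:R :> R by rewrite (@lt_le_trans _ _ 0).
  have I (b : R -> R) : sch b -> intg setT b.
    by move=> Hb'; apply: intg_decay; [exact: sch_continuous|exact: sch_decay].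
  rewrite Rint_split; first last.
  - exact: I (sch_opp Hn).
  - exact: I.
  - by apply: intg_meas; exact: I.
  rewrite !rplusE // /mellin; congr (_ + _).
    by apply: eq_Rintegral => x /set_mem /in0y x0; rewrite powR_mulrn // ltW.
  rewrite -RintegralZl //; last exact: mellin_intg (sch_hcont HN) (sch_hdecay HN).
  apply: eq_Rintegral => x /set_mem /in0y x0.
  by rewrite powR_mulrn ?ltW // [(- x) ^+ n]exprNn mulrA.
have -> : (-1) ^+ n = ((-1) ^+ n)%:C :> R[i] by rewrite rmorphXn rmorphN1.
apply: cext; rewrite !reimE /=; rewrite -(K _ Ha) || rewrite -(K _ Hb).
  by apply: eq_Rintegral => x _; rewrite reMR.
by apply: eq_Rintegral => x _; rewrite imMR.
Qed.

Lemma limit_zero_neg_int (n : nat) C D phi : schwartz phi ->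
  limit_zero (- n.+1%:R) C D phi =
  C * (pi%:C * 'i ^+ n.+1 / n`!%:R) * (x_plus n%:R phi - (-1) ^+ n * x_minus n%:R phi) +
  D * (- 'i) ^+ n * (x_plus n%:R phi + (-1) ^+ n * x_minus n%:R phi).
Proof.
move=> H; rewrite /limit_zero neg_int_nat opprK natrK /=.
have -> : x_plus n%:R phi - (-1) ^+ n * x_minus n%:R phi =
    x_plus n%:R phi + (-1) ^+ n.+1 * x_minus n%:R phi by rewrite exprS mulN1r mulNr.
rewrite -cintegral_Xn // -cintegral_sg // -cintegral_linear.
- congr (cintegral _ _); apply/funext => x; rewrite mulrDl exprMn !mulrA.
  by congr (_ + _ * _ * _); rewrite rmorphXn.
- move/schwartzP: H => [Ha Hb]; split.
    by apply: intg_eq (intg_sg n Ha) => // x _; rewrite /= reMR.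
  by apply: intg_eq (intg_sg n Hb) => // x _; rewrite /= imMR.
- apply: schwartz_cintegrable; move/schwartzP: H => [Ha Hb]; apply/schwartzP; split.
    by have := schXn n Ha; congr sch; apply/funext => x /=; rewrite reMR.
  by have := schXn n Hb; congr sch; apply/funext => x /=; rewrite imMR.
Qed.

(** Degrees greater than -1 are covered by [classification]. Otherwise the
    Fourier transform of g is, being homogeneous of degree at least 0; by
    inversion it suffices to write it as the transform of a [limit_infty]. *)
Lemma homogeneous_limit_infty g alpha : tempered g -> homogeneous g alpha ->
  exists C1 C2, eqD g (limit_infty alpha C1 C2).
Proof.
move=> Tg Hg; have [a1|a1] := ltP (-1) alpha.
  have [C1 [C2 E]] := classification a1 Tg Hg; exists C1, C2 => phi H.
  rewrite E // /limit_infty ifN //; apply/negP => /andP[/intrP[p Ep]]; move: a1; rewrite Ep.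
  by rewrite -[-1]/((-1)%:~R) -[0]/(0%:~R) !ltr_int; lia.
have Th := tempered_fourierD Tg; have Hh := homogeneous_fourierD Tg Hg.
have g1 : -1 < - alpha - 1 by lra.
have [D1 [D2 E]] := classification g1 Th Hh.
have [ai|ai] := boolP (alpha \is a Num.int).
  have [n En] : exists n : nat, alpha = - n.+1%:R.
    move/intrP: ai a1 => [p ->]; rewrite -[-1]/((-1)%:~R) ler_int.
    case: p => // n _; exists n; by rewrite NegzE mulrNz.
  have En' : - alpha - 1 = n%:R by rewrite En opprK -natr1 addrK.
  rewrite En' in E.
  have c0 : pi%:C * 'i ^+ n.+1 / n`!%:R != 0 :> R[i].
    rewrite !mulf_neq0 ?invr_neq0 //.
    - by rewrite fmorph_eq0 gt_eqF // pi_gt0.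
    - by rewrite expf_neq0 // neq0Ci.
  have d0 : (- 'i) ^+ n != 0 :> R[i] by rewrite expf_neq0 // oppr_eq0 neq0Ci.
  (* The coefficients that solve the linear system given by
     [limit_zero_neg_int]. *)
  exists ((D1 - (-1) ^+ n * D2) / (2 * (pi%:C * 'i ^+ n.+1 / n`!%:R))).
  exists ((D1 + (-1) ^+ n * D2) / (2 * (- 'i) ^+ n)).
  move=> phi H; rewrite -(fourier_invK H) -[g _]/(fourierD g (fourier_inv phi)).
  have Hi := schwartz_fourier_inv H.
  rewrite -[RHS]/(fourierD (limit_infty _ _ _) (fourier_inv phi)) fourier_limit_infty //.
  rewrite E // En limit_zero_neg_int //.
  have ss : (-1) ^+ n * (-1) ^+ n = 1 :> R[i] by rewrite -exprMn mulrNN mulr1 expr1n.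
  move: (x_plus _ _) (x_minus _ _) (pi%:C * _ / _) ((- 'i) ^+ n) c0 d0 ss => p m c d c0 d0.
  move: ((-1) ^+ n) => s ss.
  have -> : (D1 - s * D2) / (2 * c) * c * (p - s * m) + (D1 + s * D2) / (2 * d) * d * (p + s * m) =
      D1 * p + (s * s) * D2 * m by field; rewrite c0 d0.
  by rewrite ss mul1r.
(* The inverse transform of D1 x_+ + D2 x_- is, up to the constant, its
   transform reflected; the reflection exchanges B1 and B2. *)
pose G : R[i] := (@fourier_const R)^-1%:C * (Gamma (- alpha - 1 + 1))%:C.
exists (G * B2 (- alpha - 1) D1 D2), (G * B1 (- alpha - 1) D1 D2) => phi H.
have HN := schwartz_opp H; have ng : nonint (- alpha - 1) by exact/nonintP/nonintN.
rewrite -{1}(fourier_invK H) -[LHS]/(fourierD g (fourier_inv phi)) fourier_inv_eq //.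
rewrite -[fourierD (fourierD g) _]/(fourierD g (fourier _)).
rewrite E; last exact: schwartz_fourier.
rewrite homogeneous_fourier // (_ : - (- alpha - 1) - 1 = alpha); last by ring.
have -> : x_minus alpha (fun x => phi (- x)) = x_plus alpha phi.
  by rewrite /x_minus; under eq_fun do rewrite opprK.
rewrite -/(x_minus alpha phi) /limit_infty /neg_int (negbTE ai) /= /G.
move: (B1 _ _ _) (B2 _ _ _) (x_plus _ _) (x_minus _ _) (_%:C) (_%:C) => *; ring.
Qed.

Lemma automodel_powR alpha delta rho : automodel alpha rho ->
  automodel (alpha + delta) (fun t => t `^ delta * rho t).
Proof.
move=> [p0 cr lr]; split.
- by move=> t t0; rewrite mulr_gt0 ?powR_gt0 ?p0.
- by move=> t t0; apply: cvgM; [exact: powR_continuous|exact: cr].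
- move=> a a0; rewrite powRD; last by rewrite (gt_eqF a0) implybT.
  rewrite mulrC; apply: (@cvg_trans _ ((fun t => a `^ delta * (rho (t * a) / rho t)) @ +oo%R)).
    apply: near_eq_cvg; near=> t; have t0 : 0 < t by near: t; exact: nbhs_pinfty_gt.
    rewrite powRM ?(ltW t0) ?(ltW a0) //.
    by field; rewrite !gt_eqF ?powR_gt0 ?p0.
  by apply: cvgM; [exact: cvg_cst|exact: lr].
Unshelve. all: by end_near. Qed.

(** The regularly varying functions for f and F[f] are rho(t) and t rho(t),
    and the two conditions of convergence are the same for phi and F[phi]. *)
Lemma quasi_asymp_fourier f g h alpha : tempered f -> eqD (fourierD g) h ->
  quasi_asymp_infty f alpha g <-> quasi_asymp_zero (fourierD f) (- alpha - 1) h.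
Proof.
move=> Tf E; split.
  move=> [_ Tg [phi0 H0 n0] [rho Hrho L]]; split.
  - exact: tempered_fourierD.
  - by apply: eqD_tempered E _; exact: tempered_fourierD.
  - have Hi := schwartz_fourier_inv H0; exists (fourier_inv phi0) => //.
    by rewrite -E // /fourierD fourier_invK.
  - exists (fun t => t `^ 1 * rho t).
      by have := automodel_powR 1 Hrho; congr automodel; ring.
    move=> phi H; rewrite -E //; apply: ccvg_near (L _ (schwartz_fourier H)).
    near=> t; have t0 : 0 < t by near: t; exact: nbhs_pinfty_gt.
    rewrite dilate_fourier // mulrA -rmorphM /= powRr1 ?(ltW t0) //.
    congr (_%:C * _); have [p0 _ _] := Hrho; field.
    by rewrite !gt_eqF ?p0.
move=> [_ Th [phi0 H0 n0] [rho Hrho L]].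
have Eg : eqD (fun phi => h (fourier_inv phi)) g.
  move=> phi H; rewrite -E; last exact: schwartz_fourier_inv.
  by rewrite /fourierD fourier_invK.
split => //.
- by apply: eqD_tempered Eg _; exact: tempered_fourier_inv.
- by exists (fourier phi0); [exact: schwartz_fourier|rewrite -[g _]/(fourierD g phi0) E].
- exists (fun t => t `^ (-1) * rho t).
    by have := automodel_powR (-1) Hrho; congr automodel; ring.
  move=> phi H; rewrite -Eg //; have Hi := schwartz_fourier_inv H.
  apply: ccvg_near (L _ Hi); near=> t.
  have t0 : 0 < t by near: t; exact: nbhs_pinfty_gt.
  rewrite dilate_fourier // fourier_invK // mulrA -rmorphM /= powR_inv1 ?(ltW t0) //.
  congr (_%:C * _); have [p0 _ _] := Hrho; field.
  by rewrite !gt_eqF ?p0.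
Unshelve. all: by end_near. Qed.

End Transfer.

Theorem theorem3p2 (R : realType) (f : (R -> R[i]) -> R[i]) (alpha : R)
    (hf : tempered f) :
  (forall g : (R -> R[i]) -> R[i], quasi_asymp_infty f alpha g ->
     exists C1 C2 : R[i], eqD g (limit_infty alpha C1 C2)) /\
  (forall h : (R -> R[i]) -> R[i],
     quasi_asymp_zero (fourierD f) (- alpha - 1) h ->
     exists C1 C2 : R[i], eqD h (limit_zero alpha C1 C2)) /\
  (forall C1 C2 : R[i],
     eqD (fourierD (limit_infty alpha C1 C2)) (limit_zero alpha C1 C2) /\
     (quasi_asymp_infty f alpha (limit_infty alpha C1 C2) <->
      quasi_asymp_zero (fourierD f) (- alpha - 1)
        (limit_zero alpha C1 C2))).
Proof.
split; [|split].
- move=> g Hg; have [_ Tg _ _] := Hg.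
  exact: homogeneous_limit_infty Tg (homogeneous_infty Hg).
- move=> h Hh; have [_ Th _ _] := Hh.
  have Hi := homogeneous_fourier_inv Th (homogeneous_zero Hh).
  rewrite (_ : - _ - 1 = alpha) in Hi; last by ring.
  have [C1 [C2 E]] := homogeneous_limit_infty (tempered_fourier_inv Th) Hi.
  exists C1, C2 => phi H; rewrite -fourier_limit_infty // /fourierD -E ?fourierK //.
  exact: schwartz_fourier.
- move=> C1 C2; have E := @fourier_limit_infty R alpha C1 C2.
  by split=> //; exact: quasi_asymp_fourier.
Qed.
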